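(* Consider the control-free case. Let $\mathbb{X},\mathbb{Y},\mathbb{U}$ be compact and let $Q(\cdot|x)$ and $\mathcal{T}(\cdot|x)$ be weakly continuous in $x$. Suppose that either (S) $\{X_t\}$ is stationary, or (B, D) the stochastic kernel $\kappa(dx|y)=P(X_t\in dx|Y_{(-\infty,t]}=y)$ is weakly continuous in $y$ (product topology) and, for every Borel $B\subset\mathbb{X}$ and almost every $y$, $P(X_t\in B|Y_{(-\infty,t]}=y)=P(X_{t+1}\in B|Y_{(-\infty,t+1]}=y)$. Then an optimal decision/control policy for the average cost criterion exists, and this policy is stationary, i.e. of the form $U_t=\gamma(Y_{(-\infty,t]},R_t)$ for a measurable $\gamma$ not depending on $t$ and an i.i.d. sequence $R_t$.
   Context: Model (control-free): $\mathbb{X}$, $\mathbb{Y}$ are standard Borel (Polish) spaces, and $\mathbb{U}$ is a metric decision space. $\{X_t\}$ is a Markov chain with kernel $\mathcal{T}(B|x)=P(X_{t+1}\in B|X_t=x)$, not affected by decisions, and $Y_t=G(X_t,V_t)$ with $V_t$ i.i.d. and independent of the state noise; $Q(C|x)=P(Y_t\in C|X_t=x)$. The stage cost $c:\mathbb{X}\times\mathbb{U}\to\mathbb{R}_+$ is bounded and continuous; decisions enter only through the cost. Average cost: $\limsup_{N\to\infty}\frac1N E[\sum_{t=0}^{N-1}c(X_t,U_t)]$. Infinite past: measurements are assumed to have been taking place since $-\infty$ (under (S) the stationary process is extended to a two-sided stationary process); $\mathbb{Y}^{\mathbb{Z}_-}$ is the one-sided product over $\{\dots,-1,0\}$ with the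 product topology, and $Y_{(-\infty,t]}$ is viewed as $\mathbb{Y}^{\mathbb{Z}_-}$-valued. Admissible decisions are those for which, for each $t$, $U_t$ and $X_t$ are conditionally independent given $Y_{(-\infty,t]}$. The policy is optimal in the sense that, under an associated invariant initial law of $(X_0,Y_{(-\infty,0]})$ (under (S), the given stationary law), its average cost is minimal among those of all admissible policies. *)

(* Defs.v *)
From HB Require Import structures.
From mathcomp Require Import all_boot all_order all_algebra.
From mathcomp Require Import all_classical all_reals all_analysis.
From mathcomp Require Import measurable_realfun.

Set Implicit Arguments.
Unset Strict Implicit.
Unset Printing Implicit Defensive.
Import Order.TTheory GRing.Theory Num.Theory.
Import numFieldNormedType.Exports.
Local Open Scope classical_set_scope.
Local Open Scope ring_scope.
Local Open Scope ereal_scope.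

(* Metric spaces with a base point; [measurableType] requires pointedness. *)
#[short(type="pmetricType")]
HB.structure Definition PMetric (K : numDomainType) :=
  {M of PseudoPointedMetric K M & PseudoMetric_isMetric K M}.

(* A topological space equipped with its Borel sigma-algebra. *)
Notation borel X := (g_sigma_algebraType (@open X)).

(* A history h stands for a point (..., y_{-1}, y_0) of the product over the
   nonpositive times, with h k = y_{-k}. *)
Notation history Y := {ptws nat -> Y}.

Section Kernels.
Context {R : realType}.

Definition weakly_continuous (S : topologicalType)
    (E : ptopologicalType) (k : S -> {measure set (borel E) -> \bar R}) : Prop :=
  forall f : E -> R, continuous f -> (exists M, forall y, `|f y| <= M)%R ->
  continuous (fun s => (\int[k s]_y f y)%R).

End Kernels.

Section Conditioning.
Context {R : realType} {d : measure_display} {O : measurableType d}.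
Variable P : probability O R.

(* The sigma-algebra generated by the Z i, for i in D. *)
Definition sigma_of d1 (S : measurableType d1) (I : Type) (D : set I)
    (Z : I -> O -> S) : set (set O) :=
  <<s \bigcup_(i in D) preimage_set_system setT (Z i) measurable >>.

Definition indep_sigma (F G : set (set O)) : Prop :=
  forall A B, F A -> G B -> P (A `&` B) = P A * P B.

Definition iid d1 (S : measurableType d1) (I : eqType)
    (rho : probability S R) (Z : I -> O -> S) : Prop :=
  (forall i, measurable_fun setT (Z i)) /\
  forall (s : seq I) (C : I -> set S), uniq s ->
    (forall i, measurable (C i)) ->
    P (\big[setI/setT]_(i <- s) (Z i @^-1` C i)) =
    \prod_(i <- s) rho (C i).

(* f is a version of h |-> P(E | H = h). *)
Definition cond_prob d1 (S : measurableType d1) (H : O -> S) (E : set O)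
    (f : S -> \bar R) : Prop :=
  [/\ measurable_fun setT f, (forall h, 0 <= f h) &
      forall C, measurable C ->
        \int[P]_(w in H @^-1` C) f (H w) = P (E `&` H @^-1` C)].

(* k is a regular conditional distribution of Z given H. *)
Definition cond_dist d1 d2 (S : measurableType d1) (E : measurableType d2)
    (H : O -> S) (Z : O -> E) (k : S -> {measure set E -> \bar R}) : Prop :=
  forall B, measurable B -> cond_prob H (Z @^-1` B) (fun h => k h B).

(* Conditional probabilities given H exist and are unique almost surely, so the
   condition does not depend on the versions f and g. *)
Definition cond_indep d1 d2 d3 (S : measurableType d1) (E : measurableType d2)
    (F : measurableType d3) (H : O -> S) (Z : O -> E) (W : O -> F) : Prop :=
  forall A B, measurable A -> measurable B ->
  exists f g : S -> \bar R,
    [/\ cond_prob H (Z @^-1` A) f, cond_prob H (W @^-1` B) g &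
        cond_prob H (Z @^-1` A `&` W @^-1` B) (fun h => f h * g h)].

Definition strictly_stationary d1 (S : measurableType d1)
    (Z : int -> O -> S) : Prop :=
  forall (h : int) (s : seq int) (C : int -> set S),
    (forall i, measurable (C i)) ->
    P (\big[setI/setT]_(i <- s) (Z (i + h)%R @^-1` C i)) =
    P (\big[setI/setT]_(i <- s) (Z i @^-1` C i)).

Definition has_law d1 (S : measurableType d1) (Z : O -> S)
    (mu : probability S R) : Prop :=
  measurable_fun setT Z /\ forall E, measurable E -> P (Z @^-1` E) = mu E.

End Conditioning.

Section Model.
Context {R : realType} {X Y U : pmetricType R}.
Context {dV : measure_display} {VT : measurableType dV}.
Variables (G : borel X * VT -> borel Y) (pV : probability VT R).
Variables (T : R.-pker (borel X) ~> (borel X))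
          (Q : R.-pker (borel X) ~> (borel Y)).

Section Process.
Context {d : measure_display} {O : measurableType d}.

(* Decisions do not act on the state, so the uncontrolled pair (Xt, Vt)
   describes the whole system.  As Xt is driven by the state noise only, the
   independence of the measurement noise from the state noise is that of the
   processes Vt and Xt. *)
Record control_free (P : probability O R) (Xt : int -> O -> borel X)
    (Vt : int -> O -> VT) : Prop := {
  state_measurable : forall t, measurable_fun setT (Xt t) ;
  state_markov : forall (t : int) (A : set O) (B : set (borel X)),
    sigma_of [set s : int | (s <= t)%R] Xt A -> measurable B ->
    P (A `&` Xt (t + 1)%R @^-1` B) = \int[P]_(w in A) T (Xt t w) B ;
  noise_iid : iid P pV Vt ;
  noise_indep : indep_sigma P (sigma_of setT Xt) (sigma_of setT Vt) }.

Definition measurement (Xt : int -> O -> borel X) (Vt : int -> O -> VT)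
    (t : int) (w : O) : borel Y := G (Xt t w, Vt t w).

(* The random history Y_{(-oo,t]}. *)
Definition past (Xt : int -> O -> borel X) (Vt : int -> O -> VT)
    (t : int) (w : O) : borel (history Y) :=
  fun k : nat => measurement Xt Vt (t - k%:Z)%R w.

Definition admissible (P : probability O R) (Xt : int -> O -> borel X)
    (Vt : int -> O -> VT) (Ut : nat -> O -> borel U) : Prop :=
  forall t : nat, measurable_fun setT (Ut t) /\
    cond_indep P (past Xt Vt t%:Z) (Xt t%:Z) (Ut t).

Definition average_cost (c : X -> U -> R) (P : probability O R)
    (Xt : int -> O -> borel X) (Ut : nat -> O -> borel U) : \bar R :=
  limn_esup (fun N : nat => (N%:R^-1)%:E *
    'E_P[fun w => (\sum_(0 <= t < N) c (Xt t%:Z w) (Ut t w))%R]).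

(* Rt is an i.i.d. randomization with law rho, independent of the system. *)
Definition randomization (P : probability O R) (Xt : int -> O -> borel X)
    (Vt : int -> O -> VT) (rho : probability R R) (Rt : nat -> O -> R) : Prop :=
  iid P rho Rt /\
  indep_sigma P (sigma_of setT (fun t w => (Xt t w, Vt t w)))
                (sigma_of setT Rt).

Definition stationary_policy (gamma : borel (history Y) * R -> borel U)
    (Xt : int -> O -> borel X) (Vt : int -> O -> VT) (Rt : nat -> O -> R)
    (t : nat) (w : O) : borel U :=
  gamma (past Xt Vt t%:Z w, Rt t w).

(* kappa is weakly continuous and is the conditional distribution of the state
   given the past measurements at every decision time: the same kernel serves
   for t and t + 1, and the almost sure statements at time t refer to the law
   of the past at time t. *)
Definition homogeneous_filter (P : probability O R)
    (Xt : int -> O -> borel X) (Vt : int -> O -> VT)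
    (kappa : R.-pker (borel (history Y)) ~> (borel X)) : Prop :=
  weakly_continuous
    (kappa : history Y -> {measure set (borel X) -> \bar R}) /\
  forall t : nat, cond_dist P (past Xt Vt t%:Z) (Xt t%:Z) kappa.

Definition initial_law (P : probability O R)
    (Xt : int -> O -> borel X) (Vt : int -> O -> VT)
    (mu : probability (borel X * borel (history Y))%type R) : Prop :=
  has_law P (fun w => (Xt 0%R w, past Xt Vt 0%R w)) mu.

End Process.

Definition extend (y : Y) (h : history Y) : history Y :=
  fun k : nat => if k is k'.+1 then h k' else y.

(* Invariance for the Markov chain (X_t, Y_{(-oo,t]}): draw x' from T(.|x), then
   the new measurement y' from Q(.|x'). *)
Definition invariant_law
    (mu : probability (borel X * borel (history Y))%type R) : Prop :=
  forall E : set (borel X * borel (history Y)), measurable E ->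
  mu E = \int[mu]_p \int[T p.1]_x' Q x' [set y' | E (x', extend y' p.2)].

(* The two processes compared may live on different probability spaces: the
   competitor is any admissible policy for any realization of the system with
   initial law mu. *)
Definition optimal_stationary_policy (c : X -> U -> R)
    (mu : probability (borel X * borel (history Y))%type R)
    (rho : probability R R)
    (gamma : borel (history Y) * R -> borel U) : Prop :=
  forall (d : measure_display) (O : measurableType d) (P : probability O R)
    (Xt : int -> O -> borel X) (Vt : int -> O -> VT) (Rt : nat -> O -> R),
  control_free P Xt Vt -> initial_law P Xt Vt mu ->
  randomization P Xt Vt rho Rt ->
  let Ut := stationary_policy gamma Xt Vt Rt in
  admissible P Xt Vt Ut /\
  forall (d' : measure_display) (O' : measurableType d')
    (P' : probability O' R) (Xt' : int -> O' -> borel X)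
    (Vt' : int -> O' -> VT) (Ut' : nat -> O' -> borel U),
  control_free P' Xt' Vt' -> initial_law P' Xt' Vt' mu ->
  admissible P' Xt' Vt' Ut' ->
  average_cost c P Xt Ut <= average_cost c P' Xt' Ut'.

Definition realizable
    (mu : probability (borel X * borel (history Y))%type R)
    (rho : probability R R) : Prop :=
  exists (d : measure_display) (O : measurableType d) (P : probability O R)
    (Xt : int -> O -> borel X) (Vt : int -> O -> VT) (Rt : nat -> O -> R),
  [/\ control_free P Xt Vt, initial_law P Xt Vt mu &
      randomization P Xt Vt rho Rt].

End Model.

(* Main.v *)
Require Import Defs.
From HB Require Import structures.
From mathcomp Require Import all_boot all_order all_algebra.
From mathcomp Require Import all_classical all_reals all_analysis.
From mathcomp Require Import measurable_realfun finmap.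
Import Order.TTheory GRing.Theory Num.Theory.
Import numFieldNormedType.Exports.
Local Open Scope classical_set_scope.
Local Open Scope ring_scope.
Set Implicit Arguments.
Unset Strict Implicit.

(** Decisions affect neither the states nor the measurements, so under an
    invariant law [mu] of (X_t, Y_(-oo,t]) it is optimal to minimise, at every
    time, the conditional mean of [c X_t u] given the past; the minimiser is one
    measurable function of the past, the same at all times, and needs no
    randomization (the policy below ignores [R_t], which is a constant).

    A minimiser is selected through a continuous surjection of the Cantor space
    onto the compact decision space: one follows greedily the lexicographically
    least sequence of bits along which the conditional means of the costs of
    finite words tend to their infimum.  A competing admissible decision U_t is
    conditionally independent of X_t given the past, so that conditioning on
    U_t in a small set only reweights the past and cannot lower the cost below
    that of the minimiser.

    In the stationary case [mu] is the given stationary law.  Otherwise [mu]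
    comes from a Banach limit of the laws of the shifted two-sided trajectories:
    it defines a shift-invariant measure on a compact space, and weak continuity
    transfers to it the Markov property, the measurement channel and the filter
    identity, which are equalities of integrals of continuous functions that hold
    at every time. *)

(** * Borel sigma-algebras of product spaces *)

(** Two obstacles shape the construction. The conditional mean of the cost is only a version, chosen
    separately for each decision, so nothing is known about its dependence on the decision; it is
    therefore evaluated at countably many decisions only, and continuity of [c] is used under the
    integral, never under the conditional mean. The Banach limit, on the other hand, controls closed
    sets and continuous functions only. The noise space carries no topology and [G] is merely
    measurable, so the limit is taken on trajectories of states and measurements; a realization of
    the model is then rebuilt from the limit states and an independent copy of the old noise, and
    its measurements have to be shown to agree in law with the limit ones. Integrating the
    measurements out through [Q] does this, and it also reduces the invariance of [mu] to that of
    the law of the states. Optimality is proved stage by stage: under an invariant law every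
    realization has the same law of (X_t, Y_(-oo,t]) at all decision times. *)

HB.instance Definition _ (I : Type) (K : I -> ptopologicalType) :=
  Pointed.on (prod_topology K).
HB.instance Definition _ (K L : ptopologicalType) := Pointed.on (K * L)%type.

Lemma open_borel (K : ptopologicalType) (U : set K) :
  open U -> measurable (U : set (borel K)).
Proof. by move=> oU; exact: sub_sigma_algebra. Qed.

Lemma closed_borel (K : ptopologicalType) (F : set K) :
  closed F -> measurable (F : set (borel K)).
Proof.
move=> cF; rewrite -(setCK F); apply: measurableC.
by apply: open_borel; exact: closed_openC.
Qed.

Lemma measurable_fun_borel d (O : measurableType d) (K : ptopologicalType)
    (f : O -> borel K) :
  (forall U : set K, open U -> measurable (f @^-1` U)) -> measurable_fun setT f.
Proof.
move=> mf; apply: (@measurability _ _ _ _ _ _ (@open K : set (set (borel K))) erefl) => _ [U oU <-].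
by rewrite setTI; exact: mf.
Qed.

Lemma continuous_measurable (K L : ptopologicalType) (f : K -> L) :
  continuous f -> measurable_fun setT (f : borel K -> borel L).
Proof.
move=> /continuousP cf; apply: measurable_fun_borel => U /cf oU.
exact: open_borel.
Qed.

Lemma continuous_measurableR (R : realType) (K : ptopologicalType) (f : K -> R) :
  continuous f -> measurable_fun setT (f : borel K -> R).
Proof.
move=> /continuousP cf.
apply: (measurability _ (RGenOInfty.measurableE R)) => // _ [_ [x ->] <-].
rewrite setTI; apply: open_borel; apply: cf; exact: rray_open.
Qed.

(** An open set is a countable union of basis sets, so testing a countable basis suffices. This is
    how maps into the Borel space of a product are checked coordinate by coordinate. *)
Lemma measurable_fun_countable_basis d (O : measurableType d)
    (K : ptopologicalType) (B : set (set K)) (f : O -> borel K) :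
  countable B ->
  (forall (U : set K) x, open U -> U x -> exists V, [/\ B V, V x & V `<=` U]) ->
  (forall V, B V -> measurable (f @^-1` V)) -> measurable_fun setT f.
Proof.
move=> cB bB mf; apply: measurable_fun_borel => U oU.
have -> : U = \bigcup_(V in B `&` [set V | V `<=` U]) V.
  apply/seteqP; split=> [x Ux|x [V [_ VU] /VU//]].
  by have [V [BV Vx VU]] := bB U x oU Ux; exists V.
rewrite preimage_bigcup; case: (pfcard_geP cB) => [->|[g]].
  by rewrite set0I bigcup_set0.
suff -> : \bigcup_(V in B `&` [set V | V `<=` U]) (f @^-1` V) =
    \bigcup_(i in g @^-1` (B `&` [set V | V `<=` U])) (f @^-1` (g i)).
  by apply: bigcup_measurable => i [Bi _]; exact: mf.
apply/seteqP; split=> [w [V [BV VU] Vw]|w [i [Bi iU] giw]]; last by exists (g i).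
by have [i _ giV] := @surj _ _ _ _ g V BV; exists i => //=; rewrite giV.
Qed.

Lemma second_countable_basis (K : topologicalType) : @second_countable K ->
  exists2 B : set (set K), countable B & (B `<=` open /\
    forall (U : set K) x, open U -> U x -> exists V, [/\ B V, V x & V `<=` U]).
Proof.
move=> [B cB [Bo bB]]; exists B => //; split=> // U x oU Ux.
have /bB[V [BV Vx] VU] : nbhs x U by exact: open_nbhs_nbhs.
by exists V.
Qed.

(** Finite intersections of one-coordinate cylinders over a countable basis of [K] form a countable
    basis of the pointwise topology. *)
Lemma measurable_fun_ptws d (O : measurableType d) (I : countType)
    (K : ptopologicalType) (f : O -> borel {ptws I -> K}) :
  @second_countable K ->
  (forall i, measurable_fun setT ((fun w => f w i) : O -> borel K)) ->
  measurable_fun setT f.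
Proof.
move=> /second_countable_basis[B cB [Bo bB]] mf.
pose cyl (p : I * set K) : set {ptws I -> K} := [set z | p.2 (z p.1)].
pose S := cyl @` (setT `*` B).
have cS : countable S.
  apply: (card_le_trans (card_image_le _ _)).
  exact: countableX.
apply: (@measurable_fun_countable_basis _ O {ptws I -> K} (finI_from S id) f).
- exact: finI_from_countable.
- move=> U x oU Ux.
  pose F : set_system {ptws I -> K} :=
    filter_from [set V | finI_from S id V /\ V x] id.
  have FF : Filter F.
    have [V0 SV0 V0x] : (\bigcup_(A in finI_from S id) A) x by rewrite finI_from_cover.
    apply: filter_from_filter; first by exists V0.
    move=> V W [SV Vx] [SW Wx]; exists (V `&` W) => //; split=> //.
    exact: finI_fromI.
  (* Convergence to [x] can be checked one coordinate at a time; it says that the basis sets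
     containing [x] refine every neighbourhood of [x]. *)
  have Fx : F --> (x : {ptws I -> K}).
    apply/cvg_sup => i V [W [[W' oW' <-] /= W'x] WV].
    have [B0 [BB0 B0x B0W']] := bB _ _ oW' W'x.
    exists (cyl (i, B0)); last by move=> z /B0W'; exact: WV.
    by split=> //; apply: finI_from1; exists (i, B0).
  have /Fx[V [SV Vx] VU] : nbhs x U by exact: open_nbhs_nbhs.
  by exists V.
- move=> _ [N NS <-]; rewrite preimage_bigcap.
  apply: fin_bigcap_measurable; first exact: finite_fset.
  move=> V /= VN; have /set_mem[[i C] [_ /= BC] <-] := NS _ VN.
  rewrite -[X in measurable X]setTI; apply: (mf i) => //.
  by apply: open_borel; exact: Bo.
Qed.

Lemma basis_setX (K L : topologicalType) (B : set (set K)) (C : set (set L)) :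
  (forall (U : set K) x, open U -> U x -> exists V, [/\ B V, V x & V `<=` U]) ->
  (forall (U : set L) x, open U -> U x -> exists V, [/\ C V, V x & V `<=` U]) ->
  forall (U : set (K * L)) p, open U -> U p ->
  exists V W, [/\ B V, C W, V p.1, W p.2 & V `*` W `<=` U].
Proof.
move=> bB bC U [x y] oU Uxy.
have [[V W] /= [Vx Wy] VWU] : nbhs (x, y) U by exact: open_nbhs_nbhs.
move: Vx Wy; rewrite !nbhsE => -[V' [oV' V'x] V'V] [W' [oW' W'y] W'W].
have [B0 [BB0 B0x B0V]] := bB _ _ oV' V'x.
have [C0 [CC0 C0y C0W]] := bC _ _ oW' W'y.
exists B0, C0; split=> //.
by move=> [a b] /= [/B0V/V'V Va /C0W/W'W Wb]; exact: VWU.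
Qed.

Lemma second_countable_setX (K L : topologicalType) :
  @second_countable K -> @second_countable L -> @second_countable (K * L)%type.
Proof.
move=> /second_countable_basis[B cB [Bo bB]].
move=> /second_countable_basis[C cC [Co bC]].
exists ((fun p : set K * set L => p.1 `*` p.2) @` (B `*` C)).
  by apply: (card_le_trans (card_image_le _ _)); exact: countableX.
split.
  move=> _ [[V W] /= [BV CW] <-]; rewrite openE => -[x y] [/= Vx Wy].
  by exists (V, W) => //; split; apply: open_nbhs_nbhs; split=> //; [exact: Bo|exact: Co].
move=> p U /=; rewrite nbhsE => -[U' [oU' U'p] U'U].
have [V [W [BV CW Vp Wp VWU]]] := basis_setX bB bC oU' U'p.
exists (V `*` W); last by move=> z /VWU; exact: U'U.
by split; [exists (V, W)|].
Qed.

(** [borel (K * L)] is generated by the open sets of the product, not by measurable rectangles; with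
    countable bases every open set is a countable union of open rectangles. *)
Lemma measurable_fun_borel_pair d (O : measurableType d)
    (K L : ptopologicalType) (f : O -> borel K) (g : O -> borel L) :
  @second_countable K -> @second_countable L ->
  measurable_fun setT f -> measurable_fun setT g ->
  measurable_fun setT ((fun w => (f w, g w)) : O -> borel (K * L)%type).
Proof.
move=> /second_countable_basis[B cB [Bo bB]].
move=> /second_countable_basis[C cC [Co bC]] mf mg.
pose D := (fun p : set K * set L => p.1 `*` p.2) @` (B `*` C).
apply: (@measurable_fun_countable_basis _ O (K * L)%type D (fun w => (f w, g w))).
- by apply: (card_le_trans (card_image_le _ _)); exact: countableX.
- move=> U p oU Up; have [V [W [BV CW Vp Wp VWU]]] := basis_setX bB bC oU Up.
  by exists (V `*` W); split=> //; exists (V, W).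
- move=> _ [[V W] /= [BV CW] <-].
  have -> : (fun w => (f w, g w)) @^-1` (V `*` W) = f @^-1` V `&` g @^-1` W by [].
  apply: measurableI; rewrite -[X in measurable X]setTI.
    by apply: mf => //; apply: open_borel; exact: Bo.
  by apply: mg => //; apply: open_borel; exact: Co.
Qed.

Lemma ev_continuous (I : eqType) (K : topologicalType) (i : I) :
  continuous (fun z : {ptws I -> K} => z i).
Proof. exact: (@proj_continuous I (fun _ => K) i). Qed.

Lemma ptws_continuous (S : topologicalType) (I : Type) (K : topologicalType)
    (f : S -> {ptws I -> K}) :
  (forall i, continuous (fun s => f s i)) -> continuous f.
Proof.
move=> cf s; apply/cvg_sup => i V [W [[W' oW' <-] /= W'x] WV].
apply: (filterS WV) => /=.
by apply: (cf i s); exact: open_nbhs_nbhs.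
Qed.

Lemma compact_ptws (I : eqType) (K : topologicalType) :
  compact [set: K] -> compact [set: {ptws I -> K}].
Proof.
move=> cK; have := @tychonoff I (fun _ => K) (fun _ => setT) (fun _ => cK).
by congr compact; apply/seteqP; split.
Qed.

Lemma hausdorff_ptws (I : eqType) (K : topologicalType) :
  hausdorff_space K -> hausdorff_space {ptws I -> K}.
Proof. by move=> hK; exact: (@hausdorff_product I (fun _ => K)). Qed.

(** * Laws weighted by densities and by kernels *)

Local Open Scope ereal_scope.

Section WeightedLaw.
Context {R : realType} d1 d2 (O : measurableType d1) (S : measurableType d2).
Variables (mu : {measure set O -> \bar R}) (phi : O -> \bar R) (Z : O -> S).
Hypotheses (mphi : measurable_fun setT phi) (phi0 : forall w, 0 <= phi w).
Hypothesis mZ : measurable_fun setT Z.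

Let m (A : set S) := \int[mu]_(w in Z @^-1` A) phi w.

Let m0 : m set0 = 0. Proof. by rewrite /m preimage_set0 integral_set0. Qed.

Let m_ge0 A : 0 <= m A. Proof. by apply: integral_ge0. Qed.

Let m_sigma_additive : semi_sigma_additive m.
Proof.
move=> F mF tF mUF; rewrite /m preimage_bigcup.
have H := @semi_sigma_additive_nng_induced _ _ _ mu _ mphi phi0.
apply: (H (fun n => Z @^-1` F n)).
- by move=> n; rewrite -[X in measurable X]setTI; exact: mZ.
- move/trivIsetP : tF => tF; apply/trivIsetP => i j _ _ ij.
  by rewrite -preimage_setI tF ?preimage_set0.
- by rewrite -preimage_bigcup -[X in measurable X]setTI; exact: mZ.
Qed.

HB.instance Definition _ := isMeasure.Build _ _ _ m m0 m_ge0 m_sigma_additive.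

Import HBNNSimple.

Let int_indic (A : set S) : measurable A ->
  \int[m]_x (\1_A x)%:E = \int[mu]_w ((\1_A (Z w))%:E * phi w).
Proof.
move=> mA; rewrite integral_indic// setIT [LHS]integral_mkcond.
by rewrite epatch_indic; apply: eq_integral => w _; rewrite muleC.
Qed.

Let int_nnsfun (f : {nnsfun S >-> R}) :
  \int[m]_x (f x)%:E = \int[mu]_w ((f (Z w))%:E * phi w).
Proof.
under [in LHS]eq_integral do rewrite fimfunE -fsumEFin//.
rewrite ge0_integral_fsum//; last 2 first.
  - by move=> r; exact/measurable_EFinP/measurableT_comp.
  - by move=> r z _; rewrite EFinM nnfun_muleindic_ge0.
under [in RHS]eq_integral.
  move=> w _; rewrite fimfunE -fsumEFin// ge0_mule_fsuml; last first.
    by move=> r; rewrite EFinM nnfun_muleindic_ge0.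
  over.
rewrite /= ge0_integral_fsum//; last 2 first.
  - move=> r; apply: emeasurable_funM => //.
    apply/measurable_EFinP/measurable_funM => //.
    by apply: measurableT_comp => //; exact: measurable_indic.
  - by move=> r z _; rewrite mule_ge0// EFinM nnfun_muleindic_ge0.
apply: eq_fsbigr => r _.
have [r0|r0] := leP 0%R r.
  have mA : measurable (f @^-1` [set r]) by [].
  transitivity (r%:E * \int[m]_x (\1_(f @^-1` [set r]) x)%:E).
    rewrite -ge0_integralZl_EFin//.
    by apply/measurable_EFinP; exact: measurable_indic.
  rewrite int_indic// -ge0_integralZl_EFin//.
  - by apply: eq_integral => w _; rewrite EFinM muleA.
  - by move=> w _; rewrite mule_ge0// lee_fin.
  - apply: emeasurable_funM => //; apply/measurable_EFinP.
    by apply: measurableT_comp => //; exact: measurable_indic.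
rewrite preimage_nnfun0//; transitivity (0 : \bar R).
  by apply: integral0_eq => x _; rewrite indic0 mulr0.
by apply/esym/integral0_eq => x _; rewrite indic0 mulr0 mul0e.
Qed.

(** The law of [Z] under the measure with density [phi]. Having it as a measure on [S] reduces
    comparisons of weighted integrals of functions of [Z] to comparisons on sets. *)
Lemma ex_weighted_law : exists2 m : {measure set S -> \bar R},
  forall A, m A = \int[mu]_(w in Z @^-1` A) phi w &
  forall f, measurable_fun setT f -> (forall x, 0 <= f x) ->
    \int[m]_x f x = \int[mu]_w (f (Z w) * phi w).
Proof.
exists m => // f mf f0; pose f_ := nnsfun_approx measurableT mf.
transitivity (\int[m]_x (lim ((f_ n x)%:E @[n --> \oo]))).
  by apply/eq_integral => z _; apply/esym/cvg_lim => //=; exact: cvg_nnsfun_approx.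
rewrite monotone_convergence//; last 3 first.
  by move=> n; exact/measurable_EFinP.
  by move=> n z _; rewrite lee_fin.
  by move=> z _ a b ab; rewrite lee_fin; exact/lefP/nd_nnsfun_approx.
under eq_fun do rewrite int_nnsfun.
rewrite -monotone_convergence//; last 3 first.
- move=> n; apply: emeasurable_funM => //; apply/measurable_EFinP.
  exact: measurableT_comp.
- by move=> n w _; rewrite mule_ge0// lee_fin.
- move=> w _ a b ab; apply: lee_wpmul2r => //.
  by rewrite lee_fin; exact/lefP/nd_nnsfun_approx.
apply: eq_integral => w _; apply/cvg_lim => //.
have fZ : (f_ n (Z w))%:E @[n --> \oo] --> f (Z w).
  exact: (@cvg_nnsfun_approx _ _ _ _ measurableT _ mf).
(* The limit of a product is safe unless it has the form 0 * oo, and both factors may be infinite.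
   The two zero cases are settled by hand: where [f] vanishes so do its approximants. *)
have [fZ0|fZ0] := eqVneq (f (Z w)) 0.
  rewrite fZ0 mul0e; apply: cvg_near_cst; apply: nearW => n.
  suff -> : f_ n (Z w) = 0%R by rewrite mul0e.
  have : (approx setT f n (Z w))%:E <= f (Z w) by exact: le_approx.
  rewrite -nnsfun_approxE fZ0 lee_fin => fn0.
  by apply/eqP; rewrite eq_le fun_ge0 andbT.
have [pw0|pw0] := eqVneq (phi w) 0.
  by rewrite pw0 mule0; under eq_fun do rewrite mule0; exact: cvg_cst.
apply: cvgeM => //; last exact: cvg_cst.
by rewrite mule_defE (negbTE fZ0) (negbTE pw0).
Qed.

End WeightedLaw.

Section KernelPrecomp.
Context {R : realType} d1 d2 d3 (S' : measurableType d1) (S : measurableType d2)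
  (E : measurableType d3).
Variables (k : R.-pker S ~> E) (h : S' -> S).

(** The measurability proof is an argument of the definition so that the kernel instances below can
    be attached to the term. *)
Definition kernel_precomp (mh : measurable_fun setT h) :
  S' -> {measure set E -> \bar R} := fun s => k (h s).

Variable mh : measurable_fun setT h.

Let mk U : measurable U -> measurable_fun setT (kernel_precomp mh ^~ U).
Proof.
by move=> mU; exact: (measurableT_comp (measurable_kernel k U mU) mh).
Qed.

HB.instance Definition _ := isKernel.Build _ _ _ _ _ (kernel_precomp mh) mk.

Let mk_prob s : kernel_precomp mh s setT = 1.
Proof. exact: prob_kernel. Qed.

HB.instance Definition _ :=
  Kernel_isProbability.Build _ _ _ _ _ (kernel_precomp mh) mk_prob.

End KernelPrecomp.

Section JointMeasure.
Context {R : realType} d1 d2 d3 (O : measurableType d1) (S : measurableType d2)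
  (E : measurableType d3).
Variables (P : probability O R) (W : O -> S) (k : R.-pker S ~> E).
Hypothesis mW : measurable_fun setT W.

Let mWs : measurable_fun setT (fun p : unit * O => W p.2).
Proof. exact: measurableT_comp mW measurable_snd. Qed.

Let pr (q : (unit * O) * E) := (W q.1.2, q.2).

Let mpr : measurable_fun setT pr.
Proof.
apply/measurable_fun_pair => //; apply: (measurableT_comp mW).
exact: measurableT_comp measurable_snd measurable_fst.
Qed.

Let kP : R.-pker unit ~> O :=
  kprobability (measurable_cst (P : pprobability O R) : measurable_fun [set: unit] _).
Let kW : R.-pker (unit * O)%type ~> E := kernel_precomp k mWs.
Let kD : R.-pker (unit * O * E)%type ~> (S * E)%type := kdirac mpr.
Let kWD : R.-sfker (unit * O)%type ~> (S * E)%type := mkcomp kW kD.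
Let joint : {measure set (S * E) -> \bar R} := mkcomp kP kWD tt.

(** Draw [w] from [P], then [e] from [k (W w)], and keep the pair [(W w, e)]: a composition of
    kernels that starts from [P], seen as a kernel from [unit], and ends with a Dirac kernel. *)
Lemma ex_joint_measure : exists2 m : {measure set (S * E) -> \bar R},
  forall A, measurable A -> m A = \int[P]_w k (W w) [set e | A (W w, e)] &
  forall f, measurable_fun setT f -> (forall p, 0 <= f p) ->
    \int[m]_p f p = \int[P]_w \int[k (W w)]_e f (W w, e).
Proof.
exists joint => [A mA|f mf f0].
  rewrite /joint /mkcomp/= /kcomp/=; apply: eq_integral => w _.
  rewrite /kcomp /= /kernel_precomp/= /kdirac/=.
  transitivity (\int[k (W w)]_e (\1_(A : set (S * E)) (W w, e))%:E).
    by apply: eq_integral => e _; rewrite diracE.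
  rewrite -[in RHS](setIT [set e | A (W w, e)]) -integral_indic//.
  rewrite -[X in measurable X]/((fun e => (W w, e)) @^-1` A) -[X in measurable X]setTI.
  exact: pair1_measurable.
rewrite /joint /mkcomp integral_kcomp//; apply: eq_integral => w _.
rewrite /kWD /mkcomp integral_kcomp//; apply: eq_integral => e _.
by rewrite integral_dirac// diracT mul1e.
Qed.

End JointMeasure.

Lemma eq_measure_setX (R : realType) d1 d2 (S : measurableType d1)
    (E : measurableType d2) (m1 m2 : {measure set (S * E) -> \bar R}) :
  m1 setT < +oo ->
  (forall A B, measurable A -> measurable B -> m1 (A `*` B) = m2 (A `*` B)) ->
  forall A, measurable A -> m1 A = m2 A.
Proof.
move=> m1fin m12 A mA.
apply: (measure_unique [set A `*` B | A in measurable & B in measurable] (fun=> setT)) => //.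
- exact: measurable_prod_measurableType.
- move=> _ _ [A1 mA1 [B1 mB1 <-]] [A2 mA2 [B2 mB2 <-]]; rewrite -setXI.
  by exists (A1 `&` A2); [exact: measurableI|exists (B1 `&` B2) => //; exact: measurableI].
- by move=> _; exists setT => //; exists setT => //; rewrite setXTT.
- by rewrite bigcup_const.
- by move=> _ [A1 mA1 [B1 mB1 <-]]; exact: m12.
Qed.

Section JointLaw.
Context {R : realType} d1 d2 d3 (O : measurableType d1) (S : measurableType d2)
  (E : measurableType d3).
Variables (P : probability O R) (W : O -> S) (Z : O -> E) (k : R.-pker S ~> E).
Hypotheses (mW : measurable_fun setT W) (mZ : measurable_fun setT Z).
Hypothesis WZ : forall A B, measurable A -> measurable B ->
  P (W @^-1` A `&` Z @^-1` B) = \int[P]_(w in W @^-1` A) k (W w) B.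

(** By [WZ] the law of [(W, Z)] agrees with the measure of [ex_joint_measure] on rectangles, hence
    everywhere. The Markov property, independence and the filter are all used in this form. *)
Lemma integral_joint_kernel f : measurable_fun setT f -> (forall p, 0 <= f p) ->
  \int[P]_w f (W w, Z w) = \int[P]_w \int[k (W w)]_e f (W w, e).
Proof.
move=> mf f0; have [m mE <-//] := ex_joint_measure P k mW.
have mWZ : measurable_fun setT (fun w => (W w, Z w)) by exact/measurable_fun_pair.
transitivity (\int[pushforward P (fun w => (W w, Z w))]_p f p).
  by rewrite ge0_integral_pushforward.
apply: eq_measure_integral => A mA _; move: A mA; apply: eq_measure_setX.
  by rewrite -[X in X < _]/(P setT) probability_setT ltry.
move=> A1 B1 mA1 mB1.
rewrite -[LHS]/(P (W @^-1` A1 `&` Z @^-1` B1)) WZ// mE; last exact: measurableX.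
rewrite integral_mkcond; apply: eq_integral => w _; rewrite patchE.
case: ifPn => [/set_mem W1|/negP W1].
  by congr (k _ _); apply/seteqP; split => e //= [].
rewrite (_ : [set _ | _] = set0) ?measure0//.
by apply/seteqP; split => e //= [/mem_set].
Qed.

End JointLaw.

Section KernelMean.
Context {R : realType} d1 d2 (S : measurableType d1) (E : measurableType d2).
Variable k : R.-pker S ~> E.

Definition kernel_mean (f : E -> R) (s : S) : R := fine (\int[k s]_e (f e)%:E).

Variable f : E -> R.
Hypotheses (mf : measurable_fun setT f) (f01 : forall e, (0 <= f e <= 1)%R).

Let f0 e : 0 <= (f e)%:E. Proof. by rewrite lee_fin; have /andP[] := f01 e. Qed.

Lemma measurable_kernel_mean : measurable_fun setT (kernel_mean f).
Proof.
apply: (measurableT_comp (@fine_measurable _ _ measurableT)).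
apply: measurable_fun_integral_kernel => //; last exact/measurable_EFinP.
by move=> U mU; exact: measurable_kernel.
Qed.

Let mean_le1 s : \int[k s]_e (f e)%:E <= 1.
Proof.
apply: (@le_trans _ _ (\int[k s]_e (cst 1 e))).
  apply: ge0_le_integral => //; first exact/measurable_EFinP.
  by move=> e _; rewrite lee_fin; have /andP[] := f01 e.
by rewrite integral_cst// mul1e prob_kernel.
Qed.

Lemma kernel_meanE s : (kernel_mean f s)%:E = \int[k s]_e (f e)%:E.
Proof.
rewrite /kernel_mean fineK// ge0_fin_numE; last exact: integral_ge0.
by rewrite (le_lt_trans (mean_le1 s))// ltry.
Qed.

Lemma kernel_mean01 s : (0 <= kernel_mean f s <= 1)%R.
Proof. by rewrite -!lee_fin kernel_meanE mean_le1 integral_ge0. Qed.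

End KernelMean.

Local Close Scope ereal_scope.

(** * Measures determined by bounded functions *)

Local Open Scope ereal_scope.

(** Take one minus a Urysohn function that is 0 on [F] and 1 off an open neighbourhood of size 1 /
    (n + 1). A point outside the closed set [F] eventually leaves these neighbourhoods. *)
Lemma closed_indic_cvg (R : realType) (K : pseudoMetricType R) (F : set K) :
  closed F -> exists phi : nat -> K -> R,
  [/\ forall n, continuous (phi n), forall n x, (0 <= phi n x <= 1)%R &
      forall x, phi n x @[n --> \oo] --> (\1_F x : R)].
Proof.
move=> cF.
pose U n : set K := \bigcup_(y in F) (ball y n.+1%:R^-1)%R°.
have oU n : open (U n) by apply: bigcup_open => y _; exact: open_interior.
have FU n : F `<=` U n.
  move=> y Fy; exists y => //; apply: nbhsx_ballx; by rewrite invr_gt0.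
have sepF n : @uniform_separator K F (~` U n).
  have := (@normal_separatorP R K).1 (@pseudometric_normal R K).
  apply => //.
    exact: open_closedC.
  by apply/disjoints_subset; rewrite setCK; exact: FU.
pose phi n x : R := (1 - @Urysohn K R F (~` U n) x)%R.
have phi01 n x : (0 <= phi n x <= 1)%R.
  have := @Urysohn_range K R F (~` U n) _ (ex_intro2 _ _ x I erefl).
  by rewrite /= in_itv/= => /andP[u0 u1]; apply/andP; rewrite /phi subr_ge0 lerBlDr lerDl.
exists phi; split => //.
  move=> n x; apply: cvgB; first exact: cvg_cst.
  exact: Urysohn_continuous.
move=> x; have [Fx|Fx] := pselect (F x).
  rewrite indicE mem_set//; apply: cvg_near_cst; apply: nearW => n.
  have /= u0 := @Urysohn_sub0 K R _ _ (sepF n) _ (ex_intro2 _ _ x Fx erefl).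
  by  rewrite /phi u0 subr0.
rewrite indicE memNset//; apply: cvg_near_cst.
have : nbhs x (~` F) by apply: open_nbhs_nbhs; split=> //; exact: closed_openC.
rewrite -nbhs_ballE => -[e /= e0 xeF].
near=> n.
have Ux : (~` U n) x.
  move=> [y Fy /interior_subset /ball_sym yx]; apply: (xeF y) => //.
  apply: le_ball yx; apply: ltW; near: n.
  exact: (near_infty_natSinv_lt (PosNum e0)).
have /= u0 := @Urysohn_sub1 K R _ _ (sepF n) _ (ex_intro2 _ _ x Ux erefl).
by  rewrite /phi u0 subrr.
Unshelve. all: by end_near. Qed.

Section MultiplicativeClass.
Context {R : realType} d (S : measurableType d).
Variables (m1 m2 : {measure set S -> \bar R}) (M : set (S -> R)).
Hypothesis mM : forall f, M f -> measurable_fun setT f.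
Hypothesis M01 : forall f x, M f -> (0 <= f x <= 1)%R.
Hypothesis M1 : M (cst 1%R).
Hypothesis MM : forall f g, M f -> M g -> M (f \* g)%R.
Hypothesis m1fin : m1 setT < +oo.
Hypothesis m12 : forall f, M f -> \int[m1]_x (f x)%:E = \int[m2]_x (f x)%:E.

(** Indicators reached from [M] by pointwise limits of sequences: a family stable under intersection
    when [M] is stable under products, yet large enough to generate the sigma-algebras at hand. *)
Definition indic_limit : set (set S) := [set A |
  exists2 f : nat -> S -> R, forall n, M (f n) &
    forall x, f n x @[n --> \oo] --> (\1_A x : R)].

(** Dominated convergence passes from the integrals of members of [M] to the measures of the sets in
    [indic_limit], a pi-system because [M] is multiplicative; uniqueness of measures does the
    rest. *)
Lemma multiplicative_class_measure_eq A :
  <<s indic_limit >> A -> m1 A = m2 A.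
Proof.
have mind : indic_limit `<=` measurable.
  move=> B [f Mf fB]; apply/(@measurable_indicP _ _ R).
  exact: (measurable_fun_cvg (fun n => mM (Mf n))).
have m12T : m1 setT = m2 setT.
  rewrite -[LHS]mul1e -[RHS]mul1e -!integral_cst//; exact: m12 M1.
have lim (m : {measure set S -> \bar R}) (B : set S) (f : nat -> S -> R) :
    m setT < +oo -> (forall n, M (f n)) ->
    (forall x, f n x @[n --> \oo] --> (\1_B x : R)) -> measurable B ->
    \int[m]_x (f n x)%:E @[n --> \oo] --> m B.
  move=> mfin Mf fB mB; rewrite -[X in m X](setIT B) -integral_indic//.
  apply: (@dominated_cvg _ _ _ m _ measurableT _ _ (cst 1)) => //.
  - by move=> n; apply/measurable_EFinP; exact: mM.
  - by move=> x _; apply: cvg_EFin; [exact: nearW|exact: fB].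
  - apply/integrableP; split => //.
    rewrite [X in X < _](_ : _ = m setT)//.
    by under eq_integral do rewrite /= normr1; rewrite integral_cst// mul1e.
  - by move=> n x _; have /andP[f0 f1] := M01 x (Mf n); rewrite /= lee_fin ger0_norm.
apply: (@g_sigma_algebra_measure_unique _ _ _ indic_limit mind (fun=> setT)).
- move=> _; exists (fun=> cst 1%R) => // x; rewrite indicT; exact: cvg_cst.
- by rewrite bigcup_const.
- move=> B C [f Mf fB] [g Mg gC]; exists (fun n => f n \* g n)%R.
    by move=> n; exact: MM.
  by move=> x; rewrite indicI; apply: cvgM.
- move=> B GB; have mB := mind _ GB; have [f Mf fB] := GB.
  have l1 := lim m1 B f m1fin Mf fB mB.
  have l2 : \int[m2]_x (f n x)%:E @[n --> \oo] --> m2 B.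
    by apply: lim => //; rewrite -m12T.
  have := l1; under eq_fun do rewrite m12//; move=> l1'.
  exact: cvg_unique l1' l2.
- by move=> _.
Qed.

Lemma indic_limit_closed (K : pmetricType R) (Z : S -> K) (F : set K) :
  (forall f : K -> R, continuous f -> (forall x, 0 <= f x <= 1)%R -> M (f \o Z)) ->
  closed F -> indic_limit (Z @^-1` F).
Proof.
move=> MZ /(@closed_indic_cvg R)[phi [cphi phi01 phiF]].
exists (fun n => phi n \o Z); first by move=> n; apply: MZ.
by move=> x; exact: phiF.
Qed.

Lemma sigma_indic_limit (K : pmetricType R) (Z : S -> K) (B : set (borel K)) :
  (forall f : K -> R, continuous f -> (forall x, 0 <= f x <= 1)%R -> M (f \o Z)) ->
  measurable B -> <<s indic_limit >> (Z @^-1` B).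
Proof.
move=> MZ mB.
pose G := [set B : set (borel K) | <<s indic_limit >> (Z @^-1` B)].
suff : measurable `<=` G by exact.
apply: smallest_sub.
  split; rewrite /G/=.
  - by rewrite preimage_set0; exact: sigma_algebra0.
  - by move=> C ZC; exact: (sigma_algebraCD ZC).
  - by move=> C ZC; rewrite preimage_bigcup; exact: sigma_algebra_bigcup.
move=> U oU; rewrite /G/= -(setCK U) preimage_setC -setTD.
apply: sigma_algebraCD; apply: sub_sigma_algebra.
exact: (indic_limit_closed MZ (open_closedC oU)).
Qed.

End MultiplicativeClass.

Local Close Scope ereal_scope.

(** * Banach limits of laws on a compact space *)

Local Open Scope ereal_scope.

(** * From a set function on closed sets to a Borel measure *)

Section ContentOnClosedSets.
Context {R : realType} {K : ptopologicalType}.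
Hypotheses (hK : hausdorff_space K) (cK : compact [set: K]).
Variable l : set K -> R.
Hypothesis l0 : l set0 = 0%R.
Hypothesis l_mono : forall F1 F2, closed F1 -> closed F2 -> F1 `<=` F2 ->
  (l F1 <= l F2)%R.
Hypothesis l_subadd : forall F1 F2, closed F1 -> closed F2 ->
  (l (F1 `|` F2) <= l F1 + l F2)%R.
Hypothesis l_add : forall F1 F2, closed F1 -> closed F2 -> F1 `&` F2 = set0 ->
  (l F1 + l F2 <= l (F1 `|` F2))%R.

(** The classical passage from a content to a measure: inner approximation of open sets by closed
    ones, then outer approximation of arbitrary sets by open ones. *)
Definition inner_content (O : set K) : \bar R :=
  ereal_sup [set (l F)%:E | F in [set F | closed F /\ F `<=` O]].

Definition outer_content (A : set K) : \bar R :=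
  ereal_inf [set inner_content O | O in [set O | open O /\ A `<=` O]].

Let inner_ub F O : closed F -> F `<=` O -> (l F)%:E <= inner_content O.
Proof. by move=> cF FO; apply: ereal_sup_ubound; exists F. Qed.

Let inner_lub O x : (forall F, closed F -> F `<=` O -> (l F)%:E <= x) ->
  inner_content O <= x.
Proof. by move=> h; apply: ge_ereal_sup => _ [F [cF FO] <-]; exact: h. Qed.

Let inner_ge0 O : 0 <= inner_content O.
Proof.
by apply: (@le_trans _ _ (l set0)%:E); [rewrite l0|apply: inner_ub => //; exact: closed0].
Qed.

Let inner_fin O : inner_content O \is a fin_num.
Proof.
rewrite ge0_fin_numE//; apply: (@le_lt_trans _ _ (l setT)%:E); last exact: ltry.
by apply: inner_lub => F cF _; rewrite lee_fin; apply: l_mono => //; exact: closedT.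
Qed.

Let inner0 : inner_content set0 = 0.
Proof.
apply/eqP; rewrite eq_le inner_ge0 andbT; apply: inner_lub => F _.
by rewrite subset0 => ->; rewrite l0.
Qed.

(** By normality of a compact Hausdorff space, a closed [F] inside the union of [U] and [V] splits
    into a closed part in [U] and a closed part in [V]. *)
Let inner_setU U V : open U -> open V ->
  inner_content (U `|` V) <= inner_content U + inner_content V.
Proof.
move=> oU oV; apply: inner_lub => F cF FUV.
have cFU : closed (F `\` U) by apply: closedI => //; exact: open_closedC.
have FUsV : set_nbhs (F `\` U) V.
  apply/set_nbhsP; exists V; split=> // x [Fx nUx]; by case: (FUV x Fx).
have [W /set_nbhsP[W' [oW' FW' W'W]] cWV] := compact_normal hK cK cFU FUsV.
have oW'F : closed (F `\` W') by apply: closedI => //; exact: open_closedC.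
have cFW : closed (F `&` closure W) by apply: closedI => //; exact: closed_closure.
have -> : F = (F `\` W') `|` (F `&` closure W).
  apply/seteqP; split=> [x Fx|x [[]//|[]//]].
  have [W'x|nW'x] := pselect (W' x); last by left.
  by right; split=> //; apply: subset_closure; exact: W'W.
apply: (@le_trans _ _ ((l (F `\` W'))%:E + (l (F `&` closure W))%:E)).
  by rewrite -EFinD lee_fin; exact: l_subadd.
apply: leeD; apply: inner_ub => //.
  by move=> x [Fx nW'x]; apply: contrapT => nUx; apply: nW'x; exact: FW'.
by move=> x [_ /cWV].
Qed.

(** A closed [F] is compact, so finitely many of the [O n] already cover it and finite subadditivity
    applies. *)
Let inner_bigcup (O : nat -> set K) : (forall n, open (O n)) ->
  inner_content (\bigcup_n O n) <= \sum_(n <oo) inner_content (O n).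
Proof.
move=> oO; apply: inner_lub => F cF FO.
have cptF : compact F by apply: (subclosed_compact cF cK).
have [D _ FD] : finite_subset_cover setT O F.
  by move: cptF; rewrite compact_cover; apply => //.
have [N DN] : exists N, forall i, i \in D -> (i < N)%N.
  exists (\max_(i <- D) i).+1 => i iD; rewrite ltnS.
  exact: (@leq_bigmax_seq _ _ xpredT id).
have FN : F `<=` \big[setU/set0]_(i < N) O i.
  by move=> x /FD[i /= iD Oix]; rewrite -bigcup_mkord; exists i => //=; exact: DN.
apply: (@le_trans _ _ (\sum_(0 <= i < N) inner_content (O i))); last first.
  by apply: nneseries_lim_ge => n _.
apply: (@le_trans _ _ (inner_content (\big[setU/set0]_(i < N) O i))).
  exact: inner_ub.
rewrite big_mkord; elim: N {DN FN} => [|N IH].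
  by rewrite !big_ord0 inner0.
rewrite !big_ord_recr/=; apply: (le_trans (inner_setU _ _)) => //.
  by apply: big_ind => [| |i _]; [exact: open0|exact: openU|].
exact: leeD.
Qed.

Let outer_lb A O : open O -> A `<=` O -> outer_content A <= inner_content O.
Proof. by move=> oO AO; apply: ereal_inf_lbound; exists O. Qed.

Let outer_glb A x : (forall O, open O -> A `<=` O -> x <= inner_content O) ->
  x <= outer_content A.
Proof. by move=> h; apply: le_ereal_inf_tmp; move=> _ [V [oV AV] <-]; exact: h. Qed.

Let outer0 : outer_content set0 = 0.
Proof.
apply/eqP; rewrite eq_le; apply/andP; split; last by apply: outer_glb.
by rewrite -inner0; apply: outer_lb => //; exact: open0.
Qed.

Let outer_ge0 A : 0 <= outer_content A. Proof. exact: outer_glb. Qed.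

Let outer_fin A : outer_content A \is a fin_num.
Proof.
rewrite ge0_fin_numE//.
apply: (@le_lt_trans _ _ (inner_content setT)); first by apply: outer_lb => //; exact: openT.
by rewrite -ge0_fin_numE.
Qed.

Let outer_mono : {homo outer_content : A B / A `<=` B >-> A <= B}.
Proof.
move=> A B AB; apply: outer_glb => O oO BO; apply: outer_lb => //.
exact: subset_trans BO.
Qed.

Let outer_sigma_subadditive : sigma_subadditive outer_content.
Proof.
move=> A; apply/lee_addgt0Pr => e e0.
rewrite (le_trans _ (epsilon_trick _ _ _))//; last exact: ltW.
have oute n : exists O, [/\ open O, A n `<=` O &
    inner_content O <= outer_content (A n) + (e / (2 ^ n.+1)%:R)%:E].
  have en1 : (0 < e / (2 ^ n.+1)%:R)%R by rewrite divr_gt0// ltr0n expn_gt0.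
  have [_ [V [oV AV] <-] VA] := lb_ereal_inf_adherent en1 (outer_fin (A n)).
  by exists V; split => //; exact: ltW.
have [V oV] := choice oute.
apply: (@le_trans _ _ (inner_content (\bigcup_n V n))).
  apply: outer_lb; first by apply: bigcup_open => n _; have [] := oV n.
  by apply: subset_bigcup => n _; have [] := oV n.
apply: (le_trans (inner_bigcup _)); first by move=> n; have [] := oV n.
apply: lee_nneseries => // n _; by have [] := oV n.
Qed.

HB.instance Definition _ := isOuterMeasure.Build R K outer_content
  outer0 outer_ge0 outer_mono outer_sigma_subadditive.

(** Closed sets are chosen in succession: [F1] inside the intersection of [O] and [G], then [F2]
    inside [O] minus [F1], an open set containing [O] minus [G]. They are disjoint, so [l_add]
    applies to them. *)
Let open_caratheodory G : open G -> outer_content.-caratheodory G.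
Proof.
move=> oG; apply: le_caratheodory_measurable => X; apply: outer_glb => O oO XO.
have outX := outer_lb.
apply: (@le_trans _ _ (inner_content (O `&` G) + outer_content (O `\` G))).
  apply: leeD; last by apply: outer_mono; exact: setSI.
  by apply: outer_lb; [exact: openI|exact: setSI].
rewrite -leeBrDr//; apply: inner_lub => F1 cF1 F1O.
rewrite leeBrDr// addeC -leeBrDr//.
apply: (@le_trans _ _ (inner_content (O `\` F1))).
  apply: outer_lb; first by apply: openI => //; exact: closed_openC.
  by move=> x [Ox nGx]; split => // /F1O[].
apply: inner_lub => F2 cF2 F2O; rewrite leeBrDr// addeC -EFinD.
have F12 : F1 `&` F2 = set0 by apply/seteqP; split => // x [F1x /F2O[_ /(_ F1x)]].
rewrite (le_trans _ (inner_ub (closedU cF1 cF2) _))//.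
  by rewrite lee_fin; exact: l_add.
by rewrite subUset; split; [move=> x /F1O[]|move=> x /F2O[]].
Qed.

Let borel_caratheodory (A : set (borel K)) :
  measurable A -> outer_content.-cara.-measurable A.
Proof.
move: A; apply: smallest_sub => [|G oG]; last exact: open_caratheodory.
split.
- exact: measurable0.
- by move=> B mB; rewrite setTD; exact: measurableC.
- by move=> B mB; exact: bigcupT_measurable.
Qed.

Let bm (A : set (borel K)) := outer_content A.

Let bm_sigma_additive : semi_sigma_additive bm.
Proof.
move=> F mF tF mUF; apply: caratheodory_measure_sigma_additive => //.
- by move=> i; exact: borel_caratheodory.
- exact: borel_caratheodory.
Qed.

HB.instance Definition _ :=
  isMeasure.Build _ _ _ bm outer0 outer_ge0 bm_sigma_additive.

(* Replaces the Riesz representation theorem: only a set function on the closed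
   sets is available from the Banach limit. *)
Lemma ex_measure_above_content : exists2 m : {measure set (borel K) -> \bar R},
  forall F, closed F -> (l F)%:E <= m F & m setT = (l setT)%:E.
Proof.
exists bm => [F cF|]; first by apply: outer_glb => O oO FO; exact: inner_ub.
apply/eqP; rewrite eq_le; apply/andP; split.
  apply: (@le_trans _ _ (inner_content setT)); first by apply: outer_lb => //; exact: openT.
  by apply: inner_lub => F cF _; rewrite lee_fin; apply: l_mono => //; exact: closedT.
by apply: outer_glb => O oO FO; apply: inner_ub => //; exact: closedT.
Qed.

End ContentOnClosedSets.

Local Close Scope ereal_scope.

(** * Shift-invariant limits of bounded sequences *)

Section BanachLimit.
Context {R : realType}.

Definition bounded_seq (a : nat -> R) := exists M, forall n, `|a n| <= M.

Lemma bounded_seqD a b : bounded_seq a -> bounded_seq b -> bounded_seq (a \+ b).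
Proof.
move=> [M aM] [N bN]; exists (M + N) => n.
by rewrite (le_trans (ler_normD _ _))// lerD.
Qed.

Lemma bounded_seqZ c a : bounded_seq a -> bounded_seq (fun n => c * a n).
Proof. by move=> [M aM]; exists (`|c| * M) => n; rewrite normrM ler_wpM2l. Qed.

Lemma bounded_seq01 a : (forall n, 0 <= a n <= 1) -> bounded_seq a.
Proof. by move=> a01; exists 1 => n; have /andP[? ?] := a01 n; rewrite ger0_norm. Qed.

(** The limit of Cesaro means along an ultrafilter finer than [\oo]. Bounded means converge along it
    by compactness, and a shift changes the mean of [n.+1] terms by [(a n.+1 - a 0) / n.+1], which
    tends to 0. *)
Lemma ex_banach_limit : exists L : (nat -> R) -> R,
  [/\ forall a b, bounded_seq a -> bounded_seq b -> L (a \+ b) = L a + L b,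
      forall c a, bounded_seq a -> L (fun n => c * a n) = c * L a,
      forall a b, bounded_seq a -> bounded_seq b -> (forall n, a n <= b n) ->
        L a <= L b,
      L (cst 1) = 1 &
      forall a, bounded_seq a -> L (fun n => a n.+1) = L a].
Proof.
pose avg (a : nat -> R) (n : nat) : R := n.+1%:R^-1 * \sum_(0 <= t < n.+1) a t.
have [U [uU ooU]] := ultraFilterLemma (@eventually_filter : ProperFilter \oo).
have n0 n : 0 < (n.+1%:R : R) by rewrite ltr0n.
have avg_bnd a M n : (forall n, `|a n| <= M) -> `|avg a n| <= M.
  move=> aM; rewrite /avg normrM ger0_norm ?invr_ge0// mulrC ler_pdivrMr//.
  rewrite (le_trans (ler_norm_sum _ _ _))//.
  rewrite (le_trans (ler_sum _ (fun t _ => aM t)))// big_const_nat subn0.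
  by rewrite iter_addr_0 mulr_natr.
pose L a : R := lim (avg a n @[n --> U]).
have cL a : bounded_seq a -> avg a n @[n --> U] --> L a.
  move=> [M aM]; have [|l [_ al]] := @segment_compact R (- M) M (avg a n @[n --> U]) _.
    by apply: nearW => n; rewrite /= in_itv/= -ler_norml avg_bnd.
  suff : avg a n @[n --> U] --> l by move=> ?; apply/cvg_ex; exists l.
  move=> V lV; have [//|nV] := in_ultra_setVsetC (avg a @^-1` V) uU.
  by have [y [nVy Vy]] := al (~` V) V nV lV.
have LE a l : avg a n @[n --> U] --> l -> L a = l by move=> /cvg_lim; apply.
exists L; split.
- move=> a b ba bb; apply: LE.
  rewrite (_ : avg (a \+ b) = avg a \+ avg b).
    by apply: cvgD; exact: cL.
  by apply/funext => n; rewrite /avg big_split/= mulrDr.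
- move=> c a ba; apply: LE.
  rewrite (_ : avg _ = fun n => c * avg a n).
    by apply: cvgZr; exact: cL.
  by apply/funext => n; rewrite /avg -mulr_sumr mulrCA.
- move=> a b ba bb ab; have la := cL _ ba; have lb := cL _ bb.
  apply: (ler_cvg_to la lb); apply: nearW => n.
  by rewrite /avg ler_pM2l ?invr_gt0//; apply: ler_sum.
- apply: LE; apply: cvg_near_cst; apply: nearW => n; rewrite /avg.
  by rewrite big_const_nat subn0 iter_addr_0 -mulr_natr mul1r mulVf.
- move=> a [M aM]; apply: LE.
  have ba : bounded_seq a by exists M.
  have -> : avg (fun n => a n.+1) = avg a \+ (fun n => n.+1%:R^-1 * (a n.+1 - a 0%N)).
    apply/funext => n; rewrite /avg /= -mulrDr; congr (_ * _).
    have h : \sum_(0 <= t < n.+1) a t + a n.+1 = a 0%N + \sum_(0 <= t < n.+1) a t.+1.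
      by rewrite -big_nat_recr//= big_nat_recl.
    by rewrite addrA h addrC addKr.
  rewrite -[X in _ --> X]addr0; apply: cvgD; first exact: cL.
  apply: cvg_trans (_ : (fun n => n.+1%:R^-1 * (a n.+1 - a 0%N)) @ \oo --> 0).
    exact: cvg_app.
  apply/cvgr0Pnorm_le => e e0.
  have M0 : 0 <= M by exact: le_trans (aM 0%N).
  (* The numerator above is at most [2 * M]; the summand 1 keeps the denominator positive when [M]
     is 0. *)
  have : 0 < e / (2 * M + 1) by rewrite divr_gt0// ltr_wpDl// mulr_ge0.
  move=> e'0; near=> n.
  rewrite normrM ger0_norm ?invr_ge0//.
  apply: (@le_trans _ _ (e / (2 * M + 1) * (2 * M))).
    apply: ler_pM => //.
      by apply: ltW; near: n; exact: (near_infty_natSinv_lt (PosNum e'0)).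
    by rewrite (le_trans (ler_normB _ _))// mulr_natl mulr2n lerD.
  rewrite -mulrA ler_piMr ?(ltW e0)// mulrC ler_pdivrMr ?mul1r ?lerDl//.
  by rewrite ltr_wpDl// mulr_ge0.
Unshelve. all: by end_near. Qed.

End BanachLimit.

(** The sum counts the integers among 1, ..., n that are at most [z]: it is the minimum of [n] and
    the integer part of [z]. This gives the present bound and, for [z <= n], the reverse one up to
    1. *)
Lemma sum_indic_floor_le (R : realType) (n : nat) (z : R) : 0 <= z ->
  \sum_(i < n) ((i.+1%:R <= z)%R : nat)%:R <= z.
Proof.
move=> z0; have le_n k : \sum_(i < k) ((i.+1%:R <= z)%R : nat)%:R <= k%:R :> R.
  elim: k => [|k IH]; first by rewrite big_ord0.
  rewrite big_ord_recr/= -natr1 lerD//.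
  by case: (_ <= z).
elim: n => [|n IH]; first by rewrite big_ord0.
have [nz|zn] := leP n.+1%:R z; first exact: le_trans (le_n n.+1) nz.
by rewrite big_ord_recr/= (leNgt n.+1%:R z) zn addr0.
Qed.

Lemma sum_indic_floor_ge (R : realType) (n : nat) (z : R) : z <= n%:R ->
  z <= \sum_(i < n) ((i.+1%:R <= z)%R : nat)%:R + 1.
Proof.
elim: n => [|n IH] zn; first by rewrite big_ord0 add0r (le_trans zn).
rewrite big_ord_recr/=.
have [nz|/ltW/IH h] := leP n%:R z; last first.
  by rewrite (le_trans h)// lerD2r lerDl.
suff -> : \sum_(i < n) ((i.+1%:R <= z)%R : nat)%:R = n%:R :> R.
  by rewrite -addrA (le_trans zn)// -natr1 lerD2l lerDr.
rewrite (eq_bigr (fun=> 1)) ?sumr_const ?card_ord// => i _.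
by rewrite (le_trans _ nz)// ler_nat.
Qed.

Section LayerCake.
Context {R : realType} d (S : measurableType d) (Q : probability S R).
Variable f : S -> R.
Hypotheses (mf : measurable_fun setT f) (f01 : forall x, 0 <= f x <= 1).

(** The set where [f] is at least (i + 1) / n, written without division. It is closed when [f] is
    continuous, so a set function on closed sets can measure it. *)
Definition superlevel (n i : nat) : set S := [set x | i.+1%:R <= n%:R * f x].

Lemma measurable_superlevel n i : measurable (superlevel n i).
Proof.
rewrite -[X in measurable X]setTI; apply: measurable_fun_ler => //.
by apply: measurable_funM.
Qed.

Lemma integral01_le1 : (\int[Q]_x (f x)%:E <= 1)%E.
Proof.
apply: (@le_trans _ _ (\int[Q]_x (cst 1 x))%E).
  apply: ge0_le_integral => //; first by move=> x _; rewrite lee_fin; have /andP[] := f01 x.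
    exact/measurable_EFinP.
  by move=> x _; rewrite lee_fin; have /andP[] := f01 x.
by rewrite integral_cst// mul1e -[X in (X <= _)%E]/(Q setT) probability_setT.
Qed.

Lemma integral01_ge0 : (0 <= \int[Q]_x (f x)%:E)%E.
Proof. by apply: integral_ge0 => x _; rewrite lee_fin; have /andP[] := f01 x. Qed.

Lemma fin_num_integral01 : (\int[Q]_x (f x)%:E)%E \is a fin_num.
Proof.
by rewrite ge0_fin_numE ?integral01_ge0// (le_lt_trans integral01_le1)// ltry.
Qed.

Lemma fine_integral01 : 0 <= fine (\int[Q]_x (f x)%:E)%E <= 1.
Proof.
by rewrite -!lee_fin fineK ?fin_num_integral01// integral01_ge0 integral01_le1.
Qed.

Lemma fine_integral01C :
  fine (\int[Q]_x (1 - f x)%:E)%E = 1 - fine (\int[Q]_x (f x)%:E)%E.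
Proof.
have f1 x : 0 <= 1 - f x by have /andP[_ ?] := f01 x; rewrite subr_ge0.
have m1f : measurable_fun setT (fun x => (1 - f x)%:E).
  by apply/measurable_EFinP; exact: measurable_funB.
have aux (I J : \bar R) : J \is a fin_num -> (I + J = 1)%E ->
    fine I = 1 - fine J.
  by case: I J => [r| |] [t| |]//= _ /(congr1 fine)/= h; rewrite -[1]h addrK.
apply: aux; first exact: fin_num_integral01.
rewrite -ge0_integralD//; last 3 first.
    by move=> x _; rewrite lee_fin.
    by move=> x _; rewrite lee_fin; have /andP[] := f01 x.
    exact/measurable_EFinP.
  transitivity (\int[Q]_x (cst 1 x))%E.
    by apply: eq_integral => x _; rewrite /= -EFinD subrK.
  by rewrite integral_cst// mul1e; exact: probability_setT.
Qed.

Let step n x : R := \sum_(i < n) \1_(superlevel n i) x.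

Let stepE n x : step n x = \sum_(i < n) ((i.+1%:R <= n%:R * f x)%R : nat)%:R.
Proof.
apply: eq_bigr => i _; rewrite indicE; congr (nat_of_bool _)%:R.
by apply/idP/idP => [/set_mem|/mem_set].
Qed.

Let mstep n : measurable_fun setT (step n).
Proof.
by apply: measurable_sum => i; apply: measurable_indic; exact: measurable_superlevel.
Qed.

Let step_ge0 n x : 0 <= step n x.
Proof. by apply: sumr_ge0 => i _. Qed.

Let int_step n : (\int[Q]_x (step n x)%:E)%E =
  (\sum_(i < n) fine (Q (superlevel n i)))%:E.
Proof.
under eq_integral do rewrite /step -sumEFin.
rewrite ge0_integral_sum//; last first.
  by move=> i; apply/measurable_EFinP/measurable_indic/measurable_superlevel.
rewrite -sumEFin; apply: eq_bigr => i _.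
rewrite integral_indic ?setIT ?fineK ?fin_num_measure//; exact: measurable_superlevel.
Qed.

Let int_nf n : (\int[Q]_x (n%:R * f x)%:E)%E = (n%:R * fine (\int[Q]_x (f x)%:E)%E)%:E.
Proof.
under eq_integral do rewrite EFinM.
rewrite ge0_integralZl_EFin//.
- by rewrite EFinM fineK// fin_num_integral01.
- by move=> x _; rewrite lee_fin; have /andP[] := f01 x.
- exact/measurable_EFinP.
Qed.

(** Integrates a step function lying between [n * f - 1] and [n * f]. The error is at most 1 for
    every [n] and vanishes after division by [n]; bounds on closed sets thus pass to integrals of
    continuous functions. *)
Lemma layer_cake_le n :
  \sum_(i < n) fine (Q (superlevel n i)) <= n%:R * fine (\int[Q]_x (f x)%:E)%E.
Proof.
rewrite -lee_fin -int_step -int_nf; apply: ge0_le_integral => //.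
- by move=> x _; rewrite lee_fin.
- exact/measurable_EFinP.
- by apply/measurable_EFinP; exact: measurable_funM.
- move=> x _; rewrite lee_fin stepE; apply: sum_indic_floor_le.
  by rewrite mulr_ge0//; have /andP[] := f01 x.
Qed.

Lemma layer_cake_ge n :
  n%:R * fine (\int[Q]_x (f x)%:E)%E <= \sum_(i < n) fine (Q (superlevel n i)) + 1.
Proof.
rewrite -lee_fin -int_nf EFinD -int_step.
have -> : (1%:E = \int[Q]_x (cst 1 x) :> \bar R)%E.
  by rewrite integral_cst// mul1e -[RHS]/(Q setT) probability_setT.
rewrite -ge0_integralD//.
- apply: ge0_le_integral => //.
  + by move=> x _; rewrite lee_fin mulr_ge0//; have /andP[] := f01 x.
  + by apply/measurable_EFinP; exact: measurable_funM.
  + by apply: emeasurable_funD => //; exact/measurable_EFinP.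
  + move=> x _; rewrite lee_fin stepE; apply: sum_indic_floor_ge.
    by rewrite ler_piMr//; have /andP[] := f01 x.
- by move=> x _; rewrite lee_fin.
- exact/measurable_EFinP.
Qed.

End LayerCake.

Section ProbabilityOfMeasure.
Context {R : realType} d (T : measurableType d) (m : {measure set T -> \bar R}).

(** The proof of unit mass is carried as an argument so that the probability instance can be
    attached to the term. *)
Definition unit_mass_measure (m1 : m setT = 1%E) : set T -> \bar R := m.

Variable m1 : m setT = 1%E.

HB.instance Definition _ := Measure.on (unit_mass_measure m1).
HB.instance Definition _ :=
  Measure_isProbability.Build _ _ _ (unit_mass_measure m1) m1.

Lemma ex_probability : exists p : probability T R, (p : set T -> \bar R) = m.
Proof. by exists (unit_mass_measure m1). Qed.

End ProbabilityOfMeasure.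

Section LimitMeasure.
Context {R : realType} {K : ptopologicalType} d (O : measurableType d).
Hypotheses (hK : hausdorff_space K) (cK : compact [set: K]).
Variables (P : probability O R) (Z : nat -> O -> borel K).
Hypothesis mZ : forall t, measurable_fun setT (Z t).

Let preZ t (A : set (borel K)) : measurable A -> measurable (Z t @^-1` A).
Proof. by move=> mA; rewrite -[X in measurable X]setTI; exact: mZ. Qed.

(** Let [L] be a Banach limit and [l F] its value on the sequence of probabilities that [Z t] lies
    in [F]. The measure built from [l] integrates a continuous [f] to the [L]-limit of the means of
    [f (Z t)], although it is only known to dominate [l] on closed sets. Equalities valid at every
    time, and the shift invariance of [L], are then inherited. *)
Lemma ex_limit_measure : exists m : probability (borel K) R,
  (forall f g : K -> R, continuous f -> continuous g ->
    (forall x, 0 <= f x <= 1) -> (forall x, 0 <= g x <= 1) ->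
    (forall t, \int[P]_w (f (Z t w))%:E = \int[P]_w (g (Z t w))%:E)%E ->
    (\int[m]_x (f x)%:E = \int[m]_x (g x)%:E)%E) /\
  (forall (f : K -> R) (s : K -> K), continuous f -> continuous s ->
    (forall x, 0 <= f x <= 1) -> (forall t w, Z t.+1 w = s (Z t w)) ->
    (\int[m]_x (f (s x))%:E = \int[m]_x (f x)%:E)%E).
Proof.
have [L [LD LZ Lle L1 LS]] := @ex_banach_limit R.
pose p F t := fine (P (Z t @^-1` F)).
have p_fin F t : closed F -> (p F t)%:E = P (Z t @^-1` F).
  by move=> cF; rewrite fineK// fin_num_measure//; apply: preZ; exact: closed_borel.
have p01 F t : closed F -> 0 <= p F t <= 1.
  move=> cF; rewrite -!lee_fin p_fin// measure_ge0 probability_le1//.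
  by apply: preZ; exact: closed_borel.
have bp F : closed F -> bounded_seq (p F).
  by move=> cF; apply: bounded_seq01 => t; exact: p01.
pose l F := L (p F).
have l0 : l set0 = 0.
  have -> : l set0 = L (fun n => 0 * p setT n).
    congr L; apply/funext => t; rewrite mul0r /p preimage_set0 measure0//.
  by rewrite LZ ?mul0r//; apply: bp; exact: closedT.
have l_mono F1 F2 : closed F1 -> closed F2 -> F1 `<=` F2 -> l F1 <= l F2.
  move=> c1 c2 F12; apply: Lle; [exact: bp|exact: bp|move=> t].
  rewrite -lee_fin !p_fin//; apply: le_measure.
  - by apply/mem_set/preZ; exact: closed_borel.
  - by apply/mem_set/preZ; exact: closed_borel.
  - by move=> w; exact: F12.
have l_subadd F1 F2 : closed F1 -> closed F2 -> l (F1 `|` F2) <= l F1 + l F2.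
  move=> c1 c2; rewrite -LD; [|exact: bp|exact: bp].
  apply: Lle; [by apply: bp; exact: closedU|by apply: bounded_seqD; exact: bp|].
  move=> t; rewrite -lee_fin EFinD !p_fin//; last exact: closedU.
  by rewrite preimage_setU measureU2//; apply: preZ; exact: closed_borel.
have l_add F1 F2 : closed F1 -> closed F2 -> F1 `&` F2 = set0 ->
    l F1 + l F2 <= l (F1 `|` F2).
  move=> c1 c2 F12; rewrite -LD; [|exact: bp|exact: bp].
  apply: Lle; [by apply: bounded_seqD; exact: bp|by apply: bp; exact: closedU|].
  move=> t; rewrite -lee_fin EFinD !p_fin//; last exact: closedU.
  rewrite preimage_setU [leRHS](_ : _ = P (Z t @^-1` F1) + P (Z t @^-1` F2))%E//.
  apply: measureU; [by apply: preZ; exact: closed_borel..|].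
  by rewrite -preimage_setI F12 preimage_set0.
have [m0 lm0 m0T] := ex_measure_above_content hK cK l0 l_mono l_subadd l_add.
have lT : l setT = 1.
  rewrite -L1; congr L; apply/funext => t.
  by rewrite /p preimage_setT probability_setT.
have m0P : (m0 setT = 1)%E by rewrite m0T lT.
have [m mE] := ex_probability m0P.
pose e (f : K -> R) t := fine (\int[P]_w (f (Z t w))%:E)%E.
have mfZ (f : K -> R) t : continuous f -> measurable_fun setT (fun w => f (Z t w)).
  by move=> cf; exact: (measurableT_comp (continuous_measurableR cf)).
have be (f : K -> R) : continuous f -> (forall x, 0 <= f x <= 1) -> bounded_seq (e f).
  move=> cf f01; apply: bounded_seq01 => t.
  by apply: fine_integral01 => //; exact: mfZ.
have sumL n (F : nat -> set K) : (forall i, closed (F i)) ->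
    bounded_seq (fun t => \sum_(i < n) p (F i) t) /\
    \sum_(i < n) l (F i) = L (fun t => \sum_(i < n) p (F i) t).
  move=> cF; elim: n => [|n [IHb IH]].
    split; first by exists 0 => t; rewrite big_ord0 normr0.
    rewrite big_ord0 -l0; congr L; apply/funext => t.
    by rewrite big_ord0 /p preimage_set0 measure0.
  have E : (fun t => \sum_(i < n.+1) p (F i) t) =
      (fun t => \sum_(i < n) p (F i) t) \+ p (F n).
    by apply/funext => t; rewrite big_ord_recr.
  by rewrite E; split; [apply: bounded_seqD => //; exact: bp|
     rewrite LD//; [rewrite big_ord_recr/= IH|exact: bp]].
(* The layer-cake bound under each [P], the domination of [l] by [m] on superlevel sets and the
   layer-cake bound under [m] are chained; the total error 1 does not depend on [n]. *)
have key (f : K -> R) : continuous f -> (forall x, 0 <= f x <= 1) ->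
    L (e f) <= fine (\int[m]_x (f x)%:E)%E.
  move=> cf f01.
  have mf : measurable_fun setT (f : borel K -> R) by exact: continuous_measurableR.
  have cF n i : closed (superlevel (f : borel K -> R) n i : set K).
    apply: (@closed_comp _ _ (fun x => n%:R * f x) [set y | i.+1%:R <= y]).
      by move=> x _; apply: cvgM; [exact: cvg_cst|exact: cf].
    exact: closed_ge.
  have h n : n%:R * L (e f) - 1 <= n%:R * fine (\int[m]_x (f x)%:E)%E.
    apply: le_trans (layer_cake_le m mf f01 n).
    apply: (@le_trans _ _ (\sum_(i < n) l (superlevel (f : borel K -> R) n i))); last first.
      apply: ler_sum => i _; rewrite -lee_fin fineK ?fin_num_measure//.
        by rewrite mE; exact: lm0.
      by apply: measurable_superlevel.
    have [bs ->] := sumL n (superlevel (f : borel K -> R) n) (cF n).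
    rewrite lerBlDr -LZ; last exact: be.
    have b1 : bounded_seq (cst (1 : R)) by exists 1 => t; rewrite normr1.
    rewrite -[X in _ <= _ + X]L1 -LD//; apply: Lle.
    - by apply: bounded_seqZ; exact: be.
    - exact: bounded_seqD.
    - move=> t; have := @layer_cake_ge _ _ _ P (f \o Z t) (mfZ _ _ cf) (fun w => f01 _) n.
      exact.
  rewrite leNgt; apply/negP => lt.
  have d0 : 0 < L (e f) - fine (\int[m]_x (f x)%:E)%E by rewrite subr_gt0.
  (* This [n] exceeds the inverse of the supposed gap, so [n] times the gap exceeds the error 1. *)
  have := h (Num.truncn (L (e f) - fine (\int[m]_x (f x)%:E)%E)^-1).+1.
  rewrite lerBlDr -lerBlDl -mulrBr leNgt => /negP; apply.
  by rewrite -ltr_pdivrMr// mul1r truncnS_gt.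
have keyE (f : K -> R) : continuous f -> (forall x, 0 <= f x <= 1) ->
    (\int[m]_x (f x)%:E = (L (e f))%:E)%E.
  move=> cf f01.
  have mf : measurable_fun setT (f : borel K -> R) by exact: continuous_measurableR.
  rewrite -(fineK (fin_num_integral01 m mf f01)); congr (_)%:E.
  apply/eqP; rewrite eq_le; apply/andP; split; last exact: key.
  have cf1 : continuous (fun x => 1 - f x : R).
    by move=> x; apply: cvgB; [exact: cvg_cst|exact: cf].
  have f101 x : 0 <= 1 - f x <= 1.
    by have /andP[f0 f1] := f01 x; rewrite subr_ge0 f1 lerBlDr lerDl.
  (* The reverse inequality is [key] for [1 - f]: [m] has mass 1 and [L] sends the constant 1 to
     1. *)
  have := key _ cf1 f101; rewrite (fine_integral01C m mf f01).
  have -> : L (e (fun x => 1 - f x)) = 1 - L (e f).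
    have b1 : bounded_seq (cst (1 : R)) by exists 1 => t; rewrite normr1.
    rewrite -mulN1r -LZ; last exact: be.
    rewrite -[X in X + _]L1 -LD//; last by apply: bounded_seqZ; exact: be.
    congr L; apply/funext => t; rewrite /e /= mulN1r.
    by rewrite (@fine_integral01C _ _ _ P (fun w => f (Z t w)))//; exact: mfZ.
  by rewrite lerD2l lerN2.
exists m; split.
- move=> f g cf cg f01 g01 fg; rewrite !keyE//; congr (L _)%:E.
  by apply/funext => t; rewrite /e fg.
- move=> f s cf cs f01 Zs.
  rewrite !keyE//; last by move=> x; apply: continuous_comp; [exact: cs|exact: cf].
  congr (_)%:E; rewrite -[RHS]LS; last exact: be.
  by congr L; apply/funext => t; rewrite /e; congr fine; apply: eq_integral => w _; rewrite Zs.
Qed.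

End LimitMeasure.

(** * Measurements given the states *)

Section Independence.
Context {R : realType} d (O : measurableType d) (P : probability O R).

(** Independence says that the constant kernel given by the law of [Z] is a conditional law of [Z]
    given [W]. *)
Lemma integral_indep d1 d2 (S1 : measurableType d1) (S2 : measurableType d2)
    (W : O -> S1) (Z : O -> S2) (f : S1 * S2 -> \bar R) :
  measurable_fun setT W -> measurable_fun setT Z ->
  (forall A B, measurable A -> measurable B ->
    P (W @^-1` A `&` Z @^-1` B) = P (W @^-1` A) * P (Z @^-1` B))%E ->
  measurable_fun setT f -> (forall p, 0 <= f p)%E ->
  (\int[P]_w f (W w, Z w) = \int[P]_w \int[P]_w' f (W w, Z w'))%E.
Proof.
move=> mW mZ WZ mf f0.
have ZT : pushforward P Z setT = 1%E by rewrite /pushforward preimage_setT probability_setT.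
have [lZ lZE] := ex_probability ZT.
pose k : R.-pker S1 ~> S2 :=
  kprobability (measurable_cst (lZ : pprobability S2 R) : measurable_fun [set: S1] _).
rewrite (@integral_joint_kernel _ _ _ _ _ _ _ P W Z k)//.
  apply: eq_integral => w _.
  transitivity (\int[pushforward P Z]_e f (W w, e))%E.
    by rewrite -lZE.
  rewrite ge0_integral_pushforward//.
  by apply: measurableT_comp => //; exact: pair1_measurable.
move=> A B mA mB; rewrite WZ//.
rewrite (_ : (fun _ => _) = cst (P (Z @^-1` B))); last first.
  by apply/funext => w; rewrite -[RHS]/(pushforward P Z B) -lZE.
rewrite integral_cst//; first by rewrite muleC.
by rewrite -[X in measurable X]setTI; exact: mW.
Qed.

Context dV (VT : measurableType dV) (I : eqType) (rho : probability VT R)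
  (V : I -> O -> VT).
Hypothesis iidV : iid P rho V.

Let mV i : measurable_fun setT (V i). Proof. by have [] := iidV. Qed.

(** General factors over [s] are mixed with indicator factors over [s'] so that induction on [s] can
    hand one index at a time over to [s']; with [s] empty this is the definition of [iid]. *)
Let iid_mixed (s s' : seq I) (phi : I -> VT -> R) (C : I -> set VT) :
  uniq (s ++ s') -> (forall i, measurable_fun setT (phi i)) ->
  (forall i v, 0 <= phi i v <= 1) -> (forall i, measurable (C i)) ->
  (\int[P]_w (\prod_(i <- s) phi i (V i w) *
              \prod_(i <- s') \1_(C i) (V i w))%:E =
   (\prod_(i <- s) fine (\int[rho]_v (phi i v)%:E) *
    \prod_(i <- s') fine (rho (C i)))%R%:E)%E.
Proof.
move=> + mphi phi01; elim: s s' C => [|i s IH] s' C us mC.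
  under eq_integral do rewrite big_nil mul1r.
  rewrite big_nil mul1r.
  transitivity (\int[P]_w (\1_(\big[setI/setT]_(i <- s') (V i @^-1` C i)) w)%:E)%E.
    apply: eq_integral => w _; congr (_%:E).
    elim: {us} s' => [|i s' IH]; first by rewrite !big_nil indicT.
    by rewrite !big_cons indicI IH.
  rewrite integral_indic// ?setIT; last first.
    apply: big_ind => //; first exact: measurableI.
    by move=> i _; rewrite -[X in measurable X]setTI; exact: mV.
  transitivity (\prod_(i <- s') rho (C i))%E; first exact: (iidV.2 s' C us mC).
  elim: {us} s' => [|i s' IH]; first by rewrite !big_nil.
  by rewrite !big_cons IH EFinM fineK// fin_num_measure.
pose psi w := \prod_(j <- s) phi j (V j w) * \prod_(j <- s') \1_(C j) (V j w) : R.
have mpsi : measurable_fun setT psi.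
  apply: measurable_funM; apply: measurable_prod => j _.
    exact: measurableT_comp.
  by apply: measurableT_comp => //; exact: measurable_indic.
have psi0 w : 0 <= psi w.
  rewrite mulr_ge0//; apply: prodr_ge0 => j _ //.
  by have /andP[] := phi01 j (V j w).
(* The law of [V i] weighted by all other factors. The induction hypothesis, with an indicator at
   [i], identifies it as [c] times [rho]; integrating [phi i] against it gives the claim. *)
have [m mE mI] := @ex_weighted_law _ _ _ _ _ P (fun w => (psi w)%:E) (V i)
  (proj2 (measurable_EFinP _ _) mpsi) psi0 (mV i).
pose c : R := \prod_(j <- s) fine (\int[rho]_v (phi j v)%:E)%E *
  \prod_(j <- s') fine (rho (C j)).
have c0 : 0 <= c.
  rewrite mulr_ge0//; apply: prodr_ge0 => j _; rewrite ?fine_ge0//.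
  by apply: integral_ge0 => v _; rewrite lee_fin; have /andP[] := phi01 j v.
have /andP[ins us'] : (i \notin s ++ s') && uniq (s ++ s') by exact: us.
have is' : i \notin s' by apply: contra ins => is'; rewrite mem_cat is' orbT.
have mA A : measurable A -> m A = (c%:E * rho A)%E.
  move=> mA; rewrite mE integral_mkcond.
  pose C' j := if j == i then A else C j.
  have C'E j : j \in s' -> C' j = C j.
    by move=> js'; rewrite /C'; case: eqP => // ji; move: is'; rewrite -ji js'.
  have us'' : uniq (s ++ i :: s').
    by rewrite -(perm_uniq (permEl (perm_catCA [:: i] s s'))).
  have mC' j : measurable (C' j) by rewrite /C'; case: ifP.
  have C'i : C' i = A by rewrite /C' eqxx.
  have E1 : \prod_(j <- s') fine (rho (C' j)) = \prod_(j <- s') fine (rho (C j)).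
    by apply: eq_big_seq => j js; rewrite C'E.
  have E2 w : \prod_(j <- s') \1_(C' j) (V j w) = \prod_(j <- s') \1_(C j) (V j w) :> R.
    by apply: eq_big_seq => j js; rewrite C'E.
  have := IH (i :: s') C' us'' mC'.
  rewrite big_cons E1 C'i mulrCA mulrC -/c EFinM fineK ?fin_num_measure// => <-.
  apply: eq_integral => w _; rewrite big_cons E2 C'i.
  rewrite patchE indicE /psi.
  have -> : (w \in V i @^-1` A) = (V i w \in A) by apply/idP/idP => /set_mem /mem_set.
  by case: (V i w \in A); rewrite /= ?mul1r// mul0r mulr0.
have -> : (\int[P]_w (\prod_(j <- i :: s) phi j (V j w) *
    \prod_(j <- s') \1_(C j) (V j w))%:E = \int[m]_v (phi i v)%:E)%E.
  rewrite mI//; last by move=> v; rewrite lee_fin; have /andP[] := phi01 i v.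
    by apply: eq_integral => w _; rewrite big_cons -mulrA EFinM.
  exact/measurable_EFinP.
transitivity (\int[mscale (NngNum c0) rho]_v (phi i v)%:E)%E.
  by apply: eq_measure_integral => A mAA _; rewrite mA.
rewrite ge0_integral_mscale//; last by move=> v _; rewrite lee_fin; have /andP[] := phi01 i v.
  rewrite big_cons -mulrA -/c EFinM fineK; last exact: fin_num_integral01.
  by rewrite muleC.
exact/measurable_EFinP.
Qed.

Lemma iid_integral_prod (s : seq I) (phi : I -> VT -> R) :
  uniq s -> (forall i, measurable_fun setT (phi i)) ->
  (forall i v, 0 <= phi i v <= 1) ->
  (\int[P]_w (\prod_(i <- s) phi i (V i w))%:E =
   (\prod_(i <- s) fine (\int[rho]_v (phi i v)%:E)%E)%:E)%E.
Proof.
move=> us mphi phi01.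
have := @iid_mixed s [::] phi (fun=> setT); rewrite cats0 => /(_ us mphi phi01).
rewrite !big_nil !mulr1 => <- //.
by apply: eq_integral => w _; rewrite !big_nil mulr1.
Qed.

End Independence.

Lemma compact_second_countable_pmetric (R : realType) (K : pmetricType R) :
  compact [set: K] -> @second_countable K.
Proof. exact: (@compact_second_countable R K). Qed.

Section GeneratedSigmaAlgebra.
Context d (O : measurableType d) d1 (S : measurableType d1) (I : Type).
Variables (D : set I) (Z : I -> O -> S).

(** The generating family behind [sigma_of], named so that [O] with this coarser sigma-algebra is a
    measurable type of its own. Conditioning on a sigma-algebra becomes conditioning on the identity
    map into that type. *)
Definition generators : set (set O) :=
  \bigcup_(i in D) preimage_set_system setT (Z i) measurable.

Lemma measurable_generators i : D i ->
  measurable_fun setT (Z i : g_sigma_algebraType generators -> S).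
Proof.
move=> Di _ A mA; apply: sub_sigma_algebra; exists i => //.
by exists A.
Qed.

Hypothesis mZ : forall i, measurable_fun setT (Z i).

Lemma generators_measurable : generators `<=` measurable.
Proof. by move=> _ [i _ [A mA <-]]; exact: mZ. Qed.

Lemma sigma_generators_measurable : <<s generators >> `<=` @measurable _ O.
Proof.
by apply: smallest_sub; [exact: sigma_algebra_measurable|exact: generators_measurable].
Qed.

Lemma measurable_id_generators :
  measurable_fun setT (id : O -> g_sigma_algebraType generators).
Proof. by move=> _ A mA; rewrite setTI; exact: sigma_generators_measurable. Qed.

End GeneratedSigmaAlgebra.

Section ControlFreeSystem.
Context {R : realType} {X Y : pmetricType R}.
Context {dV : measure_display} {VT : measurableType dV}.
Variables (G : borel X * VT -> borel Y) (pV : probability VT R).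
Variables (T : R.-pker (borel X) ~> (borel X))
          (Q : R.-pker (borel X) ~> (borel Y)).
Hypothesis mG : measurable_fun setT G.
Hypothesis Q_channel : forall (x : borel X) (C : set (borel Y)), measurable C ->
  Q x C = pV [set v | C (G (x, v))].
Hypothesis cY : compact [set: Y].

Context {d : measure_display} {O : measurableType d}.
Variables (P : probability O R) (Xt : int -> O -> borel X) (Vt : int -> O -> VT).
Hypothesis process : control_free pV T P Xt Vt.

Let mX t : measurable_fun setT (Xt t). Proof. exact: state_measurable process t. Qed.

Let mV t : measurable_fun setT (Vt t). Proof. by have [] := noise_iid process. Qed.

Lemma measurable_measurement t : measurable_fun setT (measurement G Xt Vt t).
Proof. by apply: measurableT_comp => //; exact/measurable_fun_pair. Qed.

Lemma measurable_past t : measurable_fun setT (past G Xt Vt t).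
Proof.
apply: (@measurable_fun_ptws _ _ nat Y).
  exact: compact_second_countable_pmetric.
by move=> k; exact: measurable_measurement.
Qed.

Lemma integral_channel x (phi : borel Y -> \bar R) :
  measurable_fun setT phi -> (forall y, 0 <= phi y)%E ->
  (\int[Q x]_y phi y = \int[pV]_v phi (G (x, v)))%E.
Proof.
move=> mphi phi0.
have mGx : measurable_fun setT (fun v => G (x, v)).
  by apply: measurableT_comp => //; exact: pair1_measurable.
transitivity (\int[pushforward pV (fun v => G (x, v))]_y phi y)%E.
  by apply: eq_measure_integral => A mA _; rewrite Q_channel.
by rewrite ge0_integral_pushforward.
Qed.

(* Given the states, the measurements are independent with laws Q(.|X_s). *)
Lemma integral_measurements (t : int) (n : nat) (F : O -> \bar R)
    (phi : nat -> borel Y -> R) :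
  measurable_fun setT (F : g_sigma_algebraType (generators setT Xt) -> \bar R) ->
  (forall w, 0 <= F w)%E ->
  (forall k, measurable_fun setT (phi k)) -> (forall k y, 0 <= phi k y <= 1) ->
  (\int[P]_w (F w * (\prod_(0 <= k < n) phi k (measurement G Xt Vt (t - k%:Z)%R w))%R%:E) =
   \int[P]_w (F w * (\prod_(0 <= k < n) kernel_mean Q (phi k) (Xt (t - k%:Z)%R w))%R%:E))%E.
Proof.
move=> mF F0 mphi phi01.
(* States and noises are read through the identity into two coarser copies of [O]; independence then
   separates them into two integration variables. *)
pose SX := g_sigma_algebraType (generators setT Xt).
pose SV := g_sigma_algebraType (generators setT Vt).
pose f (p : SX * SV) : \bar R := (F p.1 *
  (\prod_(0 <= k < n) phi k (G (Xt (t - k%:Z)%R p.1, Vt (t - k%:Z)%R p.2)))%R%:E)%E.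
have mf : measurable_fun setT f.
  apply: emeasurable_funM; first exact: (measurableT_comp mF measurable_fst).
  apply/measurable_EFinP; apply: measurable_prod => k _.
  apply: (measurableT_comp (mphi k)); apply: (measurableT_comp mG).
  apply/measurable_fun_pair.
    exact: (measurableT_comp (@measurable_generators _ _ _ _ _ setT Xt _ I) measurable_fst).
  exact: (measurableT_comp (@measurable_generators _ _ _ _ _ setT Vt _ I) measurable_snd).
have f0 p : (0 <= f p)%E.
  rewrite mule_ge0// lee_fin; apply: prodr_ge0 => k _.
  by have /andP[] := phi01 k (G (Xt (t - k%:Z)%R p.1, Vt (t - k%:Z)%R p.2)).
have := @integral_indep _ _ _ P _ _ SX SV id id f
  (measurable_id_generators mX) (measurable_id_generators mV) _ mf f0.
move=> -> //; last by move=> A B sA sB; exact: (noise_indep process).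
apply: eq_integral => w _; rewrite /f /=.
have mG' k : measurable_fun setT (fun v => phi k (G (Xt (t - k%:Z) w, v))).
  apply: (measurableT_comp (mphi k)); apply: (measurableT_comp mG).
  exact: pair1_measurable.
rewrite ge0_integralZl//; last 2 first.
- apply/measurable_EFinP; apply: measurable_prod => k _.
  exact: (measurableT_comp (mG' k) (mV _)).
- move=> w' _; rewrite lee_fin; apply: prodr_ge0 => k _.
  by have /andP[] := phi01 k (G (Xt (t - k%:Z) w, Vt (t - k%:Z) w')).
congr (_ * _)%E.
(* The noises involved are indexed by the integer times [t - k]; [psi] recovers [k] from a time [i]
   as [absz (t - i)]. *)
pose s := [seq t - k%:Z | k <- index_iota 0 n].
pose psi (i : int) v := phi (absz (t - i)%R) (G (Xt i w, v)).
have tk (k : nat) : absz (t - (t - k%:Z))%R = k by rewrite opprB addrC subrK absz_nat.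
have us : uniq s.
  rewrite map_inj_uniq ?iota_uniq// => i j /addrI/oppr_inj.
  by case.
transitivity (\int[P]_w' (\prod_(i <- s) psi i (Vt i w'))%:E)%E.
  apply: eq_integral => w' _; rewrite big_map; congr (_%:E).
  by apply: eq_bigr => k _; rewrite /psi tk.
rewrite (iid_integral_prod (noise_iid process) us).
- rewrite big_map; congr (_%:E); apply: eq_bigr => k _.
  rewrite /kernel_mean integral_channel//; last 2 first.
    exact/measurable_EFinP.
    by move=> y; rewrite lee_fin; have /andP[] := phi01 k y.
  by congr fine; apply: eq_integral => v _; rewrite /psi tk.
- move=> i; apply: (measurableT_comp (mphi _)); apply: (measurableT_comp mG).
  exact: pair1_measurable.
- by move=> i v; exact: phi01.
Qed.

(** The first argument of [f] is the sample point, seen only through the states up to time [t];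
    [state_markov] is the case of rectangles. *)
Lemma markov_integral (t : int)
    (f : g_sigma_algebraType (generators [set s : int | s <= t] Xt) * borel X -> \bar R) :
  measurable_fun setT f -> (forall p, 0 <= f p)%E ->
  (\int[P]_w f (w, Xt (t + 1)%R w) = \int[P]_w \int[T (Xt t w)]_x f (w, x))%E.
Proof.
move=> mf f0.
pose S := g_sigma_algebraType (generators [set s : int | s <= t] Xt).
have mXt : measurable_fun setT (Xt t : S -> borel X).
  by apply: measurable_generators => /=.
apply: (@integral_joint_kernel _ _ _ _ O S (borel X) P id (Xt (t + 1))
  (kernel_precomp T mXt)) => //.
- exact: measurable_id_generators.
- by move=> A B sA mB; exact: (state_markov process).
Qed.

End ControlFreeSystem.

(** * Cylinders and the joint law of the state and the past *)

Section Cylinders.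
Context {R : realType} {X Y : pmetricType R}.
Hypothesis cY : compact [set: Y].

Definition cylinder (B : set (borel X)) (n : nat) (C : nat -> set (borel Y)) :
    set (borel X * borel (history Y)) :=
  [set p | B p.1 /\ forall k, (k <= n)%N -> C k (p.2 k)].

Lemma measurable_ev k : measurable_fun setT ((fun h => h k) : borel (history Y) -> borel Y).
Proof. by apply: continuous_measurable; exact: ev_continuous. Qed.

Lemma measurable_fun_history d (O : measurableType d) (f : O -> borel (history Y)) :
  (forall k, measurable_fun setT ((fun w => f w k) : O -> borel Y)) ->
  measurable_fun setT f.
Proof.
by move=> mf; apply: (@measurable_fun_ptws _ _ nat Y) => //;
  exact: compact_second_countable_pmetric.
Qed.

Lemma measurable_cylinder B n C : measurable B -> (forall k, measurable (C k)) ->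
  measurable (cylinder B n C).
Proof.
move=> mB mC.
have -> : cylinder B n C = fst @^-1` B `&`
    \bigcap_(k in [set k | (k <= n)%N]) ((fun p => p.2 k) @^-1` C k).
  by apply/seteqP; split.
apply: measurableI; first by rewrite -[X in measurable X]setTI; exact: measurable_fst.
apply: bigcap_measurableType => k _; rewrite -[X in measurable X]setTI.
by apply: (measurableT_comp (measurable_ev k) measurable_snd).
Qed.

Let Cyl : set (set (borel X * borel (history Y))) :=
  [set E | exists B n C, [/\ measurable B, forall k, measurable (C k) & E = cylinder B n C] ].

(** The state and each single measurement are measurable for the sigma-algebra of cylinders; by
    second countability of [Y], so is the identity. *)
Lemma measurable_sub_cylinders :
  @measurable _ (borel X * borel (history Y))%type `<=`
  <<s Cyl >>.
Proof.
pose S : measurableType _ := g_sigma_algebraType Cyl.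
suff mid : measurable_fun setT (id : S -> borel X * borel (history Y)).
  by move=> E mE; have := mid measurableT E mE; rewrite setTI.
apply/measurable_fun_pairP; split.
  move=> _ B mB; rewrite setTI; apply: sub_sigma_algebra.
  exists B, 0%N, (fun=> setT); split=> //.
  by apply/seteqP; split=> [p Bp|p []].
apply: measurable_fun_history => j _ A mA; rewrite setTI; apply: sub_sigma_algebra.
exists setT, j, (fun k => if k == j then A else setT); split=> //.
  by move=> k; case: ifP.
apply/seteqP; split=> [p Ap|p [_ /(_ j (leqnn _))]]; last by rewrite eqxx.
by split=> // k _; case: eqP => // ->.
Qed.

Lemma cylinders_measure_eq
    (m1 m2 : {measure set (borel X * borel (history Y)) -> \bar R}) :
  (m1 setT < +oo)%E ->
  (forall B n C, measurable B -> (forall k, measurable (C k)) ->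
    m1 (cylinder B n C) = m2 (cylinder B n C)) ->
  forall E, measurable E -> m1 E = m2 E.
Proof.
move=> m1fin m12 E mE.
apply: (@g_sigma_algebra_measure_unique _ _ _ Cyl _ (fun=> setT)).
- by move=> _ [B [n [C [mB mC ->]]]]; exact: measurable_cylinder.
- move=> _; exists setT, 0%N, (fun=> setT); split=> //.
  by apply/seteqP; split.
- by rewrite bigcup_const.
- move=> _ _ [B [n [C [mB mC ->]]]] [B' [n' [C' [mB' mC' ->]]]].
  (* The shorter cylinder imposes nothing beyond its own length, hence [setT] there. *)
  exists (B `&` B'), (maxn n n'), (fun k =>
    (if (k <= n)%N then C k else setT) `&` (if (k <= n')%N then C' k else setT)).
  split; first exact: measurableI.
    by move=> k; apply: measurableI; case: ifP.
  apply/seteqP; split=> [p [[Bp Cp] [B'p C'p]]|p [[Bp B'p] h]].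
    by split=> // k _; split; case: ifP => // kn; [exact: Cp|exact: C'p].
  split; split=> // k kn.
    have hk : (k <= maxn n n')%N by rewrite leq_max kn.
    by have [+ _] := h k hk; rewrite kn.
  have hk : (k <= maxn n n')%N by rewrite leq_max kn orbT.
  by have [_] := h k hk; rewrite kn.
- by move=> _ [B [n [C [mB mC ->]]]]; exact: m12.
- by [].
- exact: measurable_sub_cylinders.
Qed.

End Cylinders.

Section StepKernel.
Context {R : realType} {X Y : pmetricType R}.
Variables (T : R.-pker (borel X) ~> (borel X)) (Q : R.-pker (borel X) ~> (borel Y)).
Hypothesis cY : compact [set: Y].
Local Notation XH := (borel X * borel (history Y))%type.

Lemma measurable_extend d (O : measurableType d) (y : O -> borel Y)
    (h : O -> borel (history Y)) :
  measurable_fun setT y -> measurable_fun setT h ->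
  measurable_fun setT ((fun w => extend (y w) (h w)) : O -> borel (history Y)).
Proof.
move=> my mh; apply: measurable_fun_history => // -[|k]//=.
exact: (measurableT_comp (@measurable_ev R Y k) mh).
Qed.

Variable mu : probability XH R.

Let l : R.-pker unit ~> XH :=
  kprobability (measurable_cst (mu : pprobability XH R) : measurable_fun [set: unit] _).

Let m1 : measurable_fun setT (fun q : unit * XH => q.2.1).
Proof. exact: (measurableT_comp measurable_fst measurable_snd). Qed.

Let m2 : measurable_fun setT (fun q : unit * XH * borel X => q.2).
Proof. exact: measurable_snd. Qed.

Let m3 : measurable_fun setT
  ((fun q => (q.1.2, extend q.2 q.1.1.2.2)) : unit * XH * borel X * borel Y -> XH).
Proof.
apply/measurable_fun_pair; first exact: (measurableT_comp measurable_snd measurable_fst).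
apply: measurable_extend => //.
apply: (measurableT_comp measurable_snd); apply: (measurableT_comp measurable_snd).
exact: (measurableT_comp measurable_fst measurable_fst).
Qed.

Let k1 : R.-pker (unit * XH)%type ~> (borel X) := kernel_precomp T m1.
Let k2 : R.-pker (unit * XH * borel X)%type ~> (borel Y) := kernel_precomp Q m2.
Let k3 : R.-pker (unit * XH * borel X * borel Y)%type ~> XH := kdirac m3.
Let k23 : R.-sfker (unit * XH * borel X)%type ~> XH := mkcomp k2 k3.
Let k123 : R.-sfker (unit * XH)%type ~> XH := mkcomp k1 k23.

(** Makes the right-hand side of [invariant_law] a measure, so that it can be identified on
    cylinders alone. *)
Lemma ex_step_measure : exists m : {measure set XH -> \bar R},
  forall E, measurable E -> m E =
    (\int[mu]_p \int[T p.1]_x' Q x' [set y' | E (x', extend y' p.2)])%E.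
Proof.
exists (mkcomp l k123 tt) => E mE.
rewrite /mkcomp/= /kcomp/=; apply: eq_integral => p _.
rewrite /k123 /mkcomp/= /kcomp/=; apply: eq_integral => x _.
rewrite /k23 /mkcomp/= /kcomp/= /k2/= /kernel_precomp/= /k3 /kdirac/=.
transitivity (\int[Q x]_y (\1_[set y' | E (x, extend y' p.2)] y)%:E)%E.
  by apply: eq_integral => y _; rewrite diracE.
rewrite integral_indic// ?setIT//.
rewrite -[X in measurable X]setTI.
have h : measurable_fun setT (fun y' : borel Y => ((x, extend y' p.2) : XH)).
  by apply/measurable_fun_pair => //; apply: measurable_extend.
exact: h.
Qed.

End StepKernel.

Section Laws.
Context {R : realType} {X Y : pmetricType R}.
Context {dV : measure_display} {VT : measurableType dV}.
Variables (G : borel X * VT -> borel Y) (pV : probability VT R).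
Variables (T : R.-pker (borel X) ~> (borel X))
          (Q : R.-pker (borel X) ~> (borel Y)).
Hypothesis mG : measurable_fun setT G.
Hypothesis Q_channel : forall (x : borel X) (C : set (borel Y)), measurable C ->
  Q x C = pV [set v | C (G (x, v))].
Hypothesis cY : compact [set: Y].
Context {d : measure_display} {O : measurableType d}.
Variables (P : probability O R) (Xt : int -> O -> borel X) (Vt : int -> O -> VT).
Hypothesis process : control_free pV T P Xt Vt.
Local Notation XH := (borel X * borel (history Y))%type.

Let mX t : measurable_fun setT (Xt t). Proof. exact: state_measurable process t. Qed.

Let Z t w : XH := (Xt t w, past G Xt Vt t w).

Lemma measurable_state_past t : measurable_fun setT (Z t).
Proof. by apply/measurable_fun_pair => //; exact: (measurable_past mG cY process). Qed.

Let indic01 (C : set (borel Y)) y : 0 <= (\1_C y : R) <= 1.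
Proof. by rewrite indicE ler0n lern1 leq_b1. Qed.

Lemma kernel_mean_indic (C : set (borel Y)) x : measurable C ->
  (kernel_mean Q \1_C x)%:E = Q x C.
Proof.
by move=> mC; rewrite kernel_meanE ?integral_indic ?setIT.
Qed.

Lemma prod_indic_past t w n (C : nat -> set (borel Y)) :
  (\prod_(0 <= k < n) \1_(C k) (measurement G Xt Vt (t - k%:Z)%R w) : R) =
  \1_[set h : history Y | forall k, (k < n)%N -> C k (h k)] (past G Xt Vt t w).
Proof.
elim: n => [|n IH].
  by rewrite big_nil indicE mem_set.
rewrite big_nat_recr//= IH !indicE -natrM mulnb; congr (nat_of_bool _)%:R.
apply/andP/idP => [[/set_mem h /set_mem Cn]|/set_mem h]; last first.
  by split; apply/mem_set; [move=> k kn; apply: h; exact: ltnW|exact: h].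
apply/mem_set => k; rewrite ltnS leq_eqVlt => /predU1P[->//|]; exact: h.
Qed.

(** Integrating the measurements out through [Q] leaves an expectation that involves the states
    only. *)
Lemma prob_cylinder t B n C : measurable B -> (forall k, measurable (C k)) ->
  (P (Z t @^-1` cylinder B n C) = \int[P]_w ((\1_B (Xt t w))%:E *
    (\prod_(0 <= k < n.+1) kernel_mean Q \1_(C k) (Xt (t - k%:Z)%R w))%:E))%E.
Proof.
move=> mB mC.
rewrite -(integral_measurements mG Q_channel process t n.+1 (F := fun w => (\1_B (Xt t w))%:E)).
- rewrite -[X in P X]setIT -integral_indic//; last first.
    rewrite -[X in measurable X]setTI; apply: measurable_state_past => //.
    exact: measurable_cylinder.
  apply: eq_integral => w _; rewrite prod_indic_past -EFinM !indicE -natrM mulnb.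
  congr ((nat_of_bool _)%:R%:E); apply/idP/andP => [/set_mem[Bw Cw]|[/set_mem Bw /set_mem Cw]].
    by split; apply/mem_set.
  by apply/mem_set.
- apply/measurable_EFinP; apply: measurableT_comp; first exact: measurable_indic.
  by apply: measurable_generators.
- by move=> w; rewrite lee_fin.
- by move=> k; exact: measurable_indic.
- by move=> k y; exact: indic01.
Qed.

(** On a cylinder all measurements are averaged out, the Markov property is applied to the state at
    time [t + 1], and the measurements up to time [t] are put back by the same channel identity read
    in the other direction. *)
Lemma prob_step (mu : probability XH R) t :
  has_law P (Z t) mu -> forall E, measurable E ->
  (P (Z (t + 1)%R @^-1` E) =
   \int[mu]_p \int[T p.1]_x' Q x' [set y' | E (x', extend y' p.2)])%E.
Proof.
move=> [mZ Zmu] E mE.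
have [m mEq] := ex_step_measure T Q cY mu.
rewrite -mEq//; rewrite -[LHS]/(pushforward P (Z (t + 1)) E).
have mZ1 := measurable_state_past (t + 1).
apply: cylinders_measure_eq => //.
  by rewrite -[X in (X < _)%E]/(P setT) probability_setT ltry.
move=> B n C mB mC; rewrite -[LHS]/(P (Z (t + 1) @^-1` cylinder B n C)).
rewrite prob_cylinder// mEq; last exact: measurable_cylinder.
pose q k : borel X -> R := kernel_mean Q \1_(C k).
have mq k : measurable_fun setT (q k).
  by apply: measurable_kernel_mean; [exact: measurable_indic|exact: indic01].
have q01 k x : 0 <= q k x <= 1.
  by apply: kernel_mean01; [exact: measurable_indic|exact: indic01].
have q0 k x : 0 <= q k x by have /andP[] := q01 k x.
(* [C 0] concerns the new measurement at time [t + 1], and [C k.+1] the one at time [t - k]. *)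
pose prodq w : R := \prod_(0 <= k < n) q k.+1 (Xt (t - k%:Z) w).
have prodq0 w : 0 <= prodq w by apply: prodr_ge0.
pose S := g_sigma_algebraType (generators [set s : int | s <= t] Xt).
have mprodq : measurable_fun setT (prodq : S -> R).
  apply: measurable_prod => k _; apply: (measurableT_comp (mq k.+1)).
  by apply: measurable_generators; rewrite /= lerBlDr lerDl.
pose g (x : borel X) : R := \1_B x * q 0 x.
have g0 x : 0 <= g x by rewrite mulr_ge0.
have mg : measurable_fun setT g by apply: measurable_funM => //; exact: measurable_indic.
pose Phi x : \bar R := (\int[T x]_x' (g x')%:E)%E.
have Phi0 x : (0 <= Phi x)%E by apply: integral_ge0 => x' _; rewrite lee_fin.
have mPhi : measurable_fun setT (Phi : borel X -> \bar R).
  apply: measurable_fun_integral_kernel.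
  - by move=> U mU; exact: measurable_kernel.
  - by move=> x; rewrite lee_fin.
  - exact/measurable_EFinP.
pose D := [set h : borel (history Y) | forall k, (k < n)%N -> C k.+1 (h k)].
have mD : measurable D.
  have -> : D = \bigcap_(k in [set k | (k < n)%N]) ((fun h => h k) @^-1` C k.+1).
    by apply/seteqP; split.
  apply: bigcap_measurableType => k _; rewrite -[X in measurable X]setTI.
  exact: measurable_ev.
transitivity (\int[P]_w (g (Xt (t + 1) w) * prodq w)%:E)%E.
  apply: eq_integral => w _; rewrite -EFinM; congr (_%:E).
  rewrite big_nat_recl//= subr0 mulrA; congr (_ * _); apply: eq_bigr => k _.
  by rewrite -addn1 PoszD opprD addrACA subrr addr0.
rewrite (markov_integral process (f := fun r => (g r.2 * prodq r.1)%:E)); last 2 first.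
- apply/measurable_EFinP; apply: measurable_funM.
    exact: (measurableT_comp mg measurable_snd).
  exact: (measurableT_comp mprodq measurable_fst).
- by move=> r; rewrite lee_fin mulr_ge0.
transitivity (\int[P]_w (Phi (Xt t w) * (prodq w)%:E))%E.
  apply: eq_integral => w _; under eq_integral do rewrite /= EFinM.
  rewrite ge0_integralZr//; first exact/measurable_EFinP.
    by move=> x _; rewrite lee_fin.
  by rewrite lee_fin.
transitivity (\int[P]_w (Phi (Xt t w) *
    (\prod_(0 <= k < n) \1_(C k.+1) (measurement G Xt Vt (t - k%:Z)%R w))%:E))%E.
  apply/esym; apply: (integral_measurements mG Q_channel process t n
    (F := fun w => Phi (Xt t w)) (phi := fun k => \1_(C k.+1))) => //.
  by apply: (measurableT_comp mPhi); exact: measurable_generators.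
under eq_integral do rewrite (prod_indic_past _ _ _ (fun k => C k.+1)).
transitivity (\int[pushforward P (Z t)]_p (Phi p.1 * (\1_D p.2)%:E))%E.
  rewrite ge0_integral_pushforward//.
    apply: emeasurable_funM; first exact: (measurableT_comp mPhi measurable_fst).
    apply/measurable_EFinP; apply: (measurableT_comp _ measurable_snd).
    exact: measurable_indic.
  by move=> p _; rewrite mule_ge0// lee_fin.
rewrite (eq_measure_integral mu); last by move=> A mA _; exact: Zmu.
apply: eq_integral => p _; rewrite /Phi -ge0_integralZr//; last 2 first.
- exact/measurable_EFinP.
- by move=> x _; rewrite lee_fin.
apply: eq_integral => x _; rewrite /g.
have [Bx|Bx] := pselect (B x); last first.
  rewrite indicE memNset// mul0r mul0e [X in Q x X](_ : _ = set0) ?measure0//.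
  by apply/seteqP; split=> y // [].
have [Dp|Dp] := pselect (D p.2); last first.
  rewrite [\1_D _]indicE memNset// mule0 [X in Q x X](_ : _ = set0) ?measure0//.
  by apply/seteqP; split=> y // [_ h]; apply: Dp => k kn; exact: (h k.+1 kn).
rewrite !indicE !mem_set// mul1r mule1 kernel_mean_indic//; congr (Q x _).
apply/seteqP; split=> [y C0y|y [_ /(_ 0%N)]]; last exact.
by split=> // -[|k]//= kn; exact: Dp.
Qed.

Lemma has_law_next (mu : probability XH R) t : invariant_law T Q mu ->
  has_law P (Z t) mu -> has_law P (Z (t + 1)) mu.
Proof.
move=> inv Zmu; split; first exact: measurable_state_past.
by move=> E mE; rewrite (prob_step Zmu)// -inv.
Qed.

Lemma has_law_nat (mu : probability XH R) (t : nat) : invariant_law T Q mu ->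
  has_law P (Z 0) mu -> has_law P (Z t%:Z) mu.
Proof.
move=> inv Zmu; elim: t => // t IH.
by rewrite -addn1 PoszD; exact: has_law_next.
Qed.

Lemma invariant_law_of_shift (mu : probability XH R) t :
  has_law P (Z t) mu -> has_law P (Z (t + 1)) mu -> invariant_law T Q mu.
Proof. by move=> Zmu [_ Zmu1] E mE; rewrite -(prob_step Zmu)// Zmu1. Qed.

(** By [prob_cylinder] the joint law of state and past is determined by the law of the state
    history, whose invariance is therefore enough. *)
Lemma has_law_shift (mu : probability XH R) t :
  (forall A : set (borel (history X)), measurable A ->
    P [set w | A (fun k : nat => Xt (t + 1 - k%:Z) w)] =
    P [set w | A (fun k : nat => Xt (t - k%:Z) w)]) ->
  @second_countable X ->
  has_law P (Z t) mu -> has_law P (Z (t + 1)) mu.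
Proof.
move=> shX cX [mZ Zmu]; have mZ1 := measurable_state_past (t + 1).
split => // E mE; rewrite -Zmu//.
rewrite -[LHS]/(pushforward P (Z (t + 1)) E) -[RHS]/(pushforward P (Z t) E).
apply: cylinders_measure_eq => //.
  by rewrite -[X in (X < _)%E]/(P setT) probability_setT ltry.
move=> B n C mB mC; rewrite -[LHS]/(P (Z (t + 1) @^-1` cylinder B n C)).
rewrite -[RHS]/(P (Z t @^-1` cylinder B n C)) !prob_cylinder//.
pose Psi (x : borel (history X)) := ((\1_B (x 0%N))%:E *
    (\prod_(0 <= k < n.+1) kernel_mean Q \1_(C k) (x k))%:E)%E.
have mev k : measurable_fun setT ((fun x => x k) : borel (history X) -> borel X).
  exact: measurable_ev.
have mq k : measurable_fun setT (kernel_mean Q \1_(C k) : borel X -> R).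
  by apply: measurable_kernel_mean; [exact: measurable_indic|exact: indic01].
have mPsi : measurable_fun setT Psi.
  apply: emeasurable_funM; apply/measurable_EFinP.
    apply: (measurableT_comp _ (mev 0%N)); exact: measurable_indic.
  by apply: measurable_prod => k _; exact: (measurableT_comp (mq k) (mev k)).
have Psi0 x : (0 <= Psi x)%E.
  rewrite mule_ge0// lee_fin//; apply: prodr_ge0 => k _.
  suff /andP[] : 0 <= kernel_mean Q \1_(C k) (x k) <= 1 by [].
  by apply: kernel_mean01; [exact: measurable_indic|exact: indic01].
pose S s w : borel (history X) := fun k : nat => Xt (s - k%:Z) w.
have mS s : measurable_fun setT (S s).
  by apply: (@measurable_fun_ptws _ _ nat X) => // k; exact: mX.
transitivity (\int[pushforward P (S (t + 1)%R)]_x Psi x)%E.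
  by rewrite ge0_integral_pushforward//; apply: eq_integral => w _; rewrite /Psi /S /= subr0.
transitivity (\int[pushforward P (S t)]_x Psi x)%E; last first.
  by rewrite ge0_integral_pushforward//; apply: eq_integral => w _; rewrite /Psi /S /= subr0.
by apply: eq_measure_integral => A mA _; exact: shX.
Qed.

End Laws.

(** * The limit process *)

Lemma continuous_cst (R : realType) (K : topologicalType) (c : R) :
  continuous (fun _ : K => c).
Proof. by move=> x; exact: cvg_cst. Qed.

Lemma continuous_mul (R : realType) (K : topologicalType) (f g : K -> R) :
  continuous f -> continuous g -> continuous (f \* g).
Proof. by move=> cf cg x; apply: cvgM; [exact: cf|exact: cg]. Qed.

Lemma continuous_funcomp (K L M : topologicalType) (f : K -> L) (g : L -> M) :
  continuous f -> continuous g -> continuous (g \o f).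
Proof. by move=> cf cg x; apply: continuous_comp; [exact: cf|exact: cg]. Qed.

Lemma continuous_prod (R : realType) (K : topologicalType) (I : Type) (s : seq I)
    (f : I -> K -> R) :
  (forall i, continuous (f i)) -> continuous (fun x => \prod_(i <- s) f i x).
Proof.
move=> cf; elim: s => [|i s IH].
  have -> : (fun x => \prod_(i <- [::]) f i x) = cst 1.
    by apply/funext => x; rewrite big_nil.
  by move=> x; exact: cvg_cst.
have -> : (fun x => \prod_(j <- i :: s) f j x) =
    (fun x => f i x * \prod_(j <- s) f j x).
  by apply/funext => x; rewrite big_cons.
by move=> x; apply: cvgM; [exact: cf|exact: IH].
Qed.

Lemma prod01 (R : realType) (I : Type) (s : seq I) (f : I -> R) :
  (forall i, 0 <= f i <= 1) -> 0 <= \prod_(i <- s) f i <= 1.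
Proof.
move=> f01; elim: s => [|i s /andP[s0 s1]]; first by rewrite big_nil ler01 lexx.
have /andP[i0 i1] := f01 i.
by rewrite big_cons mulr_ge0//= mulr_ile1.
Qed.

Lemma mul01 (R : realType) (a b : R) :
  0 <= a <= 1 -> 0 <= b <= 1 -> 0 <= a * b <= 1.
Proof. by move=> /andP[a0 a1] /andP[b0 b1]; rewrite mulr_ge0//= mulr_ile1. Qed.

Lemma hausdorff_setX (K L : topologicalType) :
  hausdorff_space K -> hausdorff_space L -> hausdorff_space (K * L)%type.
Proof.
move=> hK hL [x y] [x' y'] cl; congr pair.
  apply: hK => A B xA xB.
  have [] := cl (A `*` setT) (B `*` setT).
  - by exists (A, setT) => //; split => //; exact: filterT.
  - by exists (B, setT) => //; split => //; exact: filterT.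
  - by move=> [a b] [[Aa _] [Ba _]]; exists a.
apply: hL => A B xA xB.
have [] := cl (setT `*` A) (setT `*` B).
- by exists (setT, A) => //; split => //; exact: filterT.
- by exists (setT, B) => //; split => //; exact: filterT.
- by move=> [a b] [[_ Aa] [_ Ba]]; exists b.
Qed.

Section GeneratorClasses.
Context {R : realType} {M : pmetricType R}.
Hypothesis cM : compact [set: M].

Lemma sub_sigma_measurable d d' (S : measurableType d) (S' : measurableType d')
    (H : set (set S)) (f : S -> S') :
  measurable_fun setT (f : g_sigma_algebraType H -> S') ->
  forall A, measurable A -> <<s H >> (f @^-1` A).
Proof. by move=> mf A mA; have := mf measurableT A mA; rewrite setTI. Qed.

Lemma measurable_history_indic_limit (C : set (history M -> R)) :
  (forall k (f : M -> R), continuous f -> (forall x, 0 <= f x <= 1) -> C (fun h => f (h k))) ->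
  @measurable _ (borel (history M)) `<=`
  <<s @indic_limit R _ (borel (history M)) C >>.
Proof.
move=> hC A mA.
apply: (@sub_sigma_measurable _ _ (borel (history M)) (borel (history M)) _ id) => //.
apply: measurable_fun_history => // k _ B mB; rewrite setTI.
apply: (@sigma_indic_limit R _ (borel (history M)) C M (fun h => h k)) => //.
by move=> f cf f01; exact: hC.
Qed.

End GeneratorClasses.

(** The products [F p.1 * g p.2] form a multiplicative class. With [C] adapted to the conditioning
    variable, an identity between joint laws reduces to such test functions. *)
Lemma product_class_measure_eq (R : realType) d (S : measurableType d)
    (M : pmetricType R) (m1 m2 : {measure set (S * borel M) -> \bar R})
    (C : set (S -> R)) :
  (forall F, C F -> measurable_fun setT F) ->
  (forall F x, C F -> 0 <= F x <= 1) -> C (cst 1) ->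
  (forall F F', C F -> C F' -> C (F \* F')) ->
  (m1 setT < +oo)%E ->
  (forall F (g : M -> R), C F -> continuous g -> (forall x, 0 <= g x <= 1) ->
    (\int[m1]_p (F p.1 * g p.2)%:E = \int[m2]_p (F p.1 * g p.2)%:E)%E) ->
  forall A B, <<s @indic_limit R _ S C >> A -> measurable B ->
  m1 (A `*` B) = m2 (A `*` B).
Proof.
move=> mC C01 C1 CM m1fin m12 A B sA mB.
pose D : set (S * borel M -> R) := [set f | exists (F : S -> R) (g : M -> R),
  [/\ C F, continuous g, (forall x, 0 <= g x <= 1) & f = fun p => F p.1 * g p.2] ].
have c1 : continuous (cst 1 : M -> R) by move=> x; exact: cvg_cst.
have c101 x : 0 <= (cst 1 : M -> R) x <= 1 by rewrite /= ler01 lexx.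
have DF F : C F -> D (F \o fst).
  by move=> CF; exists F, (cst 1 : M -> R); split=> //; apply/funext => p /=; rewrite mulr1.
have Dg (g : M -> R) : continuous g -> (forall x, 0 <= g x <= 1) -> D (g \o snd).
  by move=> cg g01; exists (cst 1), g; split=> //; apply/funext => p /=; rewrite mul1r.
apply: (@multiplicative_class_measure_eq R _ _ m1 m2 D) => //.
- move=> _ [F [g [CF cg g01 ->]]]; apply: measurable_funM.
    exact: (measurableT_comp (mC _ CF) measurable_fst).
  exact: (measurableT_comp (continuous_measurableR cg) measurable_snd).
- by move=> _ p [F [g [CF cg g01 ->]]]; apply: mul01 => //; exact: C01.
- exact: (DF _ C1).
- move=> _ _ [F [g [CF cg g01 ->]]] [F' [g' [CF' cg' g'01 ->]]].
  exists (F \* F'), (g \* g' : M -> R); split.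
  + exact: CM.
  + by move=> x; apply: cvgM; [exact: cg|exact: cg'].
  + by move=> x; exact: mul01.
  + by apply/funext => p /=; rewrite mulrACA.
- by move=> _ [F [g [CF cg g01 ->]]]; exact: m12.
have -> : A `*` B = (fst @^-1` A) `&` (snd @^-1` B) by apply/seteqP; split.
pose SD : measurableType _ := g_sigma_algebraType (@indic_limit R _ (S * borel M)%type D).
apply: (@measurableI _ SD).
  move: A sA; apply: smallest_sub.
    split=> [|A /(@measurableC _ SD)|F mF]; first exact: (@measurable0 _ SD).
      by rewrite preimage_setC setTD.
    by rewrite preimage_bigcup; exact: (@bigcupT_measurable _ SD).
  move=> A [f Cf fA]; apply: sub_sigma_algebra.
  exists (fun n => f n \o fst); first by move=> n; exact: DF.
  by move=> p; exact: fA.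
exact: (@sigma_indic_limit R _ (S * borel M)%type D M snd).
Qed.

Section LimitProcess.
Context {R : realType} {X Y : pmetricType R}.
Context {dV : measure_display} {VT : measurableType dV}.
Variables (G : borel X * VT -> borel Y) (pV : probability VT R).
Variables (T : R.-pker (borel X) ~> (borel X))
          (Q : R.-pker (borel X) ~> (borel Y)).
Hypothesis mG : measurable_fun setT G.
Hypothesis Q_channel : forall (x : borel X) (C : set (borel Y)), measurable C ->
  Q x C = pV [set v | C (G (x, v))].
Hypotheses (cX : compact [set: X]) (cY : compact [set: Y]).
Hypothesis T_continuous :
  weakly_continuous (T : X -> {measure set (borel X) -> \bar R}).
Hypothesis Q_continuous :
  weakly_continuous (Q : X -> {measure set (borel Y) -> \bar R}).
Context {d : measure_display} {O : measurableType d}.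
Variables (P : probability O R) (Xt : int -> O -> borel X) (Vt : int -> O -> VT).
Hypothesis process : control_free pV T P Xt Vt.

(** Two-sided, so that one measure carries the states and measurements of all times, and compact as
    soon as [X] and [Y] are. *)
Definition trajectory : ptopologicalType := {ptws int -> (X * Y)%type}.

Definition state_at (s : int) (z : trajectory) : X := (z s).1.
Definition measurement_at (s : int) (z : trajectory) : Y := (z s).2.

Definition shifted_trajectory (t : nat) (w : O) : borel trajectory :=
  fun k : int => (Xt (t%:Z + k) w, measurement G Xt Vt (t%:Z + k) w).

Let mX t : measurable_fun setT (Xt t). Proof. exact: state_measurable process t. Qed.
Let mV t : measurable_fun setT (Vt t). Proof. by have [] := noise_iid process. Qed.
Let scX : @second_countable X. Proof. exact: compact_second_countable_pmetric. Qed.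
Let scY : @second_countable Y. Proof. exact: compact_second_countable_pmetric. Qed.

Lemma measurable_shifted_trajectory t : measurable_fun setT (shifted_trajectory t).
Proof.
apply: (@measurable_fun_ptws _ _ int (X * Y)%type).
  exact: second_countable_setX.
move=> k; apply: measurable_fun_borel_pair => //.
exact: (measurable_measurement mG process).
Qed.

Lemma trajectory_compact : compact [set: trajectory].
Proof. by apply: compact_ptws; rewrite -setXTT; exact: compact_setX. Qed.

Lemma trajectory_hausdorff : hausdorff_space trajectory.
Proof. by apply: hausdorff_ptws; apply: hausdorff_setX; exact: metric_hausdorff. Qed.

Lemma state_at_continuous s : continuous (state_at s).
Proof.
apply: (@continuous_funcomp _ _ _ (fun z : trajectory => z s) fst).
  exact: ev_continuous.
by move=> p; exact: cvg_fst.
Qed.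

Lemma measurement_at_continuous s : continuous (measurement_at s).
Proof.
apply: (@continuous_funcomp _ _ _ (fun z : trajectory => z s) snd).
  exact: ev_continuous.
by move=> p; exact: cvg_snd.
Qed.

Lemma kernel_mean_T_continuous (g : X -> R) :
  continuous g -> (forall x, 0 <= g x <= 1) -> continuous (kernel_mean T g : X -> R).
Proof.
move=> cg g01; apply: (T_continuous cg); exists 1 => x.
by have /andP[? ?] := g01 x; rewrite ger0_norm.
Qed.

Lemma kernel_mean_Q_continuous (g : Y -> R) :
  continuous g -> (forall x, 0 <= g x <= 1) -> continuous (kernel_mean Q g : X -> R).
Proof.
move=> cg g01; apply: (Q_continuous cg); exists 1 => x.
by have /andP[? ?] := g01 x; rewrite ger0_norm.
Qed.

Variable m : probability (borel trajectory) R.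
Hypothesis m_limit : forall f g : trajectory -> R, continuous f -> continuous g ->
  (forall x, 0 <= f x <= 1) -> (forall x, 0 <= g x <= 1) ->
  (forall t, \int[P]_w (f (shifted_trajectory t w))%:E =
             \int[P]_w (g (shifted_trajectory t w))%:E)%E ->
  (\int[m]_x (f x)%:E = \int[m]_x (g x)%:E)%E.

(** The state path frozen after time [t]. Its continuous functions see only the states up to [t],
    are closed under products, and generate the past of the states. *)
Definition stopped_state (t : int) (z : trajectory) : {ptws int -> X} :=
  fun s => state_at (Num.min s t) z.

Lemma stopped_state_continuous t : continuous (stopped_state t).
Proof. by apply: ptws_continuous => s; exact: state_at_continuous. Qed.

Let mstate s : measurable_fun setT (state_at s : borel trajectory -> borel X).
Proof. exact: continuous_measurable (@state_at_continuous s). Qed.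

(** For continuous [F] of the stopped path and continuous [g], the means of [F * g(X_(t+1))] and of
    [F] times the [T]-mean of [g] at [X_t] agree along the original process at every shift. Both
    integrands are continuous in the trajectory by weak continuity of [T], so [m] inherits the
    equality. *)
Lemma limit_markov (t : int) (A : set (borel trajectory)) (B : set (borel X)) :
  <<s generators [set s : int | s <= t]
        (fun s => state_at s : borel trajectory -> borel X) >> A ->
  measurable B ->
  (m (A `&` state_at (t + 1)%R @^-1` B) = \int[m]_(z in A) T (state_at t z) B)%E.
Proof.
move=> sA mB.
have mA : measurable A.
  by apply: (@sigma_generators_measurable _ _ _ _ _ [set s : int | s <= t] _ mstate A).
have [m2 m2E m2I] := @ex_joint_measure _ _ _ _ (borel trajectory) (borel trajectory)
  (borel X) m id (kernel_precomp T (mstate t)) (@measurable_id _ _ _).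
pose W (z : borel trajectory) : borel trajectory * borel X := (z, state_at (t + 1) z).
have mW : measurable_fun setT W by apply/measurable_fun_pair.
pose C : set (borel trajectory -> R) := [set F | exists f : {ptws int -> X} -> R,
  [/\ continuous f, (forall x, 0 <= f x <= 1) & F = f \o stopped_state t] ].
have cF F : C F -> continuous (F : trajectory -> R).
  move=> [f [cf _ ->]]; apply: continuous_funcomp => //.
  exact: stopped_state_continuous.
have F01 F z : C F -> 0 <= F z <= 1 by move=> [f [_ f01 ->]]; exact: f01.
have C1 : C (cst 1).
  exists (fun=> 1 : R); split.
  - exact: continuous_cst.
  - by move=> x; rewrite ler01 lexx.
  - exact: erefl.
have CM F F' : C F -> C F' -> C (F \* F').
  move=> [f [cf f01 ->]] [f' [cf' f'01 ->]]; exists (f \* f'); split; last by [].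
    exact: continuous_mul.
  by move=> x; exact: mul01.
have mF F : C F -> measurable_fun setT F.
  by move=> /cF; exact: continuous_measurableR.
have m1m2 : pushforward m W (A `*` B) = m2 (A `*` B).
  apply: (@product_class_measure_eq _ _ _ X (pushforward m W) m2 C) => //.
  - by rewrite -[X in (X < _)%E]/(m setT) probability_setT ltry.
  - move=> F g CF cg g01.
    have mg : measurable_fun setT (g : borel X -> R) by exact: continuous_measurableR.
    have g0 x : 0 <= g x by have /andP[] := g01 x.
    have F0 z : 0 <= F z by have /andP[] := F01 F z CF.
    have mFg : measurable_fun setT (fun p : borel trajectory * borel X => (F p.1 * g p.2)%:E).
      apply/measurable_EFinP; apply: measurable_funM.
        exact: (measurableT_comp (mF _ CF) measurable_fst).
      exact: (measurableT_comp mg measurable_snd).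
    have Fg0 p : (0 <= (F p.1 * g p.2)%:E)%E by rewrite lee_fin mulr_ge0.
    have meanZ a x : 0 <= a ->
        (a%:E * \int[T x]_y (g y)%:E = \int[T x]_y (a * g y)%:E)%E.
      move=> a0; rewrite -ge0_integralZl//.
      - exact/measurable_EFinP.
      - by move=> y _; rewrite lee_fin.
    rewrite ge0_integral_pushforward// m2I//.
    transitivity (\int[m]_z (F z * g (state_at (t + 1) z))%:E)%E; first by [].
    transitivity (\int[m]_z (F z * kernel_mean T g (state_at t z))%:E)%E; last first.
      apply: eq_integral => z _; rewrite EFinM kernel_meanE//; exact: meanZ.
    apply: m_limit.
    + apply: continuous_mul; first exact: cF.
      by apply: continuous_funcomp; [exact: state_at_continuous|exact: cg].
    + apply: continuous_mul; first exact: cF.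
      by apply: continuous_funcomp;
        [exact: state_at_continuous|exact: kernel_mean_T_continuous].
    + by move=> z; apply: mul01 => //; exact: F01.
    + by move=> z; apply: mul01; [exact: F01|exact: kernel_mean01].
    move=> s; have [f [cf f01 FE]] := CF.
    pose S := g_sigma_algebraType (generators [set r : int | r <= s%:Z + t] Xt).
    have mFS : measurable_fun setT ((fun w => F (shifted_trajectory s w)) : S -> R).
      rewrite FE; apply: (measurableT_comp (continuous_measurableR cf)).
      apply: (@measurable_fun_ptws _ S int X) => // r.
      by apply: measurable_generators; rewrite /= lerD2l ge_min lexx orbT.
    transitivity (\int[P]_w (F (shifted_trajectory s w) * g (Xt (s%:Z + t + 1) w))%:E)%E.
      by apply: eq_integral => w _; rewrite /state_at /= addrA.
    rewrite (markov_integral process (t := s%:Z + t)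
      (f := fun r => (F (shifted_trajectory s r.1) * g r.2)%:E)).
    + by apply: eq_integral => w _; rewrite EFinM kernel_meanE//; exact/esym/meanZ.
    + apply/measurable_EFinP; apply: measurable_funM.
        exact: (measurableT_comp mFS measurable_fst).
      exact: (measurableT_comp mg measurable_snd).
    + by move=> r; rewrite lee_fin mulr_ge0.
  move: A sA {mA}; apply: smallest_sub; first exact: smallest_sigma_algebra.
  move=> _ [s st [D mD <-]]; rewrite setTI.
  apply: (@sigma_indic_limit R _ (borel trajectory) C X (state_at s)) => //.
  move=> f cf f01; exists (fun x => f (x s)); split; last 2 first.
  - by move=> x; exact: f01.
  - by apply/funext => z; rewrite /= /stopped_state min_l.
  apply: (@continuous_funcomp _ _ _ (fun x : {ptws int -> X} => x s) f) => //.
  exact: ev_continuous.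
transitivity (pushforward m W (A `*` B)); first by [].
rewrite m1m2 m2E; last exact: measurableX.
rewrite [RHS]integral_mkcond; apply: eq_integral => z _; rewrite patchE.
case: ifPn => [/set_mem Az|/negP nAz].
  by congr (T _ _); apply/seteqP; split => e //= [].
rewrite [X in kernel_precomp _ _ _ X](_ : _ = set0) ?measure0//.
by apply/seteqP; split => e //= [/mem_set].
Qed.

End LimitProcess.

Arguments trajectory {R} X Y.

(** The pulled-back sets form a sigma-algebra containing the generators. Events of a product space
    that depend on one factor are brought down to that factor in this way. *)
Lemma sigma_generators_comp d1 (S : measurableType d1) (I O O' : Type)
    (D : set I) (Z : I -> O -> S) (h : O' -> O) (A : set O') :
  <<s \bigcup_(i in D) preimage_set_system setT (Z i \o h) measurable >> A ->
  exists2 A1 : set O, <<s \bigcup_(i in D) preimage_set_system setT (Z i) measurable >> A1 &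
    A = h @^-1` A1.
Proof.
set H := (X in exists2 A1, <<s X >> A1 & _).
move: A; apply: (@smallest_sub _ _ _ [set A | exists2 A1 : set O, <<s H >> A1 & A = h @^-1` A1]).
  split=> [|A [A1 sA1 ->]|F sF].
  - by exists set0; [exact: sigma_algebra0|rewrite preimage_set0].
  - by exists (setT `\` A1) => //; exact: sigma_algebraCD.
  - have [F1 F1P] : {F1 : nat -> set O & forall n, <<s H >> (F1 n) /\ F n = h @^-1` F1 n}.
      apply: (@choice _ _ (fun n A1 => <<s H >> A1 /\ F n = h @^-1` A1)) => n.
      by have [A1 ? ?] := sF n; exists A1.
    exists (\bigcup_n F1 n).
      by apply: sigma_algebra_bigcup => n; have [] := F1P n.
    by rewrite preimage_bigcup; apply: eq_bigcupr => n _; have [] := F1P n.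
move=> _ [i Di [B mB <-]]; exists (Z i @^-1` B); last by rewrite setTI.
by apply: sub_sigma_algebra; exists i => //; exists B => //; rewrite setTI.
Qed.

Section ProductMarginals.
Context {R : realType} d1 d2 (S1 : measurableType d1) (S2 : measurableType d2).
Variables (P1 : probability S1 R) (P2 : probability S2 R).

Lemma product_prob_fst A : measurable A -> ((P1 \x P2) (fst @^-1` A) = P1 A)%E.
Proof.
move=> mA; have -> : fst @^-1` A = A `*` (setT : set S2) by apply/seteqP; split=> // q [].
rewrite (product_measure1E P1 P2 mA measurableT).
by rewrite -[X in (_ * X)%E]/(P2 setT) probability_setT mule1.
Qed.

Lemma product_prob_snd A : measurable A -> ((P1 \x P2) (snd @^-1` A) = P2 A)%E.
Proof.
move=> mA.
have -> : snd @^-1` A = (setT : set S1) `*` A by apply/seteqP; split=> // q [].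
rewrite (product_measure1E P1 P2 measurableT mA).
by rewrite -[X in (X * _)%E]/(P1 setT) probability_setT mul1e.
Qed.

Lemma integral_product_fst (f : S1 -> \bar R) :
  measurable_fun setT f -> (forall z, 0 <= f z)%E ->
  (\int[(P1 \x P2)]_q f q.1 = \int[P1]_z f z)%E.
Proof.
move=> mf f0; transitivity (\int[pushforward (P1 \x P2) fst]_z f z)%E.
  by rewrite ge0_integral_pushforward.
by apply: eq_measure_integral => A mA _; exact: product_prob_fst.
Qed.

End ProductMarginals.

(** * A realization of the model with the limit states *)

Section LimitRealization.
Context {R : realType} {X Y : pmetricType R}.
Context {dV : measure_display} {VT : measurableType dV}.
Variables (G : borel X * VT -> borel Y) (pV : probability VT R).
Variables (T : R.-pker (borel X) ~> (borel X))
          (Q : R.-pker (borel X) ~> (borel Y)).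
Hypothesis mG : measurable_fun setT G.
Hypothesis Q_channel : forall (x : borel X) (C : set (borel Y)), measurable C ->
  Q x C = pV [set v | C (G (x, v))].
Hypotheses (cX : compact [set: X]) (cY : compact [set: Y]).
Hypothesis T_continuous :
  weakly_continuous (T : X -> {measure set (borel X) -> \bar R}).
Hypothesis Q_continuous :
  weakly_continuous (Q : X -> {measure set (borel Y) -> \bar R}).
Context {d : measure_display} {O : measurableType d}.
Variables (P : probability O R) (Xt : int -> O -> borel X) (Vt : int -> O -> VT).
Hypothesis process : control_free pV T P Xt Vt.

Variable m : probability (borel (trajectory X Y)) R.
Let Zt := shifted_trajectory G Xt Vt.
Hypothesis m_limit : forall f g : trajectory X Y -> R, continuous f -> continuous g ->
  (forall x, 0 <= f x <= 1) -> (forall x, 0 <= g x <= 1) ->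
  (forall t, \int[P]_w (f (Zt t w))%:E = \int[P]_w (g (Zt t w))%:E)%E ->
  (\int[m]_x (f x)%:E = \int[m]_x (g x)%:E)%E.

Let mX t : measurable_fun setT (Xt t). Proof. exact: state_measurable process t. Qed.
Let mV t : measurable_fun setT (Vt t). Proof. by have [] := noise_iid process. Qed.

Let O' : measurableType _ := (borel (trajectory X Y) * O)%type.
Let P' : probability O' R := (m \x P)%E.
Definition limit_state (t : int) (q : borel (trajectory X Y) * O) : borel X :=
  state_at t q.1.
(* The limit measure only carries states: the noise stays the original one, on an
   independent copy of the original space. *)
Definition limit_noise (t : int) (q : borel (trajectory X Y) * O) : VT := Vt t q.2.

Let mstate s : measurable_fun setT (state_at s : borel (trajectory X Y) -> borel X).
Proof. by apply: continuous_measurable; exact: state_at_continuous. Qed.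

Let P'_fst A (mA : measurable A) : P' (fst @^-1` A) = m A := product_prob_fst m P mA.

Let P'_snd A (mA : measurable A) : P' (snd @^-1` A) = P A := product_prob_snd m P mA.

(** The Markov property is that of [m], the law of the noise that of the original space, and the
    product measure makes states and noise independent. *)
Lemma limit_control_free : control_free pV T P' limit_state limit_noise.
Proof.
split.
- by move=> t; exact: (measurableT_comp (mstate t) measurable_fst).
- move=> t A B sA mB.
  have [A1 sA1 ->] := sigma_generators_comp
    (Z := fun s => state_at s : borel (trajectory X Y) -> borel X) (h := fst) sA.
  have mA1 : measurable A1 by exact: (sigma_generators_measurable mstate sA1).
  rewrite -[X in P' X]/(fst @^-1` (A1 `&` state_at (t + 1) @^-1` B)) P'_fst; last first.
    by apply: measurableI => //; rewrite -[X in measurable X]setTI; exact: mstate.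
  rewrite (limit_markov cX T_continuous process m_limit sA1 mB).
  rewrite integral_mkcond [RHS]integral_mkcond.
  rewrite -(integral_product_fst m P (f := (fun z => T (state_at t z) B) \_ A1)).
  + by apply: eq_integral => q _; rewrite !patchE.
  + apply/(measurable_restrictT _ mA1); apply: measurable_funTS.
    exact: (measurableT_comp (measurable_kernel T B mB) (mstate t)).
  + by move=> z; rewrite patchE; case: ifP.
- split; first by move=> t; exact: (measurableT_comp (mV t) measurable_snd).
  move=> s C us mC.
  have -> : \big[setI/setT]_(i <- s) (limit_noise i @^-1` C i) =
      snd @^-1` (\big[setI/setT]_(i <- s) (Vt i @^-1` C i)).
    elim: {us} s => [|i s IH]; first by rewrite !big_nil.
    by rewrite !big_cons IH.
  rewrite P'_snd; last first.
    apply: big_ind => //; first exact: measurableI.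
    by move=> i _; rewrite -[X in measurable X]setTI; exact: mV.
  by have [_ h] := noise_iid process; exact: h.
- move=> A B sA sB.
  have [A1 sA1 ->] := sigma_generators_comp
    (Z := fun s => state_at s : borel (trajectory X Y) -> borel X) (h := fst) sA.
  have [B1 sB1 ->] := sigma_generators_comp (Z := Vt) (h := snd) sB.
  have mA1 : measurable A1 by exact: (sigma_generators_measurable mstate sA1).
  have mB1 : measurable B1 by exact: (sigma_generators_measurable mV sB1).
  rewrite P'_fst// P'_snd// -[RHS](product_measure1E m P mA1 mB1).
  by congr (P' _); apply/seteqP; split.
Qed.

End LimitRealization.

Lemma continuous_if (R : realType) (K : topologicalType) (b : bool) (f : K -> R) :
  continuous f -> continuous (fun y => if b then f y else 1).
Proof. by case: b => // _; exact: continuous_cst. Qed.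

Lemma big_nat_truncate (R : realType) n N (f : nat -> R) : (n <= N)%N ->
  \prod_(0 <= k < N) (if (k < n)%N then f k else 1) = \prod_(0 <= k < n) f k.
Proof. by move=> nN; rewrite -big_mkcond (big_nat_widen _ _ _ _ _ nN). Qed.

Lemma if01 (R : realType) (b : bool) (x : R) :
  0 <= x <= 1 -> 0 <= (if b then x else 1) <= 1.
Proof. by case: b => //; rewrite ler01 lexx. Qed.

(** * The joint law of the limit state and the limit past *)

Section LimitLaw.
Context {R : realType} {X Y : pmetricType R}.
Context {dV : measure_display} {VT : measurableType dV}.
Variables (G : borel X * VT -> borel Y) (pV : probability VT R).
Variables (T : R.-pker (borel X) ~> (borel X))
          (Q : R.-pker (borel X) ~> (borel Y)).
Hypothesis mG : measurable_fun setT G.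
Hypothesis Q_channel : forall (x : borel X) (C : set (borel Y)), measurable C ->
  Q x C = pV [set v | C (G (x, v))].
Hypotheses (cX : compact [set: X]) (cY : compact [set: Y]).
Hypothesis T_continuous :
  weakly_continuous (T : X -> {measure set (borel X) -> \bar R}).
Hypothesis Q_continuous :
  weakly_continuous (Q : X -> {measure set (borel Y) -> \bar R}).
Context {d : measure_display} {O : measurableType d}.
Variables (P : probability O R) (Xt : int -> O -> borel X) (Vt : int -> O -> VT).
Hypothesis process : control_free pV T P Xt Vt.

Variable m : probability (borel (trajectory X Y)) R.
Let Zt := shifted_trajectory G Xt Vt.
Hypothesis m_limit : forall f g : trajectory X Y -> R, continuous f -> continuous g ->
  (forall x, 0 <= f x <= 1) -> (forall x, 0 <= g x <= 1) ->
  (forall t, \int[P]_w (f (Zt t w))%:E = \int[P]_w (g (Zt t w))%:E)%E ->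
  (\int[m]_x (f x)%:E = \int[m]_x (g x)%:E)%E.

Hypothesis m_shift : forall (f : trajectory X Y -> R) (s : trajectory X Y -> trajectory X Y),
  continuous f -> continuous s -> (forall x, 0 <= f x <= 1) ->
  (forall t w, Zt t.+1 w = s (Zt t w)) ->
  (\int[m]_x (f (s x))%:E = \int[m]_x (f x)%:E)%E.

Local Notation XH := (borel X * borel (history Y))%type.
Let P' : probability (borel (trajectory X Y) * O)%type R := (m \x P)%E.
Let X' := @limit_state R X Y d O.
Let V' := @limit_noise R X Y dV VT d O Vt.

Let process' : control_free pV T P' X' V'.
Proof. exact: (limit_control_free cX T_continuous process m_limit). Qed.

Let Z' q : XH := (X' 0 q, past G X' V' 0 q).
Let mZ' : measurable_fun setT Z'.
Proof. exact: (measurable_state_past mG cY process'). Qed.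

(** The past is read off the measurement coordinates carried by [m], whereas [Z'] recomputes it from
    the limit states and the copied noise. *)
Definition state_past_at (z : trajectory X Y) : X * history Y :=
  (state_at 0 z, fun k : nat => measurement_at (0 - k%:Z) z).

Let past_continuous : continuous (fun z => (state_past_at z).2).
Proof. by apply: ptws_continuous => k; exact: measurement_at_continuous. Qed.

Let pi : borel (trajectory X Y) -> XH := state_past_at.

Let mpi : measurable_fun setT pi.
Proof.
apply/measurable_fun_pair; first by apply: continuous_measurable; exact: state_at_continuous.
exact: (@continuous_measurable (trajectory X Y) (history Y)).
Qed.

Let C : set (XH -> R) := [set F | exists n (g : X -> R) (f : nat -> Y -> R),
  [/\ continuous g, (forall x, 0 <= g x <= 1), (forall k, continuous (f k)),
      (forall k y, 0 <= f k y <= 1) &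
      F = fun p => g p.1 * \prod_(0 <= k < n) f k (p.2 k)] ].

Let C_mul F F' : C F -> C F' -> C (F \* F').
Proof.
move=> [n [g [f [cg g01 cf f01 ->]]]] [n' [g' [f' [cg' g'01 cf' f'01 ->]]]].
(* Both products are brought to a common length by factors equal to 1. *)
exists (maxn n n'), (g \* g'), (fun k y => (if (k < n)%N then f k y else 1) *
  (if (k < n')%N then f' k y else 1)); split.
- exact: continuous_mul.
- by move=> x; exact: mul01.
- move=> k; apply: (@continuous_mul R Y (fun y => if (k < n)%N then f k y else 1)
    (fun y => if (k < n')%N then f' k y else 1)); exact: continuous_if.
- by move=> k y; apply: mul01; exact: if01.
- apply/funext => p /=; rewrite big_split/=.
  rewrite (big_nat_truncate (fun k => f k (p.2 k)) (leq_maxl n n')).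
  rewrite (big_nat_truncate (fun k => f' k (p.2 k)) (leq_maxr n n')).
  by rewrite mulrACA.
Qed.

Let C_measurable F : C F -> measurable_fun setT F.
Proof.
move=> [n [g [f [cg g01 cf f01 ->]]]]; apply: measurable_funM.
  exact: (measurableT_comp (continuous_measurableR cg) measurable_fst).
apply: measurable_prod => k _; apply: (measurableT_comp (continuous_measurableR (cf k))).
exact: (measurableT_comp (@measurable_ev R Y k) measurable_snd).
Qed.

Let C01 F p : C F -> 0 <= F p <= 1.
Proof.
move=> [n [g [f [cg g01 cf f01 ->]]]]; apply: mul01 => //.
by apply: prod01 => k; exact: f01.
Qed.

Let C1 : C (cst 1).
Proof.
exists 0%N, (fun=> 1), (fun _ _ => 1); split => //.
- exact: continuous_cst.
- by move=> x; rewrite ler01 lexx.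
- by move=> k; exact: continuous_cst.
- by move=> k x; rewrite ler01 lexx.
- by apply/funext => p /=; rewrite big_nil mulr1.
Qed.

Let C_generates E : measurable E -> <<s @indic_limit R _ XH C >> E.
Proof.
move=> mE; apply: (@sub_sigma_measurable _ _ XH XH _ id) => //.
apply/measurable_fun_pairP; split.
  move=> _ B mB; rewrite setTI.
  apply: (@sigma_indic_limit R _ XH C X fst) => //.
  move=> f cf f01; exists 0%N, f, (fun _ _ => 1); split => //.
  - by move=> k; exact: continuous_cst.
  - by move=> k x; rewrite ler01 lexx.
  - by apply/funext => p /=; rewrite big_nil mulr1.
apply: measurable_fun_history => // j _ B mB; rewrite setTI.
apply: (@sigma_indic_limit R _ XH C Y (fun p => p.2 j)) => //.
move=> f cf f01; exists j.+1, (fun=> 1), (fun k y => if k == j then f y else 1); split => //.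
- exact: continuous_cst.
- by move=> x; rewrite ler01 lexx.
- by move=> k; exact: continuous_if.
- by move=> k y; exact: if01.
- apply/funext => p /=; rewrite big_nat_recr//= eqxx mul1r big_nat big1 ?mul1r//.
  by move=> i /andP[_ ij]; rewrite (ltn_eqF ij).
Qed.

(** Both sides integrate a product test function to the mean of [H], in which each function of a
    measurement is replaced by its [Q]-mean at the state. On the left this is the channel identity
    of the rebuilt process; on the right that identity holds for the original process at every time
    and passes to [m], since weak continuity of [Q] makes [H] continuous. *)
Lemma limit_law E : measurable E -> P' (Z' @^-1` E) = m (pi @^-1` E).
Proof.
move=> mE.
rewrite -[LHS]/(pushforward P' Z' E) -[RHS]/(pushforward m pi E).
apply: (@multiplicative_class_measure_eq R _ _ (pushforward P' Z')
  (pushforward m pi) C) => //; last exact: C_generates.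
  by rewrite -[X in (X < _)%E]/(P' setT) probability_setT ltry.
move=> F CF; have mF := C_measurable CF; have F0 p : (0 <= (F p)%:E)%E.
  by rewrite lee_fin; have /andP[] := C01 p CF.
have mFE : measurable_fun setT (fun p => (F p)%:E) by exact/measurable_EFinP.
rewrite !ge0_integral_pushforward//.
move: CF => [n [g [f [cg g01 cf f01 FE]]]].
have g0 x : 0 <= g x by have /andP[] := g01 x.
have mg : measurable_fun setT (g : borel X -> R) by exact: continuous_measurableR.
have mf k : measurable_fun setT (f k : borel Y -> R) by exact: continuous_measurableR.
have q01 k x : 0 <= kernel_mean Q (f k) x <= 1 by exact: kernel_mean01.
have mq k : measurable_fun setT (kernel_mean Q (f k)) by exact: measurable_kernel_mean.
pose H (z : trajectory X Y) : R :=
  g (state_at 0 z) * \prod_(0 <= k < n) kernel_mean Q (f k) (state_at (0 - k%:Z) z).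
have cH : continuous H.
  apply: continuous_mul; first by apply: continuous_funcomp => //; exact: state_at_continuous.
  apply: continuous_prod => k.
  apply: (@continuous_funcomp _ _ _ (state_at (0 - k%:Z)) (kernel_mean Q (f k))).
    exact: state_at_continuous.
  exact: kernel_mean_Q_continuous.
have H01 z : 0 <= H z <= 1 by apply: mul01 => //; apply: prod01 => k; exact: q01.
transitivity (\int[m]_z (H z)%:E)%E.
  transitivity (\int[P']_q ((g (X' 0 q))%:E *
      (\prod_(0 <= k < n) f k (measurement G X' V' (0 - k%:Z)%R q))%:E))%E.
    by apply: eq_integral => q _; rewrite /= FE EFinM.
  rewrite (integral_measurements mG Q_channel process' 0 n
    (F := fun q => (g (X' 0 q))%:E) (phi := f))//; last 2 first.
  - apply/measurable_EFinP; apply: (measurableT_comp mg).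
    by apply: measurable_generators.
  - by move=> q; rewrite lee_fin.
  rewrite -(integral_product_fst m P (f := fun z => (H z)%:E)).
  - by apply: eq_integral => q _; rewrite -EFinM.
  - by apply/measurable_EFinP; exact: continuous_measurableR.
  - by move=> z; rewrite lee_fin; have /andP[] := H01 z.
transitivity (\int[m]_z (F (state_past_at z))%:E)%E; last by [].
apply: m_limit => //.
- rewrite FE; apply: continuous_mul.
    by apply: continuous_funcomp => //; exact: state_at_continuous.
  apply: continuous_prod => k.
  apply: (@continuous_funcomp _ _ _ (measurement_at (0 - k%:Z)) (f k)) => //.
  exact: measurement_at_continuous.
- by move=> z; rewrite FE; apply: mul01 => //; apply: prod01 => k; exact: f01.
move=> t; rewrite FE; apply/esym.
transitivity (\int[P]_w ((g (Xt t%:Z w))%:E *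
    (\prod_(0 <= k < n) f k (measurement G Xt Vt (t%:Z - k%:Z)%R w))%:E))%E.
  apply: eq_integral => w _; rewrite -EFinM; congr (_%:E).
  rewrite /state_past_at /state_at /measurement_at /Zt /shifted_trajectory /= addr0; congr (_ * _).
  by apply: eq_bigr => k _; rewrite add0r.
have mgX : measurable_fun setT ((fun w => (g (Xt t%:Z w))%:E) :
    g_sigma_algebraType (generators setT Xt) -> \bar R).
  apply/measurable_EFinP; apply: (measurableT_comp mg).
  by apply: measurable_generators.
have gX0 w : (0 <= (g (Xt t%:Z w))%:E)%E by rewrite lee_fin.
rewrite (integral_measurements mG Q_channel process t%:Z n mgX gX0 mf f01).
apply: eq_integral => w _; rewrite -EFinM; congr (_%:E).
rewrite /H /state_at /Zt /shifted_trajectory /= addr0; congr (_ * _).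
by apply: eq_bigr => k _; rewrite add0r.
Qed.

Definition shift_trajectory (z : trajectory X Y) : trajectory X Y :=
  fun k => z (k + 1).

Lemma shift_trajectory_continuous : continuous shift_trajectory.
Proof. by apply: ptws_continuous => k; exact: ev_continuous. Qed.

Definition state_history (s : int) (z : trajectory X Y) : history X :=
  fun k : nat => state_at (s - k%:Z) z.

Lemma state_history_continuous s : continuous (state_history s).
Proof. by apply: ptws_continuous => k; exact: state_at_continuous. Qed.

(** Only state coordinates occur, and they live on the factor [m]. The shift of trajectories is
    continuous and turns [Zt t] into [Zt t.+1], so [m_shift] applies. *)
Lemma limit_shift (A : set (borel (history X))) : measurable A ->
  P' [set q | A (fun k : nat => X' (0 + 1 - k%:Z) q)] =
  P' [set q | A (fun k : nat => X' (0 - k%:Z) q)].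
Proof.
move=> mA.
pose S s : borel (trajectory X Y) -> borel (history X) := state_history s.
have mS s : measurable_fun setT (S s).
  exact: (@continuous_measurable (trajectory X Y) (history X) _ (@state_history_continuous s)).
have P'S s : P' [set q | A (fun k : nat => X' (s - k%:Z) q)] = m (S s @^-1` A).
  rewrite -[X in P' X]/(fst @^-1` (S s @^-1` A)); apply: product_prob_fst.
  by rewrite -[X in measurable X]setTI; exact: mS.
rewrite !P'S -[LHS]/(pushforward m (S (0 + 1)) A) -[RHS]/(pushforward m (S 0) A).
pose D : set (borel (history X) -> R) :=
  [set F | continuous (F : history X -> R) /\ (forall x, 0 <= F x <= 1)].
have mD F : D F -> measurable_fun setT F.
  by move=> [cF _]; exact: (@continuous_measurableR R (history X)).
apply: (@multiplicative_class_measure_eq R _ _ (pushforward m (S (0 + 1)))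
  (pushforward m (S 0)) D).
- exact: mD.
- by move=> F x [_ F01]; exact: F01.
- by split; [exact: continuous_cst|move=> x; rewrite /= ler01 lexx].
- by move=> F F' [cF F01] [cF' F'01]; split; [exact: continuous_mul|move=> x; exact: mul01].
- by rewrite -[X in (X < _)%E]/(m setT) probability_setT ltry.
- move=> F DF; have mF := mD _ DF; have [cF F01] := DF.
  have F0 x : (0 <= (F x)%:E)%E by rewrite lee_fin; have /andP[] := F01 x.
  have mFE : measurable_fun setT (fun x => (F x)%:E) by exact/measurable_EFinP.
  rewrite !ge0_integral_pushforward//.
  transitivity (\int[m]_z (F (state_history 0 (shift_trajectory z)))%:E)%E.
    apply: eq_integral => z _ /=; congr (F _)%:E; apply/funext => k.
    rewrite /S /state_history /state_at /shift_trajectory; congr (z _).1.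
    by rewrite addrAC.
  apply: (m_shift (f := F \o state_history 0)).
  + apply: (@continuous_funcomp _ _ _ (state_history 0) F) => //.
    exact: state_history_continuous.
  + exact: shift_trajectory_continuous.
  + by move=> z; exact: F01.
  + move=> t w; apply/funext => k.
    rewrite /Zt /shifted_trajectory /shift_trajectory.
    by rewrite -addn1 PoszD -!addrA (addrC 1).
- apply: (measurable_history_indic_limit cX) => // k f cf f01; split.
    apply: (@continuous_funcomp _ _ _ (fun h : history X => h k) f) => //.
    exact: ev_continuous.
  by move=> x; exact: f01.
Qed.

(** For continuous [F] and [g], multiplying [F(past)] by [g(X)] or by the [kappa]-mean of [g] gives
    the same expectation at every decision time. Weak continuity of [kappa] makes the second
    integrand continuous in the trajectory, so the equality passes to [m]. *)
Lemma limit_cond_dist (mu : probability XH R)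
    (kappa : R.-pker (borel (history Y)) ~> (borel X)) :
  (forall E, measurable E -> mu E = m (pi @^-1` E)) ->
  homogeneous_filter G P Xt Vt kappa -> cond_dist mu snd fst kappa.
Proof.
move=> muE [kappa_continuous filterP] B mB.
split; [by apply: measurable_kernel| |move=> A mA].
  by move=> h; exact: measure_ge0.
have [m2 m2E m2I] := ex_joint_measure mu kappa (@measurable_snd _ _ (borel X) (borel (history Y))).
pose sw (p : XH) : borel (history Y) * borel X := (p.2, p.1).
have msw : measurable_fun setT sw.
  by apply/measurable_fun_pair; [exact: measurable_snd|exact: measurable_fst].
pose D : set (borel (history Y) -> R) :=
  [set F | continuous (F : history Y -> R) /\ (forall x, 0 <= F x <= 1)].
have mD F : D F -> measurable_fun setT F.
  by move=> [cF _]; exact: (@continuous_measurableR R (history Y)).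
have : pushforward mu sw (A `*` B) = m2 (A `*` B).
  apply: (@product_class_measure_eq _ _ _ X (pushforward mu sw) m2 D) => //.
  - by move=> F x [_ F01]; exact: F01.
  - by split; [exact: continuous_cst|move=> x; rewrite /= ler01 lexx].
  - by move=> F F' [cF F01] [cF' F'01]; split; [exact: continuous_mul|move=> x; exact: mul01].
  - by rewrite -[X in (X < _)%E]/(mu setT) probability_setT ltry.
  - move=> F g DF cg g01; have mF := mD _ DF; have [cF F01] := DF.
    have mg : measurable_fun setT (g : borel X -> R) by exact: continuous_measurableR.
    have g0 x : 0 <= g x by have /andP[] := g01 x.
    have F0 x : 0 <= F x by have /andP[] := F01 x.
    have mFg : measurable_fun setT (fun p : borel (history Y) * borel X => (F p.1 * g p.2)%:E).
      apply/measurable_EFinP; apply: measurable_funM.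
        exact: (measurableT_comp mF measurable_fst).
      exact: (measurableT_comp mg measurable_snd).
    have Fg0 p : (0 <= (F p.1 * g p.2)%:E)%E by rewrite lee_fin mulr_ge0.
    pose km := kernel_mean kappa g.
    have km01 h : 0 <= km h <= 1 by exact: kernel_mean01.
    have km0 h : 0 <= km h by have /andP[] := km01 h.
    have mkm : measurable_fun setT km by exact: measurable_kernel_mean.
    have ckm : continuous (km : history Y -> R).
      apply: (kappa_continuous _ cg); exists 1 => x.
      by have /andP[? ?] := g01 x; rewrite ger0_norm.
    have meanZ h : (\int[kappa h]_x (F h * g x)%:E = (F h * km h)%:E)%E.
      rewrite EFinM kernel_meanE// -ge0_integralZl//.
      - exact/measurable_EFinP.
      - by move=> y _; rewrite lee_fin.
      - by rewrite lee_fin.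
    have mu_m (f : XH -> R) : measurable_fun setT f -> (forall p, 0 <= f p) ->
        (\int[mu]_p (f p)%:E = \int[m]_z (f (pi z))%:E)%E.
      move=> mf f0; transitivity (\int[pushforward m pi]_p (f p)%:E)%E.
        by apply: eq_measure_integral => E mE _; exact: muE.
      have mfE : measurable_fun setT (fun p => (f p)%:E) by exact/measurable_EFinP.
      have f0E p : (0 <= (f p)%:E)%E by rewrite lee_fin.
      by rewrite ge0_integral_pushforward.
    rewrite m2I//.
    transitivity (\int[mu]_p (F p.2 * g p.1)%:E)%E.
      transitivity (\int[pushforward mu sw]_p (F p.1 * g p.2)%:E)%E; first by [].
      by rewrite ge0_integral_pushforward.
    transitivity (\int[m]_z (F (pi z).2 * g (pi z).1)%:E)%E.
      apply: (mu_m (fun p => F p.2 * g p.1)); last by move=> p; exact: mulr_ge0.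
      apply: measurable_funM; first exact: (measurableT_comp mF measurable_snd).
      exact: (measurableT_comp mg measurable_fst).
    transitivity (\int[m]_z (F (pi z).2 * km (pi z).2)%:E)%E; last first.
      under [RHS]eq_integral do rewrite meanZ.
      apply/esym; apply: (mu_m (fun p => F p.2 * km p.2)); last by move=> p; exact: mulr_ge0.
      apply: measurable_funM; first exact: (measurableT_comp mF measurable_snd).
      exact: (measurableT_comp mkm measurable_snd).
    have cF_past : continuous (fun z => F (state_past_at z).2).
      exact: (@continuous_funcomp _ _ _ _ (F : history Y -> R) past_continuous cF).
    apply: (m_limit (f := fun z => F (pi z).2 * g (pi z).1)
      (g := fun z => F (pi z).2 * km (pi z).2)).
    + apply: continuous_mul; first by [].
      by apply: continuous_funcomp => //; exact: state_at_continuous.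
    + apply: continuous_mul; first by [].
      exact: (@continuous_funcomp _ _ _ _ (km : history Y -> R) past_continuous ckm).
    + by move=> z; exact: mul01.
    + by move=> z; exact: mul01.
    move=> t.
    have piZ w : pi (Zt t w) = (Xt t%:Z w, past G Xt Vt t%:Z w).
      rewrite /pi /state_past_at /state_at /Zt /shifted_trajectory /= addr0; congr pair.
      by apply/funext => k; rewrite /measurement_at /= add0r.
    under eq_integral do rewrite piZ.
    under [RHS]eq_integral do rewrite piZ.
    have mP := measurable_past mG cY process t%:Z.
    have mXt : measurable_fun setT (Xt t%:Z) by exact: state_measurable process t%:Z.
    rewrite (@integral_joint_kernel _ _ _ _ O _ _ P (past G Xt Vt t%:Z) (Xt t%:Z) kappa
      mP mXt _ (fun p => (F p.1 * g p.2)%:E) mFg Fg0).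
      by apply: eq_integral => w _; rewrite meanZ.
    move=> A1 B1 mA1 mB1; have [_ _ h] := filterP t B1 mB1.
    by rewrite setIC -h.
  - apply: (measurable_history_indic_limit cY) => // k f cf f01; split.
      apply: (@continuous_funcomp _ _ _ (fun h : history Y => h k) f) => //.
      exact: ev_continuous.
    by move=> x; exact: f01.
rewrite m2E; last exact: measurableX.
rewrite -[X in X = _ -> _]/(mu (snd @^-1` A `&` fst @^-1` B)) setIC => ->.
rewrite [LHS]integral_mkcond; apply: eq_integral => p _; rewrite patchE.
case: ifPn => [/set_mem Ap|/negP nAp].
  by congr (kappa _ _); apply/seteqP; split => e //= [].
rewrite [X in kappa _ X](_ : _ = set0) ?measure0//.
by apply/seteqP; split => e //= [/mem_set].
Qed.

End LimitLaw.

(** * Measurable selection of minimisers *)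

Lemma bool_second_countable : @second_countable bool.
Proof.
exists (range (@set1 bool)).
  by apply: (sub_countable (card_image_le _ _)); exact: countableP.
split=> [A _|x A /= Ax]; first exact: discrete_open.
by exists [set x]; [split; [exists x|]|move=> y /= ->; exact: nbhs_singleton].
Qed.

Section CountableQuantifiers.
Context d (O : measurableType d) (J : countType).

Lemma measurable_exists (A : J -> set O) : (forall j, measurable (A j)) ->
  measurable [set w | exists j, A j w].
Proof.
move=> mA; have -> : [set w | exists j, A j w] = \bigcup_j A j.
  by apply/seteqP; split=> [w [j Aj]|w [j _ Aj]]; exists j.
by apply: countable_bigcupT_measurable => //; exact: countableP.
Qed.

Lemma measurable_forall (A : J -> set O) : (forall j, measurable (A j)) ->
  measurable [set w | forall j, A j w].
Proof.
move=> mA; have -> : [set w | forall j, A j w] = ~` [set w | exists j, (~` A j) w].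
  by apply/seteqP; split=> [w Aw [j /(_ (Aw j))]//|w + j]; move/forallNP/(_ j)/contrapT.
by apply: measurableC; apply: measurable_exists => j; exact: measurableC.
Qed.

(** The index with the least code is chosen; that it equals [j] means [A j] holds and no [A j'] with
    a smaller code does. *)
Lemma countable_measurable_choice (A : J -> set O) :
  (forall j, measurable (A j)) -> (forall w, exists j, A j w) ->
  exists K : O -> J, (forall j, measurable [set w | K w = j]) /\
    forall w, A (K w) w.
Proof.
move=> mA exA.
have exK w : exists j, A j w /\ forall j', A j' w -> (choice.pickle j <= choice.pickle j')%N.
  pose b i := `[< exists j, A j w /\ choice.pickle j = i >].
  have exb : exists i, b i.
    by have [j Aj] := exA w; exists (choice.pickle j); apply/asboolP; exists j.
  case: (ex_minnP exb) => i /asboolP[j [Aj ji]] imin; exists j; split=> // j' Aj'.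
  by rewrite ji; apply: imin; apply/asboolP; exists j'.
have [K KP] := choice exK; exists K; split=> [j|w]; last by have [] := KP w.
have -> : [set w | K w = j] =
    A j `&` [set w | forall j',
      (if (choice.pickle j' < choice.pickle j)%N then ~` A j' else setT) w].
  apply/seteqP; split=> [w /= <-|w /= [Aj jmin]]; have [AK Kmin] := KP w.
    split=> // j'; case: ifP => // j'K /Kmin.
    by rewrite leqNgt j'K.
  apply: (pcan_inj choice.pickleK); apply/eqP; rewrite eqn_leq Kmin//= leqNgt.
  by apply/negP => jK; move: (jmin (K w)); rewrite jK.
apply: measurableI => //; apply: measurable_forall => j'.
by case: ifP => // _; exact: measurableC.
Qed.

End CountableQuantifiers.

Section Selection.
Context {R : realType} d (S : measurableType d).
Local Notation cantor := {ptws nat -> bool}.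

(** Padding with [false] embeds the countably many words into the Cantor space as a dense set. *)
Definition finite_word (s : seq bool) : cantor := fun k => nth false s k.

Variable V : cantor -> S -> R.
Hypothesis mV : forall b, measurable_fun setT (V b).
Hypothesis V0 : forall b h, 0 <= V b h.

(** The comparison is with finite words only, so the quantifier is countable and measurability in
    [h] is preserved. *)
Definition near_minimal (s : seq bool) (i : nat) (h : S) :=
  forall t, V (finite_word s) h <= V (finite_word t) h + i.+1%:R^-1.

Definition extendible (p : seq bool) (h : S) :=
  forall i, exists s, near_minimal (p ++ s) i h.

Lemma near_minimal_leq s i j h : (i <= j)%N -> near_minimal s j h -> near_minimal s i h.
Proof.
move=> ij sj t; apply: le_trans (sj t) _; rewrite lerD2l.
by rewrite lef_pV2 ?posrE// ler_nat.
Qed.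

Lemma extendible_nil h : extendible [::] h.
Proof.
move=> i; pose E : set R := range (fun t => V (finite_word t) h).
have infE : has_inf E.
  split; first by exists (V (finite_word [::]) h); exists [::].
  by exists 0 => _ [t _ <-].
have e0 : 0 < (i.+1%:R^-1 : R) by rewrite invr_gt0.
have [_ [s _ <-] sE] := inf_adherent e0 infE.
exists s => t /=; apply: (le_trans (ltW sE)); rewrite lerD2r.
by apply: (ge_inf (proj2 infE)); exists t.
Qed.

Lemma finite_word_rcons_false p : finite_word (rcons p false) = finite_word p.
Proof.
apply/funext => k; rewrite /finite_word nth_rcons.
by case: ltngtP => // [pk|->]; rewrite nth_default// ltnW.
Qed.

(** If both continuations failed, at precisions [i] and [j], a completion of [p] of precision
    [maxn i j] could start with neither bit. The empty completion counts as [false], since padding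
    identifies the two words. *)
Lemma extendible_rcons p h : extendible p h ->
  extendible (rcons p false) h \/ extendible (rcons p true) h.
Proof.
move=> ep; apply: contrapT => /not_orP[/existsNP[i pi] /existsNP[j pj]].
have [s sP] := ep (maxn i j).
have si := near_minimal_leq (leq_maxl i j) sP.
have sj := near_minimal_leq (leq_maxr i j) sP.
case: s => [|[] s] in sP si sj *.
- apply: pi; exists [::] => t; rewrite cats0 finite_word_rcons_false.
  by rewrite -[p]cats0; exact: si.
- by apply: pj; exists s; rewrite cat_rcons.
- by apply: pi; exists s; rewrite cat_rcons.
Qed.

(* Greedy choice of the lexicographically least infinite word that is a limit of
   finite words with values tending to the infimum. *)
Fixpoint greedy (n : nat) (h : S) : seq bool :=
  if n is n'.+1 then
    rcons (greedy n' h) (~~ `[< extendible (rcons (greedy n' h) false) h >])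
  else [::].

Lemma greedy_extendible n h : extendible (greedy n h) h.
Proof.
elim: n => [|n IHn] /=; first exact: extendible_nil.
case: asboolP => //= nf; by have [/nf|] := extendible_rcons IHn.
Qed.

Lemma size_greedy n h : size (greedy n h) = n.
Proof. by elim: n => //= n IHn; rewrite size_rcons IHn. Qed.

Lemma nth_greedy n k h : (k < n)%N ->
  nth false (greedy n h) k = nth false (greedy k.+1 h) k.
Proof.
elim: n => // n IHn; rewrite ltnS leq_eqVlt => /predU1P[->//|kn] /=.
by rewrite [LHS]nth_rcons size_greedy kn IHn.
Qed.

Lemma measurable_near_minimal s i : measurable [set h | near_minimal s i h].
Proof.
apply: measurable_forall => t; rewrite -[X in measurable X]setTI.
by apply: measurable_fun_le => //; exact: measurable_funD.
Qed.

Lemma measurable_extendible p : measurable [set h | extendible p h].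
Proof.
apply: (@measurable_forall _ _ _ (fun i => [set h | exists s, near_minimal (p ++ s) i h])) => i.
by apply: measurable_exists => s; exact: measurable_near_minimal.
Qed.

Lemma measurable_greedy n q : measurable [set h | greedy n h = q].
Proof.
elim: n q => [|n IHn] q.
  case: q => [|b q].
    by rewrite (_ : [set h | _] = setT)//; apply/seteqP; split.
  by rewrite (_ : [set h | _] = set0)//; apply/seteqP; split.
case/lastP: q => [|q b].
  rewrite (_ : [set h | _] = set0)//; apply/seteqP; split => h //= /(congr1 size).
  by rewrite size_rcons.
rewrite (_ : [set h | _] = [set h | greedy n h = q] `&`
    (if b then ~` [set h | extendible (rcons q false) h] else
       [set h | extendible (rcons q false) h])).
  by apply: measurableI => //; case: b; [apply: measurableC|]; exact: measurable_extendible.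
apply/seteqP; split=> h /=.
  move=> /rcons_inj[-> <-]; split=> //.
  by case: (asboolP (extendible _ h)).
by move=> [->]; case: b => [/asboolPn/negPf->|/asboolP->].
Qed.

(** [K n h] is a near-minimal word that starts with the first [n] greedy bits. These words converge
    to the greedy path [beta h], while nothing is claimed about the value of [V] at [beta h]. *)
Lemma measurable_selection : exists (beta : S -> cantor) (K : nat -> S -> seq bool),
  [/\ measurable_fun setT (beta : S -> borel cantor),
      forall n q, measurable [set h | K n h = q],
      forall h, finite_word (K n h) @[n --> \oo] --> beta h &
      forall n h t, V (finite_word (K n h)) h <= V (finite_word t) h + n.+1%:R^-1].
Proof.
pose beta h : cantor := fun k => nth false (greedy k.+1 h) k.
pose A n q := [set h | near_minimal q n h] `&` [set h | greedy n h = take n q].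
have mA n q : measurable (A n q).
  by apply: measurableI; [exact: measurable_near_minimal|exact: measurable_greedy].
have exA n h : exists q, A n q h.
  have [s sP] := greedy_extendible n h n; exists (greedy n h ++ s); split=> //=.
  by rewrite take_cat size_greedy ltnn subnn take0 cats0.
have /choice[K KP] n := countable_measurable_choice (mA n) (exA n).
exists beta, K; split.
- apply: measurable_fun_ptws; first exact: bool_second_countable.
  move=> k _ B mB; rewrite setTI.
  rewrite (_ : _ @^-1` B = [set h | exists q, (if `[< B (nth false q k) >] then
     [set h | greedy k.+1 h = q] else set0) h]).
    apply: measurable_exists => q.
    by case: ifP => _; [exact: (measurable_greedy k.+1 q)|exact: measurable0].
  apply/seteqP; split=> [h /= Bh|h /= [q]].
    by exists (greedy k.+1 h); case: asboolP.
  by case: asboolP => // Bq kq; rewrite /preimage/= /beta [greedy _ _]kq.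
- by move=> n q; have [] := KP n.
- move=> h; apply/cvg_sup => k W [W1 [[W' oW' <-] /= W'x] W1W].
  apply: (filterS W1W); exists k.+1 => // n /= kn.
  suff -> : finite_word (K n h) k = beta h k by [].
  have [_ /(_ h)[_ /= gK]] := KP n.
  by rewrite /beta -(nth_greedy _ kn) gK nth_take.
- by move=> n h t; have [_ /(_ h)[/(_ t)]] := KP n.
Qed.

End Selection.

(** * Conditional means *)

Local Open Scope ereal_scope.

Section CountablePartition.
Context {R : realType} d (O : measurableType d) (J : countType).
Variables (P : {measure set O -> \bar R}) (K : O -> J).
Hypothesis mK : forall j, measurable [set w | K w = j].

Lemma measurable_fun_countable_choice d' (S : measurableType d') (f : J -> O -> S) :
  (forall j, measurable_fun setT (f j)) -> measurable_fun setT (fun w => f (K w) w).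
Proof.
move=> mf _ B mB; rewrite setTI.
rewrite (_ : _ @^-1` B = [set w | exists j, ([set w | K w = j] `&` f j @^-1` B) w]).
  apply: measurable_exists => j; apply: measurableI => //.
  by rewrite -[X in measurable X]setTI; exact: mf.
by apply/seteqP; split=> [w /= Bw|w /= [j [-> ]]//]; exists (K w).
Qed.

(** The integrals split over the countably many events [K w = j], on each of which the choice is
    constant. *)
Lemma le_integral_countable_choice (f g : J -> O -> \bar R) D : measurable D ->
  (forall j, measurable_fun setT (f j)) -> (forall j, measurable_fun setT (g j)) ->
  (forall j w, 0 <= f j w) -> (forall j w, 0 <= g j w) ->
  (forall j, \int[P]_(w in D `&` [set w | K w = j]) f j w <=
             \int[P]_(w in D `&` [set w | K w = j]) g j w) ->
  \int[P]_(w in D) f (K w) w <= \int[P]_(w in D) g (K w) w.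
Proof.
move=> mD mf mg f0 g0 fg.
(* Indexing by codes makes the partition a sequence; a code that is not attained gives the empty
   set. *)
pose F i := D `&` [set w | choice.pickle (K w) = i].
have FE i : F i = set0 \/ exists j, F i = D `&` [set w | K w = j].
  have [->|/set0P[w [Dw /= Kw]]] := eqVneq (F i) set0; [by left|right].
  exists (K w); rewrite /F -Kw; apply/seteqP; split=> w' [Dw' /= Kw']; split=> //=.
    exact: (pcan_inj choice.pickleK).
  by rewrite Kw'.
have mF i : measurable (F i).
  by have [->|[j ->]] := FE i; [exact: measurable0|exact: measurableI].
have DF : D = \bigcup_i F i.
  by apply/seteqP; split=> [w Dw|w [i _ []]//]; exists (choice.pickle (K w)).
have tF : trivIset setT F.
  apply/trivIsetP => i j _ _ /eqP ij; apply/seteqP; split=> // w [[_ /= Ki] [_ /= Kj]].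
  by apply: ij; rewrite -Ki.
rewrite DF ge0_integral_bigcup//; last first.
  by apply: measurable_funTS; exact: measurable_fun_countable_choice.
rewrite ge0_integral_bigcup//; last first.
  by apply: measurable_funTS; exact: measurable_fun_countable_choice.
apply: lee_nneseries => [i _ _|i _]; first by apply: integral_ge0.
have [->|[j ->]] := FE i; first by rewrite !integral_set0.
rewrite (_ : \int[P]_(w in _) f _ _ = \int[P]_(w in D `&` [set w | K w = j]) f j w).
  rewrite (_ : \int[P]_(w in _) g _ _ = \int[P]_(w in D `&` [set w | K w = j]) g j w)//.
  by apply: eq_integral => w /set_mem[_ /= ->].
by apply: eq_integral => w /set_mem[_ /= ->].
Qed.

End CountablePartition.

Section Weights.
Context {R : realType} d (O : measurableType d) d1 (S : measurableType d1).
Variables (P : {measure set O -> \bar R}) (H : O -> S).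
Hypothesis mH : measurable_fun setT H.

(** The hypothesis on events of [H] is an inequality between the two weighted laws of [H], hence
    between integrals of any nonnegative [g] against them. *)
Lemma le_integral_weight (phi1 phi2 : O -> \bar R) (g : S -> \bar R) :
  measurable_fun setT phi1 -> measurable_fun setT phi2 ->
  (forall w, 0 <= phi1 w) -> (forall w, 0 <= phi2 w) ->
  (forall C, measurable C ->
    \int[P]_(w in H @^-1` C) phi1 w <= \int[P]_(w in H @^-1` C) phi2 w) ->
  measurable_fun setT g -> (forall h, 0 <= g h) ->
  \int[P]_w (g (H w) * phi1 w) <= \int[P]_w (g (H w) * phi2 w).
Proof.
move=> m1 m2 p1 p2 le12 mg g0.
have [mu1 mu1E mu1I] := ex_weighted_law P m1 p1 mH.
have [mu2 mu2E mu2I] := ex_weighted_law P m2 p2 mH.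
rewrite -mu1I// -mu2I//; apply: ge0_le_measure_integral => // C mC.
by rewrite mu1E mu2E; exact: le12.
Qed.

Lemma eq_integral_weight (phi1 phi2 : O -> \bar R) (g : S -> \bar R) :
  measurable_fun setT phi1 -> measurable_fun setT phi2 ->
  (forall w, 0 <= phi1 w) -> (forall w, 0 <= phi2 w) ->
  (forall C, measurable C ->
    \int[P]_(w in H @^-1` C) phi1 w = \int[P]_(w in H @^-1` C) phi2 w) ->
  measurable_fun setT g -> (forall h, 0 <= g h) ->
  \int[P]_w (g (H w) * phi1 w) = \int[P]_w (g (H w) * phi2 w).
Proof.
move=> m1 m2 p1 p2 e12 mg g0; apply/eqP; rewrite eq_le.
by apply/andP; split; apply: le_integral_weight => // C mC; rewrite e12.
Qed.

End Weights.

Section FiniteRadonNikodym.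
Context {R : realType} d (S : measurableType d) (m : {measure set S -> \bar R}).
Hypothesis m_fin : fin_num_fun m.

Let finite_m := (m : set S -> \bar R).
HB.instance Definition _ := Measure.on finite_m.
HB.instance Definition _ := @Measure_isFinite.Build _ _ _ finite_m m_fin.

Lemma ex_density (mu : probability S R) : m `<< mu ->
  exists f : S -> R, [/\ measurable_fun setT f, forall s, (0 <= f s)%R &
    forall C, measurable C -> m C = \int[mu]_(s in C) (f s)%:E].
Proof.
move=> mmu; have [f [f0 ffin fint fE]] := @radon_nikodym_sigma_finite _ _ _ mu finite_m mmu.
exists (fine \o f); split.
- by apply: measurableT_comp => //; case/integrableP : fint.
- by move=> s; rewrite /= fine_ge0.
- move=> C mC; transitivity (finite_m C); [by []|rewrite fE//]; apply: eq_integral => s _.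
  by rewrite /= fineK.
Qed.

End FiniteRadonNikodym.

Section ConditionalMean.
Context {R : realType} d (O : measurableType d) d1 (S : measurableType d1).
Variables (P : probability O R) (H : O -> S).
Hypothesis mH : measurable_fun setT H.

(** A Radon-Nikodym density of the [phi]-weighted law of [H] with respect to the law of [H]. It is
    real and nonnegative everywhere, as the selection of minimisers requires. *)
Lemma ex_conditional_mean (phi : O -> R) (M : R) : measurable_fun setT phi ->
  (forall w, 0 <= phi w <= M)%R ->
  exists f : S -> R, [/\ measurable_fun setT f, forall s, (0 <= f s)%R &
    forall C, measurable C ->
      \int[P]_(w in H @^-1` C) (f (H w))%:E = \int[P]_(w in H @^-1` C) (phi w)%:E].
Proof.
move=> mphi phi0M.
have mphiE : measurable_fun setT (fun w => (phi w)%:E) by exact/measurable_EFinP.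
have phi0 w : 0 <= (phi w)%:E by rewrite lee_fin; have /andP[] := phi0M w.
have [m mE mI] := ex_weighted_law P mphiE phi0 mH.
have HT : pushforward P H setT = 1 by rewrite -[LHS]/(P setT) probability_setT.
have [mu muE] := ex_probability HT.
have mHC C : measurable C -> measurable (H @^-1` C).
  by move=> mC; rewrite -[X in measurable X]setTI; exact: mH.
have mM C : measurable C -> m C <= M%:E * P (H @^-1` C).
  move=> mC; rewrite mE -integral_cst; last exact: mHC.
  apply: ge0_le_integral; [exact: mHC|by move=> w _; exact: phi0| | |].
  - exact: measurable_funTS.
  - exact: measurable_cst.
  - by move=> w _; rewrite lee_fin; have /andP[] := phi0M w.
have mfin : fin_num_fun m.
  move=> C mC; rewrite ge0_fin_numE//; apply: (le_lt_trans (mM C mC)).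
  by rewrite ltey_eq fin_numM// fin_num_measure//; exact: mHC.
have mdom : m `<< mu.
  apply/null_content_dominatesP => C mC muC; have PC : P (H @^-1` C) = 0.
    by rewrite -muC [RHS](congr1 (fun m' : set S -> \bar R => m' C) muE).
  by apply/eqP; rewrite eq_le measure_ge0 andbT (le_trans (mM C mC))// PC mule0.
have [f [mf f0 fE]] := ex_density mfin mdom.
exists f; split=> // C mC; rewrite -mE fE//.
transitivity (\int[pushforward P H]_(s in C) (f s)%:E).
  rewrite ge0_integral_pushforward//; first exact/measurable_funTS/measurable_EFinP.
  by move=> s _; rewrite lee_fin.
apply: eq_measure_integral => A mA _.
by rewrite -[LHS](congr1 (fun m' : set S -> \bar R => m' A) muE).
Qed.

End ConditionalMean.

Section ConditionalIndependence.
Context {R : realType} d (O : measurableType d).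
Context d1 d2 d3 (S : measurableType d1) (E : measurableType d2) (F : measurableType d3).
Variables (P : probability O R) (H : O -> S) (Z : O -> E) (W : O -> F).
Hypotheses (mH : measurable_fun setT H) (mZ : measurable_fun setT Z)
  (mW : measurable_fun setT W).

Let preimage_measurable d' (M : measurableType d') (f : O -> M) A :
  measurable_fun setT f -> measurable A -> measurable (f @^-1` A).
Proof. by move=> mf mA; rewrite -[X in measurable X]setTI; exact: mf. Qed.

Let indicE (A : set O) (f : O -> \bar R) w :
  (f w * (\1_A w)%:E)%E = if w \in A then f w else 0.
Proof. by rewrite indicE; case: (w \in A); rewrite ?mule1 ?mule0. Qed.

Lemma cond_prob_weight (A : set O) (f psi : S -> \bar R) : measurable A ->
  cond_prob P H A f -> measurable_fun setT psi -> (forall h, 0 <= psi h) ->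
  \int[P]_w (psi (H w) * f (H w)) = \int[P]_(w in A) psi (H w).
Proof.
move=> mA [mf f0 fE] mpsi psi0.
rewrite [RHS]integral_mkcond.
under [RHS]eq_integral do rewrite patchE -(indicE A (fun w => psi (H w))).
have mfH : measurable_fun setT (fun w => f (H w)) by exact: measurableT_comp.
have mA1 : measurable_fun setT (fun w => (\1_A w : R)%:E).
  by apply/measurable_EFinP; exact: measurable_indic.
apply: (eq_integral_weight mH mfH mA1) => // C mC.
by rewrite fE// integral_indic//; exact: preimage_measurable.
Qed.

(** Restricting to [W] in [B] acts on the joint law of [Z] and [H] as a density [g(H)], where [g] is
    the conditional probability of that event. Rectangles suffice. *)
Lemma cond_indep_weight (B : set F) : cond_indep P H Z W -> measurable B ->
  exists g : S -> \bar R, [/\ measurable_fun setT g, forall h, 0 <= g h &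
    forall phi : E * S -> \bar R, measurable_fun setT phi -> (forall p, 0 <= phi p) ->
    \int[P]_(w in W @^-1` B) phi (Z w, H w) = \int[P]_w (phi (Z w, H w) * g (H w))].
Proof.
move=> ZW mB; have [f [g [_ gP _]]] := ZW setT B measurableT mB.
have [mg g0 gE] := gP.
exists g; split=> // phi mphi phi0.
have mWB := preimage_measurable mW mB.
have mB1 : measurable_fun setT (fun w => (\1_(W @^-1` B) w : R)%:E).
  by apply/measurable_EFinP; exact: measurable_indic.
have mgH : measurable_fun setT (fun w => g (H w)) by exact: measurableT_comp.
have B10 w : 0 <= (\1_(W @^-1` B) w : R)%:E by rewrite lee_fin.
have gH0 w : 0 <= g (H w) by [].
have mZH : measurable_fun setT (fun w => (Z w, H w)) by exact/measurable_fun_pair.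
rewrite integral_mkcond.
under eq_integral do rewrite patchE -(indicE _ (fun w => phi (Z w, H w))).
have [m1 m1E <-//] := ex_weighted_law P mB1 B10 mZH.
have [m2 m2E <-//] := ex_weighted_law P mgH gH0 mZH.
apply: eq_measure_integral => D mD _; move: D mD; apply: eq_measure_setX.
  rewrite m1E preimage_setT integral_indic// setIT.
  exact: (le_lt_trans (probability_le1 P mWB) (ltry 1)).
move=> A C mA mC; rewrite m1E m2E.
have mAC : measurable (Z @^-1` A `&` H @^-1` C).
  by apply: measurableI; exact: preimage_measurable.
have [fA [gA [fAP gAP fgE]]] := ZW A B mA mB.
have [mf f0 _] := fAP; have [mgA gA0 _] := gAP; have [_ _ fgI] := fgE.
pose psi h := fA h * (\1_C h : R)%:E.
have mC1 : measurable_fun setT (fun h => (\1_C h : R)%:E).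
  by apply/measurable_EFinP; exact: measurable_indic.
have mpsi : measurable_fun setT psi by exact: emeasurable_funM.
have psi0 h : 0 <= psi h by rewrite mule_ge0// lee_fin.
have mgC : measurable_fun setT (fun h => (\1_C h : R)%:E * g h) by exact: emeasurable_funM.
have gC0 h : 0 <= (\1_C h : R)%:E * g h by rewrite mule_ge0// lee_fin.
have C1H w : (\1_C (H w) : R) = \1_(H @^-1` C) w by [].
transitivity (P (Z @^-1` A `&` W @^-1` B `&` H @^-1` C)).
  by rewrite integral_indic// setIC setIAC.
rewrite -fgI//.
transitivity (\int[P]_w (psi (H w) * gA (H w))).
  rewrite integral_mkcond; apply: eq_integral => w _; rewrite patchE.
  by rewrite -(indicE _ (fun w => fA (H w) * gA (H w))) -C1H /psi muleAC.
(* Under a weight depending on [H], both [gA] and [g] integrate like the indicator of [W] in [B], so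
   one replaces the other; [fA] then becomes the indicator of [Z] in [A]. *)
rewrite (cond_prob_weight mWB gAP mpsi psi0) -(cond_prob_weight mWB gP mpsi psi0).
transitivity (\int[P]_w ((\1_C (H w) : R)%:E * g (H w) * fA (H w))).
  by apply: eq_integral => w _; rewrite /psi -muleA muleC.
rewrite (cond_prob_weight (preimage_measurable mZ mA) fAP mgC gC0).
rewrite [LHS]integral_mkcond [RHS]integral_mkcond; apply: eq_integral => w _.
rewrite !patchE -(indicE _ (fun w => (\1_C (H w) : R)%:E * g (H w))) -(indicE _ (fun w => g (H w))).
rewrite C1H.
have -> : (fun w => (Z w, H w)) @^-1` (A `*` C) = Z @^-1` A `&` H @^-1` C by [].
by rewrite indicI /= EFinM muleA [RHS]muleAC [X in _ = X * _]muleC.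
Qed.

End ConditionalIndependence.

Local Close Scope ereal_scope.

Lemma finite_word_cvg (b : {ptws nat -> bool}) :
  finite_word (mkseq b n) @[n --> \oo] --> b.
Proof.
apply/cvg_sup => k W [W1 [[W' oW' <-] /= W'x] W1W].
apply: (filterS W1W); exists k.+1 => // n /= kn.
suff -> : finite_word (mkseq b n) k = b k by [].
by rewrite /finite_word nth_mkseq.
Qed.

(** The Hausdorff-Alexandroff theorem; images of finite words are then dense in [U]. *)
Lemma compact_dense_words (R : realType) (U : pmetricType R) : compact [set: U] ->
  exists p : {ptws nat -> bool} -> U, continuous p /\
    forall u, exists b, p b = u.
Proof.
move=> cU; have [f cf] := @cantor_surj R U cU (@metric_hausdorff _ _).
exists f; split; first exact: cf.
by move=> u; have [b _ <-] := @surj _ _ _ _ f u I; exists b.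
Qed.

Section Cost.
Context {R : realType} {X U : pmetricType R}.
Variables (c : X -> U -> R) (M : R).
Hypothesis c0M : forall x u, 0 <= c x u <= M.
Hypothesis c_continuous : continuous (fun p : X * U => c p.1 p.2).
Hypotheses (cX : compact [set: X]) (cU : compact [set: U]).

Let c0 x u : (0 <= (c x u)%:E)%E.
Proof. by rewrite lee_fin; have /andP[] := c0M x u. Qed.

Lemma measurable_cost d (O : measurableType d) (Z : O -> borel X) (W : O -> borel U) :
  measurable_fun setT Z -> measurable_fun setT W ->
  measurable_fun setT (fun w => (c (Z w) (W w))%:E).
Proof.
move=> mZ mW; apply/measurable_EFinP.
have sX := compact_second_countable_pmetric cX.
have sU := compact_second_countable_pmetric cU.
exact: (measurableT_comp (continuous_measurableR c_continuous)
  (measurable_fun_borel_pair sX sU mZ mW)).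
Qed.

Lemma cost_cvg x (u_ : nat -> U) (u : U) : u_ n @[n --> \oo] --> u ->
  c x (u_ n) @[n --> \oo] --> c x u.
Proof.
move=> uu; have xu : (x, u_ n) @[n --> \oo] --> (x, u).
  by apply: cvg_pair => //; exact: cvg_cst.
exact: (cvg_comp (fun n => (x, u_ n)) (fun p : X * U => c p.1 p.2) xu (@c_continuous (x, u))).
Qed.

Lemma integral_cost_cvg d (O : measurableType d) (P : probability O R) (D : set O)
    (Z : O -> borel X) (W_ : nat -> O -> U) (W : O -> U) :
  measurable D -> measurable_fun setT Z ->
  (forall n, measurable_fun setT (W_ n : O -> borel U)) ->
  (forall w, W_ n w @[n --> \oo] --> W w) ->
  (\int[P]_(w in D) (c (Z w) (W_ n w))%:E @[n --> \oo] -->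
    \int[P]_(w in D) (c (Z w) (W w))%:E)%E.
Proof.
move=> mD mZ mW WW.
apply: (@dominated_cvg _ _ _ P D mD (fun n w => (c (Z w) (W_ n w))%:E)
  (fun w => (c (Z w) (W w))%:E) (cst M%:E)) => //.
- by move=> n; apply: measurable_funTS; exact: measurable_cost.
- by move=> w _; apply: cvg_EFin; [exact: nearW|exact: cost_cvg].
- apply: (integrableS measurableT) => //.
  exact: (finite_measure_integrable_cst P M measurableT).
- move=> n w _ /=; have /andP[c0w cMw] := c0M (Z w) (W_ n w).
  by rewrite lee_fin ger0_norm.
Qed.

Section OptimalSelector.
Context d (S : measurableType d) (mu : probability (borel X * S)%type R).

(** Costs are compared after integration: [K n] is as good as each finite word up to 1 / (n + 1),
    dominated convergence carries this from [K n] to [beta], and then from finite words to an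
    arbitrary [u]. *)
Lemma ex_optimal_selector : exists gamma : S -> borel U,
  measurable_fun setT gamma /\ forall (C : set S) (u : U), measurable C ->
  (\int[mu]_(p in snd @^-1` C) (c p.1 (gamma p.2))%:E <=
   \int[mu]_(p in snd @^-1` C) (c p.1 u)%:E)%E.
Proof.
have [pr [cpr pr_surj]] := compact_dense_words cU.
have pr_cvg (b_ : nat -> {ptws nat -> bool}) b :
    b_ n @[n --> \oo] --> b -> pr (b_ n) @[n --> \oo] --> pr b.
  by move=> b_b; exact: (cvg_comp _ _ b_b (@cpr b)).
have msnd : measurable_fun setT (snd : borel X * S -> S) by exact: measurable_snd.
have mfst : measurable_fun setT (fst : borel X * S -> borel X) by exact: measurable_fst.
have mcu u : measurable_fun setT (fun p : borel X * S => c p.1 u).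
  apply/measurable_EFinP; apply: (measurable_cost (W := fun=> u)) => //.
have [V VP] := choice (fun b => ex_conditional_mean mu msnd (mcu (pr b))
  (fun p : borel X * S => c0M p.1 (pr b))).
have mV b : measurable_fun setT (V b) by have [] := VP b.
have V0 b h : 0 <= V b h by have [] := VP b.
have VE b C : measurable C -> (\int[mu]_(p in snd @^-1` C) (V b p.2)%:E =
    \int[mu]_(p in snd @^-1` C) (c p.1 (pr b))%:E)%E by have [_ _] := VP b; exact.
have [beta [K [mbeta mK Kbeta Kmin]]] := measurable_selection mV V0.
have mgamma : measurable_fun setT (fun h => pr (beta h) : borel U).
  exact: (measurableT_comp (continuous_measurable cpr) mbeta).
exists (fun h => pr (beta h)); split => // C u mC.
have mCs : measurable (snd @^-1` C : set (borel X * S)).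
  by rewrite -[X in measurable X]setTI; exact: msnd.
pose D : set (borel X * S) := snd @^-1` C.
have mKs n q : measurable [set p : borel X * S | K n p.2 = q].
  by rewrite -[X in measurable X]setTI; exact: msnd (mK n q).
have mW n : measurable_fun setT (fun p : borel X * S => pr (finite_word (K n p.2)) : borel U).
  exact: (measurable_fun_countable_choice (mKs n)
    (f := fun q p => pr (finite_word q) : borel U)).
have step n t : (\int[mu]_(p in D) (c p.1 (pr (finite_word (K n p.2))))%:E <=
    \int[mu]_(p in D) (c p.1 (pr (finite_word t)))%:E + (n.+1%:R^-1)%:E)%E.
  apply: (@le_trans _ _ (\int[mu]_(p in D) (V (finite_word (K n p.2)) p.2)%:E)%E).
    (* On the event that [K n] equals [q] the decision is fixed, and the cost may be exchanged with
       its conditional mean [V]. *)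
    apply: (le_integral_countable_choice (mKs n)
      (f := fun q p => (c p.1 (pr (finite_word q)))%:E)
      (g := fun q p => (V (finite_word q) p.2)%:E)) => //.
    + by move=> q; exact/measurable_EFinP.
    + move=> q; apply/measurable_EFinP; exact: (measurableT_comp (mV _) msnd).
    + by move=> q p; rewrite lee_fin.
    + move=> q; rewrite (_ : D `&` _ = snd @^-1` (C `&` [set h | K n h = q]))//.
      by rewrite VE//; exact: measurableI.
  rewrite -(VE (finite_word t) C mC).
  have mVt : measurable_fun D (fun p => (V (finite_word t) p.2)%:E).
    apply/measurable_funTS/measurable_EFinP; exact: (measurableT_comp (mV _) msnd).
  apply: (@le_trans _ _ (\int[mu]_(p in D) ((V (finite_word t) p.2)%:E + (n.+1%:R^-1)%:E))%E).
    apply: ge0_le_integral => //.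
    + by move=> p _; rewrite lee_fin.
    + apply: measurable_funTS; apply: (measurable_fun_countable_choice (mKs n)
        (f := fun q p => (V (finite_word q) p.2)%:E)) => q.
      apply/measurable_EFinP; exact: (measurableT_comp (mV _) msnd).
    + by apply: emeasurable_funD.
    + by move=> p _; rewrite -EFinD lee_fin.
  rewrite ge0_integralD//; last by move=> p _; rewrite lee_fin.
  by apply: leeD2l; rewrite integral_cst// -[leRHS]mule1 lee_pmul//; exact: probability_le1.
have Kcvg := integral_cost_cvg (P := mu) mCs mfst mW
  (fun p => pr_cvg _ _ (Kbeta p.2)).
have le_word t : (\int[mu]_(p in D) (c p.1 (pr (beta p.2)))%:E <=
    \int[mu]_(p in D) (c p.1 (pr (finite_word t)))%:E)%E.
  apply/lee_addgt0Pr => e e0; apply: (cvge_le _ Kcvg).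
  near=> n; apply: (le_trans (step n t)); apply: leeD2l; rewrite lee_fin ltW//.
  near: n; exact: (near_infty_natSinv_lt (PosNum e0)).
have [b <-] := pr_surj u.
have bcvg := integral_cost_cvg (W_ := fun n _ => pr (finite_word (mkseq b n)))
  (W := fun=> pr b) (P := mu) mCs mfst (fun n => measurable_cst _)
  (fun p => pr_cvg _ _ (@finite_word_cvg b)).
apply: (cvge_ge _ bcvg); apply: nearW => n; exact: le_word.
Unshelve. all: by end_near. Qed.

End OptimalSelector.
End Cost.

(** * Comparison of policies *)

(** Decisions are rounded measurably to the image of a finite word within 1 / (n + 1); interiors of
    balls give Borel events at once. *)
Lemma ex_countable_approximation (R : realType) (U : pmetricType R) :
  compact [set: U] -> exists (u_ : seq bool -> U) (K : nat -> borel U -> seq bool),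
    (forall n q, measurable [set u | K n u = q]) /\
    forall u : U, u_ (K n u) @[n --> \oo] --> u.
Proof.
move=> cU; have [pr [cpr pr_surj]] := compact_dense_words cU.
pose u_ s := pr (finite_word s).
have e0 n : 0 < (n.+1%:R^-1 : R) by rewrite invr_gt0.
pose A n q : set (borel U) := interior (ball (u_ q) (n.+1%:R^-1 : R)).
have mA n q : measurable (A n q).
  by apply: (@open_borel U); exact: open_interior.
have exA n u : exists q, A n q u.
  have [b bu] := pr_surj u.
  have words : u_ (mkseq b k) @[k --> \oo] --> u.
    by rewrite -bu; exact: (cvg_comp _ _ (@finite_word_cvg b) (@cpr b)).
  (* If a word image is within half the radius of [u], its ball of full radius contains the
     half-size ball around [u], so [u] is an interior point. *)
  have e20 : 0 < (n.+1%:R^-1 / 2 : R) by rewrite divr_gt0.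
  have [k _ /(_ k (leqnn k)) kP] := cvg_ball words e20.
  exists (mkseq b k); rewrite /A /interior/= -nbhs_ballE; exists (n.+1%:R^-1 / 2) => //.
  by move=> v uv; apply: (@ball_split _ _ u) => //; exact: ball_sym.
have /choice[K KP] n := countable_measurable_choice (mA n) (exA n).
exists u_, K; split=> [n q|u]; first by have [] := KP n.
apply/cvg_ballP => e epos; near=> n; apply: ball_sym.
have [_ /(_ u)/interior_subset uK] := KP n.
apply: (le_ball _ uK); apply: ltW; near: n.
exact: (near_infty_natSinv_lt (PosNum epos)).
Unshelve. all: by end_near. Qed.

Section Competitor.
Context {R : realType} {X U : pmetricType R}.
Variables (c : X -> U -> R) (M : R).
Hypothesis c0M : forall x u, 0 <= c x u <= M.
Hypothesis c_continuous : continuous (fun p : X * U => c p.1 p.2).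
Hypotheses (cX : compact [set: X]) (cU : compact [set: U]).
Context d (O : measurableType d) d1 (S : measurableType d1).
Variables (P : probability O R) (Z : O -> borel X) (H : O -> S) (W : O -> borel U).
Hypotheses (mZ : measurable_fun setT Z) (mH : measurable_fun setT H)
  (mW : measurable_fun setT W).
Variable gamma : S -> borel U.
Hypothesis mgamma : measurable_fun setT gamma.
Hypothesis gamma_optimal : forall (C : set S) (u : U), measurable C ->
  (\int[P]_(w in H @^-1` C) (c (Z w) (gamma (H w)))%:E <=
   \int[P]_(w in H @^-1` C) (c (Z w) u)%:E)%E.

(** [W] is rounded to countably many values. On the event of one value the competitor is a constant
    decision under a weight [g(H)], to which [gamma_optimal] extends from events of [H]; continuity
    of the cost removes the rounding. *)
Lemma selector_cost_le : cond_indep P H Z W ->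
  (\int[P]_w (c (Z w) (gamma (H w)))%:E <= \int[P]_w (c (Z w) (W w))%:E)%E.
Proof.
move=> ZW; have [u_ [K [mK Kcvg]]] := ex_countable_approximation cU.
have c0 x u : (0 <= (c x u)%:E)%E by rewrite lee_fin; have /andP[] := c0M x u.
have mcost d2 (O2 : measurableType d2) (Z2 : O2 -> borel X) (W2 : O2 -> borel U) :
  measurable_fun setT Z2 -> measurable_fun setT W2 ->
  measurable_fun setT (fun w => (c (Z2 w) (W2 w))%:E) by exact: measurable_cost.
have mKW n q : measurable [set w | K n (W w) = q].
  by rewrite -[X in measurable X]setTI; exact: mW (mK n q).
have mgH : measurable_fun setT (fun w => gamma (H w)) by exact: measurableT_comp.
have step n : (\int[P]_w (c (Z w) (gamma (H w)))%:E <=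
    \int[P]_w (c (Z w) (u_ (K n (W w))))%:E)%E.
  apply: (le_integral_countable_choice (mKW n)
    (f := fun _ w => (c (Z w) (gamma (H w)))%:E)
    (g := fun q w => (c (Z w) (u_ q))%:E)) => //.
  - by move=> q; exact: mcost.
  - by move=> q; apply: mcost => //; exact: measurable_cst.
  move=> q; rewrite setTI.
  have [g [mg g0 gE]] := cond_indep_weight mH mZ mW ZW (mK n q).
  have gW (v : S -> borel U) : measurable_fun setT v ->
      (\int[P]_(w in [set w | K n (W w) = q]) (c (Z w) (v (H w)))%:E =
       \int[P]_w (g (H w) * (c (Z w) (v (H w)))%:E))%E.
    move=> mv; rewrite (gE (fun p => (c p.1 (v p.2))%:E))//.
      by under eq_integral do rewrite muleC.
    by apply: mcost; [exact: measurable_fst|exact: measurableT_comp].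
  rewrite gW// (gW (fun=> u_ q)); last exact: measurable_cst.
  apply: (le_integral_weight mH) => //.
  - exact: mcost.
  - by apply: mcost => //; exact: measurable_cst.
  - by move=> C mC; exact: gamma_optimal.
have Wcvg := integral_cost_cvg c0M c_continuous cX cU (P := P) measurableT mZ
  (fun n => measurable_fun_countable_choice (mKW n) (f := fun q _ => u_ q : borel U)
     (fun q => measurable_cst _)) (fun w => Kcvg (W w)).
by apply: (cvge_ge _ Wcvg); exact: nearW.
Qed.

End Competitor.

(** * Constant randomization and decisions that are functions of the past *)

Section ConstantRandomization.
Context {R : realType} {d : measure_display} {O : measurableType d}.
Variable P : probability O R.

Lemma preimage_cst_prob d' (S : measurableType d') (s : S) (I : Type) (r : seq I)
    (C : I -> set S) :
  P (\big[setI/setT]_(i <- r) ((fun _ : O => s) @^-1` C i)) =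
  (\prod_(i <- r) \d_s (C i))%E.
Proof.
elim: r => [|i r IHr]; first by rewrite !big_nil probability_setT.
rewrite !big_cons diracE -IHr; case: (boolP (s \in C i)) => [/set_mem si|/negP si].
  by rewrite preimage_cst mem_set// setTI mul1e.
by rewrite preimage_cst memNset// ?set0I ?measure0 ?mul0e// => /mem_set.
Qed.

(** Constant maps generate only the empty and the full event, which are independent of
    everything. *)
Lemma randomization_cst (X : pmetricType R) dV (VT : measurableType dV)
    (Xt : int -> O -> borel X) (Vt : int -> O -> VT) (r : R) :
  randomization P Xt Vt (\d_r : probability R R) (fun _ _ => r).
Proof.
split; first split.
- by move=> i; exact: measurable_cst.
- by move=> s C _ _; exact: preimage_cst_prob.
move=> A B _ sB.
have BE : forall w w', B w -> B w'.
  apply: (sB [set B : set O | forall w w', B w -> B w']); split.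
    split=> //.
    + by move=> D DE w w' [_ nDw]; split => // Dw'; apply: nDw; exact: DE Dw'.
    + by move=> F FE w w' [i _ Fi]; exists i => //; exact: FE Fi.
  by move=> _ [i _ [D _ <-]] w w' [_ Dr].
have [[w Bw]|noB] := pselect (exists w, B w).
  have -> : B = setT by apply/seteqP; split=> // w' _; exact: BE Bw.
  by rewrite setIT -[X in (_ * X)%E]/(P setT) probability_setT mule1.
have -> : B = set0 by apply/seteqP; split=> // w Bw; apply: noB; exists w.
by rewrite setI0 measure0 mule0.
Qed.

End ConstantRandomization.

Section LawsAndPolicies.
Context {R : realType} {d : measure_display} {O : measurableType d}.
Variable P : probability O R.

Lemma ex_has_law d1 (S : measurableType d1) (Z : O -> S) :
  measurable_fun setT Z -> exists mu : probability S R, has_law P Z mu.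
Proof.
move=> mZ; have m1 : (pushforward P Z setT = 1)%E.
  by rewrite -[LHS]/(P setT) probability_setT.
have [mu muE] := ex_probability m1; exists mu; split=> // E mE.
by rewrite (congr1 (fun m : set S -> \bar R => m E) muE).
Qed.

Lemma integral_has_law d1 (S : measurableType d1) (Z : O -> S)
    (mu : probability S R) (D : set S) (f : S -> \bar R) : has_law P Z mu ->
  measurable D -> measurable_fun setT f -> (forall s, 0 <= f s)%E ->
  (\int[mu]_(s in D) f s = \int[P]_(w in Z @^-1` D) f (Z w))%E.
Proof.
move=> [mZ ZE] mD mf f0; transitivity (\int[pushforward P Z]_(s in D) f s)%E.
  by apply: eq_measure_integral => A mA _; exact/esym/ZE.
by rewrite ge0_integral_pushforward//; exact: measurable_funTS.
Qed.

(** The event that [gamma \o H] lies in [B] has an indicator of [H] as its conditional probability,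
    and such an indicator factors out. *)
Lemma cond_indep_function d1 d2 d3 (S : measurableType d1) (E : measurableType d2)
    (F : measurableType d3) (H : O -> S) (Z : O -> E) (gamma : S -> F) :
  measurable_fun setT H -> measurable_fun setT Z -> measurable_fun setT gamma ->
  cond_indep P H Z (gamma \o H).
Proof.
move=> mH mZ mgamma A B mA mB.
have mZA : measurable (Z @^-1` A) by rewrite -[X in measurable X]setTI; exact: mZ.
have mgB : measurable (gamma @^-1` B) by rewrite -[X in measurable X]setTI; exact: mgamma.
have mHC C : measurable C -> measurable (H @^-1` C).
  by move=> mC; rewrite -[X in measurable X]setTI; exact: mH.
have m1 : measurable_fun setT (\1_(Z @^-1` A) : O -> R) by exact: measurable_indic.
have i01 w : 0 <= (\1_(Z @^-1` A) w : R) <= 1.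
  by rewrite indicE; case: (_ \in _); rewrite ?lexx ?ler01.
have [f [mf f0 fE]] := ex_conditional_mean P mH m1 (M := 1) i01.
have fP C : measurable C ->
    (\int[P]_(w in H @^-1` C) (f (H w))%:E = P (Z @^-1` A `&` H @^-1` C))%E.
  by move=> mC; rewrite fE// integral_indic//; exact: mHC.
pose g h : \bar R := (\1_(gamma @^-1` B) h)%:E.
have mg : measurable_fun setT g by apply/measurable_EFinP; exact: measurable_indic.
exists (EFin \o f), g; split.
- by split=> //; exact/measurable_EFinP.
- split=> //; first by move=> h; rewrite lee_fin.
  move=> C mC; rewrite (_ : (fun w => g (H w)) = (fun w => (\1_(H @^-1` (gamma @^-1` B)) w)%:E))//.
  by rewrite integral_indic//; exact: mHC.
- split.
  + by apply: emeasurable_funM => //; exact/measurable_EFinP.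
  + by move=> h; rewrite mule_ge0// lee_fin.
  + move=> C mC; have mCB : measurable (C `&` gamma @^-1` B) by exact: measurableI.
    rewrite (_ : _ `&` _ `&` _ = Z @^-1` A `&` H @^-1` (C `&` gamma @^-1` B)); last first.
      by rewrite -setIA; congr (_ `&` _); rewrite setIC.
    rewrite -fP// integral_mkcond [RHS]integral_mkcond; apply: eq_integral => w _.
    rewrite !patchE preimage_setI in_setI; case: (_ \in H @^-1` C) => //=.
    rewrite /g indicE.
    have -> : (w \in H @^-1` (gamma @^-1` B)) = (H w \in gamma @^-1` B) by [].
    by case: ifP => _; rewrite ?mule1 ?mule0.
Qed.

End LawsAndPolicies.

Lemma le_limn_esup (R : realType) (u v : nat -> \bar R) :
  (forall n, u n <= v n)%E -> (limn_esup u <= limn_esup v)%E.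
Proof.
move=> uv; apply: le_ereal_inf_tmp => _ [V FV <-].
apply: (@le_trans _ _ (ereal_sup (u @` V))).
  by apply: ereal_inf_lbound; exists V.
apply: ge_ereal_sup => _ [n Vn <-]; apply: (le_trans (uv n)).
by apply: ereal_sup_ubound; exists n.
Qed.

(** * Optimal stationary policies under an invariant law *)

Section OptimalPolicy.
Context {R : realType} {X Y U : pmetricType R}.
Context {dV : measure_display} {VT : measurableType dV}.
Variables (G : borel X * VT -> borel Y) (pV : probability VT R).
Variables (T : R.-pker (borel X) ~> (borel X)) (Q : R.-pker (borel X) ~> (borel Y)).
Hypothesis mG : measurable_fun setT G.
Hypothesis Q_channel : forall (x : borel X) (C : set (borel Y)), measurable C ->
  Q x C = pV [set v | C (G (x, v))].
Hypotheses (cX : compact [set: X]) (cY : compact [set: Y]) (cU : compact [set: U]).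
Variables (c : X -> U -> R) (M : R).
Hypothesis c0M : forall x u, 0 <= c x u <= M.
Hypothesis c_continuous : continuous (fun p : X * U => c p.1 p.2).

Lemma expected_cost_sum d (O : measurableType d) (P : probability O R)
    (Xt : int -> O -> borel X) (Ut : nat -> O -> borel U) N :
  (forall t, measurable_fun setT (Xt t)) -> (forall t, measurable_fun setT (Ut t)) ->
  ('E_P[fun w => (\sum_(0 <= t < N) c (Xt t%:Z w) (Ut t w))%R] =
   \sum_(0 <= t < N) \int[P]_w (c (Xt t%:Z w) (Ut t w))%:E)%E.
Proof.
move=> mX mU; rewrite expectation.unlock.
under eq_integral do rewrite -sumEFin.
rewrite ge0_integral_sum// => t.
  exact: measurable_cost.
by move=> w _; rewrite lee_fin; have /andP[] := c0M (Xt t%:Z w) (Ut t w).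
Qed.

(** By invariance the pair of state and past has law [mu] at every decision time in both
    realizations. The stage cost of the policy is thus an integral against [mu], which is recomputed
    on the competitor's space and compared there. *)
Lemma ex_optimal_policy (mu : probability (borel X * borel (history Y))%type R) :
  invariant_law T Q mu -> exists gamma : borel (history Y) -> borel U,
  measurable_fun setT gamma /\
  forall rho : probability R R,
    optimal_stationary_policy G pV T c mu rho (fun p => gamma p.1).
Proof.
move=> mu_inv; have [gamma [mgamma gammaE]] := ex_optimal_selector c0M c_continuous cX cU mu.
exists gamma; split => // rho d O P Xt Vt Rt process law_mu _ Ut.
have mXt t : measurable_fun setT (Xt t) by exact: state_measurable process t.
have mpast t : measurable_fun setT (past G Xt Vt t) by exact: (measurable_past mG cY process t).
have mUt t : measurable_fun setT (Ut t) by exact: (measurableT_comp mgamma (mpast t%:Z)).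
split=> [t|d' O' P' Xt' Vt' Ut' process' law_mu' adm'].
  by split=> //; exact: (cond_indep_function P (mpast t%:Z) (mXt t%:Z) mgamma).
have mXt' t : measurable_fun setT (Xt' t) by exact: state_measurable process' t.
have mpast' t : measurable_fun setT (past G Xt' Vt' t).
  exact: (measurable_past mG cY process' t).
have mUt' t : measurable_fun setT (Ut' t) by have [] := adm' t.
have law t := has_law_nat mG Q_channel cY process t mu_inv law_mu.
have law' t := has_law_nat mG Q_channel cY process' t mu_inv law_mu'.
have c0 x u : (0 <= (c x u)%:E)%E by rewrite lee_fin; have /andP[] := c0M x u.
have mcost (v : borel (history Y) -> borel U) : measurable_fun setT v ->
    measurable_fun setT (fun p : borel X * borel (history Y) => (c p.1 (v p.2))%:E).
  move=> mv; apply: (measurable_cost c_continuous cX cU measurable_fst).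
  exact: (measurableT_comp mv measurable_snd).
have stage t : (\int[P]_w (c (Xt t%:Z w) (Ut t w))%:E <=
    \int[P']_w (c (Xt' t%:Z w) (Ut' t w))%:E)%E.
  have -> : (\int[P]_w (c (Xt t%:Z w) (Ut t w))%:E =
      \int[mu]_p (c p.1 (gamma p.2))%:E)%E.
    by rewrite (integral_has_law (law t) measurableT (mcost _ mgamma)).
  rewrite (integral_has_law (law' t) measurableT (mcost _ mgamma))//.
  apply: (selector_cost_le c0M c_continuous cX cU (mXt' t%:Z) (mpast' t%:Z) (mUt' t) mgamma).
    move=> C u mC; have mC2 : measurable (snd @^-1` C : set (borel X * borel (history Y))).
      by rewrite -[X in measurable X]setTI; exact: measurable_snd.
    have := gammaE C u mC.
    rewrite (integral_has_law (law' t) mC2 (mcost _ mgamma))//.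
    by rewrite (integral_has_law (law' t) mC2 (mcost (fun=> u) (measurable_cst _))).
  by have [] := adm' t.
apply: le_limn_esup => N; rewrite !expected_cost_sum//.
(* This covers the horizon 0 as well, where the inverse is 0 by convention. *)
apply: lee_wpmul2l; first by rewrite lee_fin invr_ge0.
by apply: lee_sum => t _; exact: stage.
Qed.

End OptimalPolicy.

(** Strict stationarity concerns finite intersections of state events; a cylinder of the history is
    one, over the times 0, -1, ..., -n. *)
Lemma stationary_shift (R : realType) (X : pmetricType R) d (O : measurableType d)
    (P : probability O R) (Xt : int -> O -> borel X) :
  compact [set: X] -> (forall t, measurable_fun setT (Xt t)) ->
  strictly_stationary P Xt ->
  forall A : set (borel (history X)), measurable A ->
    P [set w | A (fun k : nat => Xt (0 + 1 - k%:Z) w)] =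
    P [set w | A (fun k : nat => Xt (0 - k%:Z) w)].
Proof.
move=> cX mX stat A mA.
pose W t (w : O) : (borel X * borel (history X))%type :=
  (Xt t w, fun k : nat => Xt (t - k%:Z) w).
have mW t : measurable_fun setT (W t).
  apply/measurable_fun_pair; first exact: mX.
  by apply: measurable_fun_history => // k; exact: mX.
have mA2 : measurable (snd @^-1` A : set (borel X * borel (history X))).
  by rewrite -[X in measurable X]setTI; exact: measurable_snd.
rewrite -[LHS]/(pushforward P (W (0 + 1)) (snd @^-1` A)).
rewrite -[RHS]/(pushforward P (W 0) (snd @^-1` A)).
move: (snd @^-1` A) mA2; apply: cylinders_measure_eq => //.
  by rewrite -[X in (X < _)%E]/(P setT) probability_setT ltry.
move=> B n C mB mC.
pose s : seq int := [seq - k%:Z | k <- iota 0 n.+1].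
(* At time 0 both [B] and [C 0] constrain the same state. *)
pose D (i : int) : set (borel X) := (if i == 0 then B else setT) `&` C `|i|%N.
have mD i : measurable (D i) by apply: measurableI => //; case: ifP.
have memk k : (k \in iota 0 n.+1) = (k <= n)%N by rewrite mem_iota add0n ltnS.
have cylE h : (W (0 + h) @^-1` cylinder B n C) =
    \big[setI/setT]_(i <- s) (Xt (i + h) @^-1` D i).
  rewrite big_map -bigcap_seq; apply/seteqP; split=> w.
    move=> [Bw Cw] k ks; have kn : (k <= n)%N by rewrite -memk.
    split; first by case: eqP => // /eqP; rewrite oppr_eq0 => /eqP ->; rewrite oppr0.
    by rewrite abszN absz_nat addrC; have := Cw k kn; rewrite /= add0r.
  move=> sw; split.
    have s0 : 0%N \in iota 0 n.+1 by rewrite memk.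
    by have := sw 0%N s0; rewrite /preimage /D oppr0 eqxx => -[].
  move=> k kn; have ks : k \in iota 0 n.+1 by rewrite memk.
  by have [_] := sw k ks; rewrite abszN absz_nat addrC /= add0r.
rewrite -[LHS]/(P (W (0 + 1) @^-1` cylinder B n C)) -[RHS]/(P (W 0 @^-1` cylinder B n C)).
rewrite cylE stat// -[X in W X]addr0 cylE; congr (P _).
by apply: eq_bigr => i _; rewrite addr0.
Qed.

Lemma cond_dist_law (R : realType) (X : pmetricType R) d (O : measurableType d)
    (P : probability O R) d1 (S : measurableType d1) (Z : O -> borel X) (H : O -> S)
    (mu : probability (borel X * S)%type R) (kappa : R.-pker S ~> (borel X)) :
  has_law P (fun w => (Z w, H w)) mu -> cond_dist P H Z kappa ->
  cond_dist mu snd fst kappa.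
Proof.
move=> law HZ B mB; have [mk k0 kE] := HZ B mB; split=> // C mC.
have mC2 : measurable (snd @^-1` C : set (borel X * S)).
  by rewrite -[X in measurable X]setTI; exact: measurable_snd.
have mB2 : measurable (fst @^-1` B : set (borel X * S)).
  by rewrite -[X in measurable X]setTI; exact: measurable_fst.
rewrite (integral_has_law law mC2 (f := fun p => kappa p.2 B))//; last first.
  exact: (measurableT_comp mk measurable_snd).
have [_ <-] := law; last exact: measurableI.
exact: kE.
Qed.

Theorem theorem14 (R : realType) (X Y U : pmetricType R)
  (dV : measure_display) (VT : measurableType dV)
  (G : borel X * VT -> borel Y) (pV : probability VT R)
  (T : R.-pker (borel X) ~> (borel X)) (Q : R.-pker (borel X) ~> (borel Y))
  (c : X -> U -> R)
  (d : measure_display) (O : measurableType d) (P : probability O R)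
  (Xt : int -> O -> borel X) (Vt : int -> O -> VT)
  (mG : measurable_fun setT G)
  (Q_channel : forall (x : borel X) (C : set (borel Y)), measurable C ->
    Q x C = pV [set v | C (G (x, v))])
  (c_ge0 : forall x u, 0 <= c x u)
  (c_bounded : exists M, forall x u, c x u <= M)
  (c_continuous : continuous (fun p : X * U => c p.1 p.2))
  (X_compact : compact [set: X]) (Y_compact : compact [set: Y])
  (U_compact : compact [set: U])
  (T_continuous : weakly_continuous (T : X -> {measure set (borel X) -> \bar R}))
  (Q_continuous : weakly_continuous (Q : X -> {measure set (borel Y) -> \bar R}))
  (process : control_free pV T P Xt Vt)
  (stationary_or_filter : strictly_stationary P Xt \/
    exists kappa : R.-pker (borel (history Y)) ~> (borel X),
      homogeneous_filter G P Xt Vt kappa) :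
  exists mu : probability (borel X * borel (history Y))%type R,
    [/\ invariant_law T Q mu,
        strictly_stationary P Xt -> initial_law G P Xt Vt mu,
        forall kappa : R.-pker (borel (history Y)) ~> (borel X),
          homogeneous_filter G P Xt Vt kappa ->
          cond_dist mu snd fst kappa &
        exists (rho : probability R R)
               (gamma : borel (history Y) * R -> borel U),
          [/\ measurable_fun setT gamma,
              realizable G pV T mu rho &
              optimal_stationary_policy G pV T c mu rho gamma]].
Proof.
have [M cM] := c_bounded.
have c0M x u : 0 <= c x u <= M by rewrite c_ge0 cM.
have sX := compact_second_countable_pmetric X_compact.
have policy mu : invariant_law T Q mu ->
    (exists d1 (O1 : measurableType d1) (P1 : probability O1 R) X1 V1,
      control_free pV T P1 X1 V1 /\ initial_law G P1 X1 V1 mu) ->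
    exists (rho : probability R R) (gamma : borel (history Y) * R -> borel U),
      [/\ measurable_fun setT gamma, realizable G pV T mu rho &
          optimal_stationary_policy G pV T c mu rho gamma].
  move=> mu_inv [d1 [S1 [P1 [X1 [V1 [process1 law1]]]]]].
  have [gamma [mgamma gamma_opt]] := ex_optimal_policy mG Q_channel X_compact
    Y_compact U_compact c0M c_continuous mu_inv.
  exists (\d_(0 : R)), (fun p => gamma p.1); split => //.
    exact: (measurableT_comp mgamma measurable_fst).
  exists d1, S1, P1, X1, V1, (fun _ _ => 0); split => //.
  exact: randomization_cst.
(* The split is on stationarity itself, since in that case the conclusion asks [mu] to be the
   initial law of the given process. *)
have [stat|nstat] := pselect (strictly_stationary P Xt).
  have [mu law] := ex_has_law P (measurable_state_past mG Y_compact process 0).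
  have mX t : measurable_fun setT (Xt t) by exact: state_measurable process t.
  have law1 := has_law_shift mG Q_channel Y_compact process
    (stationary_shift X_compact mX stat) sX law.
  have mu_inv := invariant_law_of_shift mG Q_channel Y_compact process law law1.
  exists mu; split => //.
    by move=> kappa [_ filterP]; exact: cond_dist_law law (filterP 0%N).
  by apply: policy => //; exists d, O, P, Xt, Vt.
have mZt := measurable_shifted_trajectory mG X_compact Y_compact process.
have [m [m_limit m_shift]] := ex_limit_measure (@trajectory_hausdorff R X Y)
  (trajectory_compact X_compact Y_compact) P mZt.
have process' := limit_control_free X_compact T_continuous process m_limit.
pose P' : probability (borel (trajectory X Y) * O)%type R := (m \x P)%E.
have [mu law] := ex_has_law P' (measurable_state_past mG Y_compact process' 0).
have law1 := has_law_shift mG Q_channel Y_compact process'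
  (limit_shift X_compact P m_shift) sX law.
have mu_inv := invariant_law_of_shift mG Q_channel Y_compact process' law law1.
exists mu; split => //.
  move=> kappa filterP; apply: (limit_cond_dist mG Y_compact process m_limit) filterP.
  move=> E mE; have [_ <-//] := law.
  exact: (limit_law mG Q_channel X_compact Y_compact T_continuous Q_continuous process m_limit).
by apply: policy => //; do 5 eexists; split; [exact: process'|exact: law].
Qed.
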